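(* Let $p\in\mathcal{S}_{1,1}$ be even in the $\xi$ variable. Let $0<\varepsilon<1$ be such that $$\sup_\xi\left(\|\partial_x\partial_\xi p(\cdot,\xi)\|_{H^{-\varepsilon}}+\|\partial_x\partial_\xi p(\cdot,\xi)\|_{H^{1+\varepsilon}}\right)<\infty.$$ Let $f\in L^2(\mathbb{R})$. Then $$\|\mathrm{Op}(p)^{skew}f\|_{L^2}\le|||\mathrm{Op}(p)^{skew}|||\,\|f\|_{L^2},$$ where $$|||\mathrm{Op}(p)^{skew}|||\le C\sup_\xi\left(\|\partial_x\partial_\xi p(\cdot,\xi)\|_{\dot H^{-\varepsilon}}+\|\partial_x\partial_\xi p(\cdot,\xi)\|_{H^{1+\varepsilon}}\right).$$
   Context: For a symbol $p(x,\xi)$ on $\mathbb{R}\times\mathbb{R}$, $\mathrm{Op}(p)f(x)=\int_{\mathbb{R}}e^{2\pi ix\xi}p(x,\xi)\hat f(\xi)\,d\xi$ for Schwartz $f$, with $\hat f(\xi)=\int e^{-2\pi ix\xi}f(x)\,dx$ (extended to $L^2$ by density when bounded). $\mathrm{Op}(p)^{skew}=\mathrm{Op}(p)-\mathrm{Op}(p)^T$, where $\mathrm{Op}(p)^T$ is the adjoint with respect to the (real, bilinear) $L^2$ product $\int fg\,dx$. $|||\mathrm{Op}(p)^{skew}|||$ denotes the operator norm bound on $L^2(\mathbb{R})$. $\|p\|_{\alpha,\beta}=\sup_{x,\xi,\ \alpha'\le\alpha,\ \beta'\le\beta}|\partial_x^{\alpha'}\partial_\xi^{\beta'}p(x,\xi)|$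 (distributional derivatives) and $p\in\mathcal{S}_{\alpha,\beta}$ iff $\|p\|_{\alpha,\beta}<\infty$. Sobolev norms are in the variable $x\in\mathbb{R}$; $\dot H^{s}$ is the homogeneous Sobolev space. The constant $C$ does not depend on $p$ or $f$ (it may depend on $\varepsilon$). *)

(* Defs.v *)
From mathcomp Require Import all_boot all_order all_algebra.
From mathcomp Require Import all_classical all_reals all_analysis.
From mathcomp.real_closed Require Import complex.

Set Implicit Arguments.
Unset Strict Implicit.
Unset Printing Implicit Defensive.

Import Order.TTheory GRing.Theory Num.Theory.
Import numFieldNormedType.Exports.

Local Open Scope classical_set_scope.
Local Open Scope ring_scope.
Local Open Scope complex_scope.

(* All functions are complex-valued; the functions in L^2(R) and the symbols on
   R x R are represented by actual functions, so that identities between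
   elements of L^2 are almost-everywhere identities. *)

Section ComplexValued.
Context {d : measure_display} {T : measurableType d} {R : realType}.
Variable mu : {measure set T -> \bar R}.
Implicit Types f g : T -> R[i].

Definition cmeasurable f :=
  measurable_fun [set: T] (fun x => complex.Re (f x)) /\
  measurable_fun [set: T] (fun x => complex.Im (f x)).

Definition cintegrable f :=
  mu.-integrable [set: T] (fun x => (complex.Re (f x))%:E) /\
  mu.-integrable [set: T] (fun x => (complex.Im (f x))%:E).

Definition cint f : R[i] :=
  (\int[mu]_x complex.Re (f x)) +i* (\int[mu]_x complex.Im (f x)).

Definition cLnorm (r : \bar R) f : \bar R :=
  Lnorm mu r (fun x => (Normc.normc (f x))%:E).

Definition ceq_ae f g := {ae mu, forall x, f x = g x}.

End ComplexValued.

Section Line.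
Context {R : realType}.
Implicit Types (f g phi psi : R -> R[i]) (u : R -> R) (s : R).

Definition leb : {measure set (measurableTypeR R) -> \bar R} :=
  @lebesgue_measure R.

Definition expi (t : R) : R[i] := cos t +i* sin t.

Definition L2norm f : \bar R := cLnorm leb 2%:E f.

Definition inL2 f := cmeasurable (f : measurableTypeR R -> R[i]) /\
  (L2norm f < +oo)%E.

Definition rschwartz u :=
  (forall (n : nat) (x : R), derivable (derive1n n u) x 1) /\
  (forall m n : nat, exists M : R, forall x : R,
    `|x ^+ m * derive1n n u x| <= M).

Definition schwartz phi :=
  rschwartz (fun x => complex.Re (phi x)) /\
  rschwartz (fun x => complex.Im (phi x)).

Definition fourier phi (xi : R) : R[i] :=
  cint leb (fun x => expi (- (2 * pi * x * xi)) * phi x).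

(* [G] is a function which is the Fourier transform of the tempered
   distribution [g]. *)
Definition tempered_fourier g (G : R -> R[i]) :=
  forall phi, schwartz phi ->
  [/\ cintegrable leb (fun x => g x * fourier phi x),
      cintegrable leb (fun eta => G eta * phi eta) &
      cint leb (fun eta => G eta * phi eta) =
      cint leb (fun x => g x * fourier phi x)].

(* The L^2 norm of [w] times the Fourier transform of [g]; it is [+oo] when
   this Fourier transform is not a function, as the infimum of the empty set.
   When it is a function, it is unique up to a null set. *)
Definition fourier_weighted_norm (w : R -> R) g : \bar R :=
  ereal_inf [set L2norm (fun eta => (w eta)%:C * G eta)
            | G in tempered_fourier g].

Definition sobolev_norm s g : \bar R :=
  fourier_weighted_norm (fun eta => (1 + eta ^+ 2) `^ (s / 2)) g.

Definition hom_sobolev_norm s g : \bar R :=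
  fourier_weighted_norm (fun eta => `|eta| `^ s) g.

End Line.

Section Plane.
Context {R : realType}.
Implicit Types (phi : R * R -> R) (p q : R * R -> R[i]).

Definition leb2 :
    {measure set (measurableTypeR R * measurableTypeR R)%type -> \bar R} :=
  (@lebesgue_measure R \x @lebesgue_measure R)%E.

Definition partial1 phi : R * R -> R :=
  fun z => derive1 (fun t => phi (t, z.2)) z.1.

Definition partial2 phi : R * R -> R :=
  fun z => derive1 (fun t => phi (z.1, t)) z.2.

Fixpoint Ck (n : nat) phi : Prop :=
  continuous phi /\
  match n with
  | 0%N => True
  | m.+1 =>
    [/\ forall z : R * R, derivable (fun t => phi (t, z.2)) z.1 1,
        forall z : R * R, derivable (fun t => phi (z.1, t)) z.2 1,
        Ck m (partial1 phi) & Ck m (partial2 phi)]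
  end.

Definition test_function phi :=
  (forall n, Ck n phi) /\
  (exists M : R, forall z : R * R, M < `|z.1| \/ M < `|z.2| -> phi z = 0).

Definition clocally_integrable p :=
  cmeasurable (p : measurableTypeR R * measurableTypeR R -> R[i]) /\
  forall M : R,
    (\int[leb2]_(z in `[(- M)%R, M] `*` `[(- M)%R, M])
       (Normc.normc (p z))%:E < +oo)%E.

(* [q] is the distributional derivative of order [a] in the first variable and
   [b] in the second variable of [p]. Real test functions suffice, by
   linearity. *)
Definition weak_derivative (a b : nat) p q :=
  [/\ clocally_integrable p, clocally_integrable q &
      forall phi, test_function phi ->
        cint leb2 (fun z => (iter a partial1 (iter b partial2 phi) z)%:C * p z)
        = (-1) ^+ (a + b) * cint leb2 (fun z => (phi z)%:C * q z)].

(* [+oo] when some distributional derivative is not a bounded function. *)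
Definition symbol_norm (alpha beta : nat) p : \bar R :=
  ereal_sup [set N | exists a b : nat, [/\ (a <= alpha)%N, (b <= beta)%N &
    N = ereal_inf [set cLnorm leb2 +oo%E q | q in weak_derivative a b p]]].

Definition symbol_class (alpha beta : nat) p :=
  (symbol_norm alpha beta p < +oo)%E.

End Plane.

Section Operators.
Context {R : realType}.
Implicit Types (p : R * R -> R[i]) (T : (R -> R[i]) -> R -> R[i]).

(* To be applied to Schwartz functions [f]. *)
Definition Op p (f : R -> R[i]) (x : R) : R[i] :=
  cint leb (fun xi => expi (2 * pi * x * xi) * p (x, xi) * fourier f xi).

(* [h = Op(p)^T f] for the bilinear pairing (no complex conjugation). *)
Definition is_Op_transpose p (f h : R -> R[i]) :=
  inL2 h /\
  forall psi, schwartz psi ->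
    cint leb (fun x => h x * psi x) = cint leb (fun x => f x * Op p psi x).

Definition opnorm T : \bar R :=
  ereal_sup [set L2norm (T f) | f in [set f | inL2 f /\ (L2norm f <= 1)%E]].

Definition L2_bounded_linear T :=
  [/\ forall f, inL2 f -> inL2 (T f),
      forall (a : R[i]) f g, inL2 f -> inL2 g ->
        ceq_ae leb (T (fun x => a * f x + g x)) (fun x => a * T f x + T g x) &
      (opnorm T < +oo)%E].

(* [T] is the continuous extension to L^2 of the operator
   [Op(p) - Op(p)^T] defined on the Schwartz functions; it is unique up to
   almost-everywhere equality since the latter are dense. *)
Definition is_Op_skew p T :=
  L2_bounded_linear T /\
  forall f, schwartz f -> exists h, is_Op_transpose p f h /\
    ceq_ae leb (T f) (fun x => Op p f x - h x).

End Operators.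

(* Main.v *)
(** With F and H the Fourier transforms of Schwartz functions f and g, consider, for 0 <= t <= 1,

      W_t(x, xi) = \int e^{2 pi i x eta} F(xi + t eta) H((1 - t) eta - xi) d eta.

    By Fourier inversion and the evenness of p, pairing p with W_0 and with W_1 gives \int (Op(p) f) g and
    \int f (Op(p) g), up to a constant. Moreover 2 pi i d/dt W_t = d/dx d/dxi W_t, so that the bilinear form of
    the skew part is, up to a constant, the integral over t of the pairings of q = d/dx d/dxi p with W_t.
    On a slice xi = zeta such a pairing is that of the Fourier transform of q(., zeta) with
    F(zeta - t eta) H(-(1 - t) eta - zeta); the Sobolev norm of order 1 + eps and the Cauchy-Schwarz inequality
    bound it by the L^2 norm of (1 + eta^2)^{-(1 + eps)/2} F(zeta + t eta) H((1 - t) eta - zeta).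
    Averaging in zeta against the square of the integrable weight (1 + s^2)^{-(1 + eps)/2}, with Peetre's inequality to separate
    F from H, bounds the integral in zeta by the product of the L^2 norms of f and g. *)

(* The obstacle is that the Sobolev bound on the slices is uniform in the frequency but does not
   decay there, so the Cauchy-Schwarz bounds of the slices cannot be summed as they stand. With k
   the weight, the integral of k(zeta - sigma)^2 over sigma does not depend on zeta; hence the
   integral in zeta is an average over sigma of localized integrals. In each of them Cauchy-Schwarz
   is used in the form J <= l M^2 / 2 + E / (2 l), with l depending on sigma only. The localized
   energy E is at most 4 A B, where A(sigma) and B(sigma) are weighted squared norms of F and H; l
   is taken proportional to A + B, and A and B integrate to multiples of the squared L^2 norms. The
   resulting bound by a sum of squares becomes a product because the form is invariant under f -> s
   f, g -> g / s. Riesz representation then recovers an operator from the form. Weak derivatives fix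
   symbols only up to null sets, hence the truncated representatives. For the transpose to take
   values in L^2, Op(p) f itself must lie in L^2, which follows from the boundedness of the
   frequency derivative of p. *)
Require Import Defs.
From HB Require Import structures.
From mathcomp Require Import all_boot all_order all_algebra.
From mathcomp Require Import all_classical all_reals all_analysis ess_sup_inf measurable_realfun.
From mathcomp Require Import lebesgue_integral_under.
From mathcomp.real_closed Require Import complex.
From mathcomp Require Import ring lra.

Import Order.TTheory GRing.Theory Num.Theory.
Import numFieldNormedType.Exports.

Local Open Scope classical_set_scope.
Local Open Scope ring_scope.
Local Open Scope complex_scope.

(** * Complex-valued integrals *)

Notation cRe := complex.Re.
Notation cIm := complex.Im.
Notation normc := Normc.normc.

Section ComplexNumbers.
Context {R : realType}.
Implicit Types (z w : R[i]) (a : R).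

Lemma cRe_add z w : cRe (z + w) = cRe z + cRe w. Proof. by case: z w => ? ? []. Qed.
Lemma cIm_add z w : cIm (z + w) = cIm z + cIm w. Proof. by case: z w => ? ? []. Qed.
Lemma cRe_opp z : cRe (- z) = - cRe z. Proof. by case: z. Qed.
Lemma cIm_opp z : cIm (- z) = - cIm z. Proof. by case: z. Qed.
Lemma cRe_mul z w : cRe (z * w) = cRe z * cRe w - cIm z * cIm w.
Proof. by case: z w => ? ? []. Qed.
Lemma cIm_mul z w : cIm (z * w) = cRe z * cIm w + cIm z * cRe w.
Proof. by case: z w => ? ? []. Qed.
Lemma cRe_conj z : cRe z^* = cRe z. Proof. by case: z. Qed.
Lemma cIm_conj z : cIm z^* = - cIm z. Proof. by case: z. Qed.

Definition cE := (cRe_add, cIm_add, cRe_opp, cIm_opp, cRe_mul, cIm_mul,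
  cRe_conj, cIm_conj).

Lemma complex_ext z w : cRe z = cRe w -> cIm z = cIm w -> z = w.
Proof. by case: z w => ? ? [] ? ? /= -> ->. Qed.

Lemma conjcM z w : (z * w)^* = z^* * w^*.
Proof. by apply: complex_ext; rewrite !cE; ring. Qed.

Lemma normcE2 z : normc z ^+ 2 = cRe z ^+ 2 + cIm z ^+ 2.
Proof. by case: z => a b /=; rewrite sqr_sqrtr// addr_ge0 ?sqr_ge0. Qed.

Lemma normc_ge0 z : 0 <= normc z.
Proof. by case: z => a b /=; rewrite sqrtr_ge0. Qed.

Lemma ler_normc z b : 0 <= b -> cRe z ^+ 2 + cIm z ^+ 2 <= b ^+ 2 -> normc z <= b.
Proof.
by move=> b0 h; rewrite -(@ler_pXn2r _ 2)// ?nnegrE ?normc_ge0// normcE2.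
Qed.

Lemma normc_ge_cRe z : `|cRe z| <= normc z.
Proof.
rewrite -(@ler_pXn2r _ 2)// ?nnegrE ?normc_ge0//.
by rewrite normcE2 real_normK ?num_real// lerDl sqr_ge0.
Qed.

Lemma normc_ge_cIm z : `|cIm z| <= normc z.
Proof.
rewrite -(@ler_pXn2r _ 2)// ?nnegrE ?normc_ge0//.
by rewrite normcE2 real_normK ?num_real// lerDr sqr_ge0.
Qed.

Lemma normc_le_sum z : normc z <= `|cRe z| + `|cIm z|.
Proof.
apply: ler_normc; first by rewrite addr_ge0.
rewrite sqrrD -!normrX !(ger0_norm (sqr_ge0 _)).
by rewrite -addrA lerD2l lerDr mulrn_wge0// mulr_ge0.
Qed.

Lemma normc_add z w : normc (z + w) <= normc z + normc w.
Proof. exact: le_normcD. Qed.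

Lemma normc_mul z w : normc (z * w) = normc z * normc w.
Proof. exact: Normc.normcM. Qed.

Lemma normc_opp z : normc (- z) = normc z.
Proof. exact: normcN. Qed.

Lemma normc_conj z : normc z^* = normc z.
Proof. by case: z => a b /=; rewrite sqrrN. Qed.

Lemma normc_real a : normc a%:C = `|a|.
Proof. by rewrite /= expr0n addr0 sqrtr_sqr. Qed.

Lemma normc_eq0 z : normc z = 0 -> z = 0.
Proof. exact: Normc.eq0_normc. Qed.

Lemma normc_zero : normc (0 : R[i]) = 0.
Proof. exact: Normc.normc0. Qed.

Lemma normc_expi a : normc (expi a) = 1.
Proof. by rewrite /expi /= cos2Dsin2 sqrtr1. Qed.

Lemma expiD a b : expi (a + b) = expi a * expi b :> R[i].
Proof. by apply: complex_ext; rewrite cE /= ?cosD ?sinD//; ring. Qed.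

Lemma expi0 : expi 0 = 1 :> R[i].
Proof. by rewrite /expi cos0 sin0. Qed.

Lemma conj_expi a : (expi a)^* = expi (- a) :> R[i].
Proof. by rewrite /expi /= cosN sinN. Qed.

Lemma conj_mulE z : z * z^* = (normc z ^+ 2)%:C.
Proof. by rewrite normcE2; case: z => a b; apply: complex_ext => /=; ring. Qed.

End ComplexNumbers.

Section ComplexIntegral.
Context {d : measure_display} {T : measurableType d} {R : realType}.
Variable mu : {measure set T -> \bar R}.
Implicit Types f g : T -> R[i].

Lemma cmeasurable_add f g : cmeasurable f -> cmeasurable g ->
  cmeasurable (fun x => f x + g x).
Proof.
move=> [f1 f2] [g1 g2]; split.
- by under eq_fun do rewrite cE; exact: measurable_funD.
- by under eq_fun do rewrite cE; exact: measurable_funD.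
Qed.

Lemma cmeasurable_mul f g : cmeasurable f -> cmeasurable g ->
  cmeasurable (fun x => f x * g x).
Proof.
move=> [f1 f2] [g1 g2]; split; under eq_fun do rewrite cE.
- by apply: measurable_funB; exact: measurable_funM.
- by apply: measurable_funD; exact: measurable_funM.
Qed.

Lemma cmeasurable_cst (c : R[i]) : cmeasurable (fun _ : T => c).
Proof. by split; exact: measurable_cst. Qed.

Lemma cmeasurable_opp f : cmeasurable f -> cmeasurable (fun x => - f x).
Proof.
by move=> [f1 f2]; split; under eq_fun do rewrite cE; exact: measurable_funN.
Qed.

Lemma cmeasurable_conj f : cmeasurable f -> cmeasurable (fun x => (f x)^*).
Proof.
move=> [f1 f2]; split; under eq_fun do rewrite cE; first by [].
exact: measurable_funN.
Qed.

Lemma cmeasurable_real (u : T -> R) : measurable_fun setT u ->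
  cmeasurable (fun x => (u x)%:C).
Proof. by move=> mu'; split => //=; exact: measurable_cst. Qed.

Lemma measurable_normc f : cmeasurable f ->
  measurable_fun setT (fun x => normc (f x)).
Proof.
move=> [f1 f2].
have -> : (fun x => normc (f x)) =
  (fun x => Num.sqrt (cRe (f x) ^+ 2 + cIm (f x) ^+ 2)).
  by apply/funext => x; case: (f x).
apply: measurableT_comp; first exact: continuous_measurable_fun (@sqrt_continuous _).
by apply: measurable_funD; exact: measurable_funX.
Qed.

Lemma measurable_enormc f : cmeasurable f ->
  measurable_fun setT (fun x => (normc (f x))%:E).
Proof. by move=> /measurable_normc h; exact/measurable_EFinP. Qed.

Lemma cintegrable_cmeasurable f : cintegrable mu f -> cmeasurable f.
Proof.
by move=> [/measurable_int/measurable_EFinP ? /measurable_int/measurable_EFinP ?].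
Qed.

Lemma cintegrable_dom f (g : T -> R) : cmeasurable f ->
  mu.-integrable setT (EFin \o g) -> (forall x, normc (f x) <= g x) ->
  cintegrable mu f.
Proof.
move=> [f1 f2] ig fg; split; apply: le_integrable ig => //.
- exact/measurable_EFinP.
- move=> x _ /=; rewrite lee_fin (le_trans (normc_ge_cRe _))//.
  by rewrite (le_trans (fg x))// ler_norm.
- exact/measurable_EFinP.
- move=> x _ /=; rewrite lee_fin (le_trans (normc_ge_cIm _))//.
  by rewrite (le_trans (fg x))// ler_norm.
Qed.

Lemma integrable_normc f : cintegrable mu f ->
  mu.-integrable setT (fun x => (normc (f x))%:E).
Proof.
move=> [f1 f2]; have := integrableD measurableT (integrable_abse f1) (integrable_abse f2).
apply: le_integrable => //.
  apply: measurable_enormc; apply: cintegrable_cmeasurable; split => //.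
move=> x _ /=; rewrite lee_fin ger0_norm ?normc_ge0//.
by rewrite (le_trans (normc_le_sum _))// ler_norm.
Qed.

Lemma cintegrableP f : cintegrable mu f <->
  cmeasurable f /\ (\int[mu]_x (normc (f x))%:E < +oo)%E.
Proof.
split=> [fi|[mf ifin]].
  split; first exact: cintegrable_cmeasurable fi.
  have /integrableP[_] := integrable_normc f fi; apply: le_lt_trans.
  by rewrite le_eqVlt; apply/orP; left; apply/eqP; apply: eq_integral => x _;
    rewrite gee0_abs ?lee_fin ?normc_ge0.
apply: (cintegrable_dom _ (fun x => normc (f x))) => //.
apply/integrableP; split; first exact: measurable_enormc.
apply: le_lt_trans ifin; rewrite le_eqVlt; apply/orP; left; apply/eqP.
by apply: eq_integral => x _; rewrite /= ger0_norm ?normc_ge0.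
Qed.

Lemma cintegrable_domc f g : cmeasurable f -> cintegrable mu g ->
  (forall x, normc (f x) <= normc (g x)) -> cintegrable mu f.
Proof. by move=> mf /integrable_normc ig fg; exact: cintegrable_dom ig fg. Qed.

Lemma cintegrable_add f g : cintegrable mu f -> cintegrable mu g ->
  cintegrable mu (fun x => f x + g x).
Proof.
move=> [f1 f2] [g1 g2]; split; under eq_fun do rewrite cE EFinD.
- exact: integrableD.
- exact: integrableD.
Qed.

Lemma cintegrable_boundedM f g (K : R) : cmeasurable f -> cintegrable mu g ->
  (forall x, normc (f x) <= K) -> cintegrable mu (fun x => f x * g x).
Proof.
move=> mf ig fK.
apply: (cintegrable_dom _ (fun x => K * normc (g x))).
- by apply: cmeasurable_mul => //; exact: cintegrable_cmeasurable ig.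
- rewrite (_ : _ \o _ = (fun x => K%:E * (normc (g x))%:E)%E).
    by apply: integrableZl => //; exact: integrable_normc.
  by apply/funext => x /=; rewrite EFinM.
- by move=> x; rewrite normc_mul ler_wpM2r ?normc_ge0.
Qed.

Lemma cintegrable_scale f (c : R[i]) : cintegrable mu f ->
  cintegrable mu (fun x => c * f x).
Proof.
by move=> ?; apply: (cintegrable_boundedM (fun=> c) f (normc c)) => //; exact: cmeasurable_cst.
Qed.

Lemma cintegrable_opp f : cintegrable mu f -> cintegrable mu (fun x => - f x).
Proof.
move=> [f1 f2]; split; under eq_fun do rewrite cE EFinN.
- exact: integrableN.
- exact: integrableN.
Qed.

Lemma cint_add f g : cintegrable mu f -> cintegrable mu g ->
  cint mu (fun x => f x + g x) = cint mu f + cint mu g.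
Proof.
move=> [f1 f2] [g1 g2]; rewrite /cint; apply: complex_ext => /=.
- by rewrite -RintegralD//; apply: eq_Rintegral => x _; rewrite cE.
- by rewrite -RintegralD//; apply: eq_Rintegral => x _; rewrite cE.
Qed.

Lemma cint_opp f : cintegrable mu f -> cint mu (fun x => - f x) = - cint mu f.
Proof.
move=> [f1 f2]; rewrite /cint; apply: complex_ext => /=.
- by rewrite -[RHS]mulN1r -RintegralZl//; apply: eq_Rintegral => x _; rewrite cE mulN1r.
- by rewrite -[RHS]mulN1r -RintegralZl//; apply: eq_Rintegral => x _; rewrite cE mulN1r.
Qed.

Lemma cint_sub f g : cintegrable mu f -> cintegrable mu g ->
  cint mu (fun x => f x - g x) = cint mu f - cint mu g.
Proof.
by move=> hf hg; rewrite cint_add ?cint_opp//; exact: cintegrable_opp.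
Qed.

Lemma integrable_scaler (u : T -> R) (a : R) :
  mu.-integrable setT (EFin \o u) ->
  mu.-integrable setT (EFin \o (fun x => a * u x)).
Proof.
move=> iu; rewrite (_ : _ \o _ = (fun x => a%:E * (EFin \o u) x)%E).
  exact: integrableZl.
by apply/funext => x /=; rewrite EFinM.
Qed.

Lemma cint_scale f (c : R[i]) : cintegrable mu f ->
  cint mu (fun x => c * f x) = c * cint mu f.
Proof.
move=> [f1 f2]; rewrite /cint; case: c => a b; apply: complex_ext => /=.
- rewrite -!RintegralZl// -RintegralB; [|by []|exact: integrable_scaler..].
  by apply: eq_Rintegral => x _; case: (f x).
- rewrite -!RintegralZl// -RintegralD; [|by []|exact: integrable_scaler..].
  by apply: eq_Rintegral => x _; case: (f x).
Qed.

Lemma cint_conj f : cintegrable mu f -> cint mu (fun x => (f x)^*) = (cint mu f)^*.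
Proof.
move=> [f1 f2]; apply: complex_ext => /=; first by apply: eq_Rintegral => x _; rewrite cE.
rewrite -[RHS]mulN1r -RintegralZl//; apply: eq_Rintegral => x _.
by rewrite cE mulN1r.
Qed.

Lemma eq_cint f g : f =1 g -> cint mu f = cint mu g.
Proof. by move=> fg; congr cint; exact/funext. Qed.

Lemma cint_real (u : T -> R) : cint mu (fun x => (u x)%:C) = (\int[mu]_x u x)%:C.
Proof.
apply: complex_ext => //=.
by rewrite /Rintegral integral0.
Qed.

Lemma Rintegral_ae_eq (u v : T -> R) : measurable_fun setT u -> measurable_fun setT v ->
  {ae mu, forall x, u x = v x} -> \int[mu]_x u x = \int[mu]_x v x.
Proof.
move=> m1 m2 uv; congr fine; apply: ae_eq_integral => //; try exact/measurable_EFinP.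
by apply: filterS uv => x -> _.
Qed.

Lemma cint_ae_eq f g : cmeasurable f -> cmeasurable g -> ceq_ae mu f g ->
  cint mu f = cint mu g.
Proof.
move=> [f1 f2] [g1 g2] fg; apply: complex_ext => /=; apply: Rintegral_ae_eq => //.
- by apply: filterS fg => x ->.
- by apply: filterS fg => x ->.
Qed.

(** Multiplying by the conjugate of the integral [I] turns [normc I ^+ 2] into the real part of an
    integral, to which the monotonicity of real integrals applies. *)
Lemma normc_cint_le f : cintegrable mu f ->
  normc (cint mu f) <= \int[mu]_x normc (f x).
Proof.
move=> fi; set I := cint mu f.
have J0 : 0 <= \int[mu]_x normc (f x) by apply: Rintegral_ge0 => x _; exact: normc_ge0.
have [->//|I0] := eqVneq (normc I) 0.
have I1 : 0 < normc I by rewrite lt_neqAle eq_sym I0 normc_ge0.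
rewrite -(ler_pM2l I1) -expr2.
have -> : normc I ^+ 2 = cRe (cint mu (fun x => I^* * f x)).
  by rewrite cint_scale// mulrC conj_mulE.
have cfi := cintegrable_scale f I^* fi.
rewrite -RintegralZl//; last exact: integrable_normc.
apply: le_Rintegral => //; first by case: cfi.
  by apply: integrable_scaler; exact: integrable_normc.
move=> x _; rewrite -normc_conj -normc_mul.
exact: le_trans (ler_norm _) (normc_ge_cRe _).
Qed.

Lemma normc_cint_le_dom f (g : T -> R) : cmeasurable f ->
  mu.-integrable setT (EFin \o g) -> (forall x, normc (f x) <= g x) ->
  normc (cint mu f) <= \int[mu]_x g x.
Proof.
move=> mf ig fg; have fi := cintegrable_dom f g mf ig fg.
apply: (le_trans (normc_cint_le f fi)); apply: le_Rintegral => //.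
exact: integrable_normc.
Qed.

End ComplexIntegral.

(** * Fubini, affine changes of variables, dominated convergence *)

Section Fubini.
Context {d1 d2 : measure_display} {T1 : measurableType d1}
  {T2 : measurableType d2} {R : realType}.
Variable m1 : {sigma_finite_measure set T1 -> \bar R}.
Variable m2 : {sigma_finite_measure set T2 -> \bar R}.

Local Notation mm := (m1 \x m2)%E.

(** The inner integrals in Fubini's theorem are extended reals, finite only almost everywhere; this
    allows replacing them by their real values. *)
Lemma fineK_ae (mu : {measure set T1 -> \bar R}) (F : T1 -> \bar R) :
  mu.-integrable setT F ->
  mu.-integrable setT (EFin \o (fine \o F)) /\
  \int[mu]_x (fine \o F) x = fine (\int[mu]_x F x).
Proof.
move=> iF; have mF := measurable_int _ iF.
have mfF : measurable_fun setT (EFin \o (fine \o F)).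
  by apply/measurable_EFinP; exact: measurableT_comp.
have aeF : {ae mu, forall x, F x = (EFin \o (fine \o F)) x}.
  have := integrable_ae measurableT iF; apply: filterS => x h /=.
  by rewrite fineK// h.
split.
  apply/integrableP; split=> //; have /integrableP[_] := iF; apply: le_lt_trans.
  apply: ae_ge0_le_integral => //; try exact: measurableT_comp.
  by apply: filterS aeF => x <-.
congr fine; apply: ae_eq_integral => //.
by apply: filterS aeF => x -> _.
Qed.

Lemma Rintegral_fubini (u : T1 * T2 -> R) : mm.-integrable setT (EFin \o u) ->
  m1.-integrable setT (EFin \o (fun x => \int[m2]_y u (x, y))) /\
  \int[mm]_z u z = \int[m1]_x \int[m2]_y u (x, y).
Proof.
move=> iu.
have [h1 h2] := fineK_ae m1 _ (integrable_fubini_F iu).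
split; first exact: h1.
by rewrite {1}/Rintegral -integral12_prod_meas1// -h2.
Qed.

Lemma cint_fubini (f : T1 * T2 -> R[i]) : cintegrable mm f ->
  cintegrable m1 (fun x => cint m2 (fun y => f (x, y))) /\
  cint mm f = cint m1 (fun x => cint m2 (fun y => f (x, y))).
Proof.
move=> [f1 f2].
have [a1 a2] := Rintegral_fubini _ f1.
have [b1 b2] := Rintegral_fubini _ f2.
by split; [split|rewrite /cint a2 b2].
Qed.

Lemma integrable_tensor (g : T1 -> R) (h : T2 -> R) :
  m1.-integrable setT (EFin \o g) -> m2.-integrable setT (EFin \o h) ->
  mm.-integrable setT (EFin \o (fun z => g z.1 * h z.2)).
Proof.
move=> ig ih.
have mg : measurable_fun setT g by apply/measurable_EFinP; exact: measurable_int ig.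
have mh : measurable_fun setT h by apply/measurable_EFinP; exact: measurable_int ih.
have mgh : measurable_fun setT (EFin \o (fun z : T1 * T2 => g z.1 * h z.2)).
  apply/measurable_EFinP; apply: measurable_funM.
    exact: (measurableT_comp mg).
  exact: (measurableT_comp mh).
apply/(integrable12ltyP _ _ mgh) => /=.
under eq_integral => x _.
  under eq_integral do rewrite normrM EFinM.
  rewrite ge0_integralZl//; last by apply/measurable_EFinP; exact: measurableT_comp.
  over.
have /integrableP[_ fg] := ig; have /integrableP[_ fh] := ih.
rewrite ge0_integralZr//; last 2 first.
  by apply/measurable_EFinP; exact: measurableT_comp.
  by apply: integral_ge0 => x _; rewrite lee_fin.
by rewrite lte_mul_pinfty// ?integral_ge0// ge0_fin_numE// integral_ge0.
Qed.

Lemma cintegrable_tensor_dom (f : T1 * T2 -> R[i]) (g : T1 -> R) (h : T2 -> R) :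
  cmeasurable f ->
  m1.-integrable setT (EFin \o g) -> m2.-integrable setT (EFin \o h) ->
  (forall x y, normc (f (x, y)) <= g x * h y) -> cintegrable mm f.
Proof.
move=> mf ig ih fgh; apply: (cintegrable_dom _ _ (fun z => g z.1 * h z.2)) => //.
  exact: integrable_tensor.
by move=> [x y]; exact: fgh.
Qed.

Lemma cmeasurable_slice (f : T1 * T2 -> R[i]) x : cmeasurable f ->
  cmeasurable (fun y => f (x, y)).
Proof.
by move=> [f1 f2]; split;
  [exact: (measurableT_comp f1 (measurable_pair1 x))|exact: (measurableT_comp f2 (measurable_pair1 x))].
Qed.

(** Tonelli's theorem makes the integrals of the positive and negative parts measurable in the
    parameter, whether or not they are finite; their difference is then measurable in the extended
    reals. *)
Lemma measurable_Rint_param (u : T1 * T2 -> R) : measurable_fun setT u ->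
  measurable_fun setT (fun x => \int[m2]_y u (x, y)).
Proof.
move=> mu; apply: measurableT_comp => //.
pose F x := (\int[m2]_y (EFin \o u)^\+ (x, y))%E.
pose G x := (\int[m2]_y (EFin \o u)^\- (x, y))%E.
have mEu : measurable_fun setT (EFin \o u) by exact/measurable_EFinP.
have mF : measurable_fun setT F.
  by apply: measurable_fun_fubini_tonelli_F => //; exact: measurable_funepos.
have mG : measurable_fun setT G.
  by apply: measurable_fun_fubini_tonelli_F => //; exact: measurable_funeneg.
rewrite (_ : (fun _ => _) = (fun x => F x - G x)%E); first exact: emeasurable_funB.
apply/funext => x; rewrite integralE; congr (_ - _)%E; apply: eq_integral => y _.
  by rewrite !funeposE.
by rewrite !funenegE.
Qed.

Lemma cmeasurable_cint_param (f : T1 * T2 -> R[i]) : cmeasurable f ->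
  cmeasurable (fun x => cint m2 (fun y => f (x, y))).
Proof.
by move=> [f1 f2]; split; [exact: (measurable_Rint_param _ f1)|exact: (measurable_Rint_param _ f2)].
Qed.

End Fubini.

Section FubiniSwap.
Context {d1 d2 : measure_display} {T1 : measurableType d1}
  {T2 : measurableType d2} {R : realType}.
Variable m1 : {sigma_finite_measure set T1 -> \bar R}.
Variable m2 : {sigma_finite_measure set T2 -> \bar R}.

Lemma cintegrable_swap (f : T1 * T2 -> R[i]) : cintegrable (m1 \x m2)%E f ->
  cintegrable (m2 \x m1)%E (fun z => f (z.2, z.1)).
Proof.
move=> [f1 f2].
have mE (u : T1 * T2 -> R) : (m1 \x m2)%E.-integrable setT (EFin \o u) ->
    (m2 \x m1)%E.-integrable setT (EFin \o (fun z => u (z.2, z.1))).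
  move=> iu; have mu := measurable_int _ iu.
  have mv : measurable_fun setT (EFin \o (fun z : T2 * T1 => u (z.2, z.1))).
    apply: (measurableT_comp mu); exact: measurable_swap.
  apply/(integrable12ltyP _ _ mv).
  by have /(integrable21ltyP _ _ mu) := iu.
by split; [exact: (mE _ f1)|exact: (mE _ f2)].
Qed.

Lemma cint_fubini_swap (f : T1 * T2 -> R[i]) : cintegrable (m1 \x m2)%E f ->
  cint m1 (fun x => cint m2 (fun y => f (x, y))) =
  cint m2 (fun y => cint m1 (fun x => f (x, y))).
Proof.
move=> fi; rewrite -(cint_fubini _ _ _ fi).2.
have E (u : T1 * T2 -> R) : (m1 \x m2)%E.-integrable setT (EFin \o u) ->
   \int[(m1 \x m2)%E]_z u z = \int[m2]_y \int[m1]_x u (x, y).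
  move=> iu; rewrite {1}/Rintegral -integral21_prod_meas1//.
  have iG : m2.-integrable setT (fubini_G m1 (EFin \o u)).
    have mu := measurable_int _ iu; apply/integrableP; split.
      exact: (measurable_fubini_G iu).
    have /(integrable21ltyP _ _ mu) := iu; apply: le_lt_trans.
    apply: ge0_le_integral => //.
    - by apply: measurableT_comp => //; exact: (measurable_fubini_G iu).
    - apply: (measurable_fun_fubini_tonelli_G (abse \o (EFin \o u))) => //=.
      exact: measurableT_comp.
    - move=> x _; apply: le_abse_integral => //.
      exact: (measurableT_comp mu (measurable_pair2 _)).
  by rewrite -(fineK_ae m2 _ iG).2.
by case: fi => f1 f2; rewrite /cint !E.
Qed.

End FubiniSwap.

Section Affine.
Context {R : realType}.
Local Notation mu := (@leb R).
Implicit Types a b : R.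

Lemma measurable_affine a b :
  measurable_fun setT (fun x : measurableTypeR R => a * x + b : measurableTypeR R).
Proof. by apply: measurable_funD => //; exact: measurable_funM. Qed.

(** The push-forward of Lebesgue measure under [x -> a x + b], multiplied by [|a|], agrees with
    Lebesgue measure on half-open intervals, hence everywhere by uniqueness. The formula is then the
    change of variables for a push-forward. *)
Lemma ge0_integral_affine a b (f : R -> \bar R) : a != 0 ->
  measurable_fun (setT : set (measurableTypeR R)) f -> (forall x, (0 <= f x)%E) ->
  (\int[mu]_x f x = `|a|%:E * \int[mu]_x f (a * x + b)%R)%E.
Proof.
move=> a0 mf f0.
have na : 0 <= `|a| by [].
pose k := NngNum na.
have mphi := measurable_affine a b.
pose phi' : {mfun _ >-> _} := HB.pack (fun x : measurableTypeR R => a * x + b : measurableTypeR R) (isMeasurableFun.Build _ _ _ _ _ mphi).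
pose m' : {measure set (measurableTypeR R) -> \bar R} :=
  mscale k (pushforward mu phi').
have mE : forall A, measurable A -> @lebesgue_measure R A = m' mphi A.
  apply: lebesgue_measure_unique => _ [[u v]] /= _ <-.
  rewrite /m' /= /mscale /= /pushforward.
  have [a_gt0|a_lt0] : 0 < a \/ a < 0 by apply/orP; rewrite -neq_lt eq_sym in a0 *.
  - rewrite (_ : _ @^-1` _ = ([set` `]((u - b) / a), ((v - b) / a)]])%R); last first.
      apply/seteqP; split=> x /=; rewrite !in_itv/=;
       rewrite ltr_pdivrMr// ler_pdivlMr// ltrBlDr lerBrDr [x * a]mulrC; by [].
    rewrite /leb !lebesgue_measure_itv/= !lte_fin ltr_pM2r ?invr_gt0// ltrD2r.
    case: ifP => _; last by rewrite mule0.
    rewrite -EFinM gtr0_norm//; congr EFin; field; exact: lt0r_neq0.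
  (* A negative [a] exchanges the endpoints, and the preimage of a left-open interval is
     right-open. *)
  - rewrite (_ : _ @^-1` _ = ([set` `[((v - b) / a), ((u - b) / a)[])%R); last first.
      apply/seteqP; split=> x /=; rewrite !in_itv/=;
       rewrite ler_ndivrMr// ltr_ndivlMr// ltrBlDr lerBrDr [x * a]mulrC andbC; by [].
    rewrite /leb !lebesgue_measure_itv/= !lte_fin ltr_nM2r ?invr_lt0// ltrD2r.
    case: ifP => _; last by rewrite mule0.
    rewrite -EFinM ltr0_norm//; congr EFin; field; exact: ltr0_neq0.
rewrite (eq_measure_integral (m' mphi)); last by move=> A mA _; exact: mE.
rewrite ge0_integral_mscale//; congr (_ * _)%E.
by rewrite ge0_integral_pushforward.
Qed.

Lemma integrable_affine a b (u : R -> R) : a != 0 ->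
  mu.-integrable setT (EFin \o u) ->
  mu.-integrable setT (EFin \o (fun x => u (a * x + b))).
Proof.
move=> a0 iu; have mu' := measurable_int _ iu; apply/integrableP; split.
  exact: (measurableT_comp mu' (measurable_affine a b)).
have /integrableP[_] := iu.
rewrite (ge0_integral_affine a b)//; last exact: measurableT_comp.
have a1 : (0 < `|a|%:E)%E by rewrite lte_fin normr_gt0.
move=> h; rewrite ltey; apply: contra_ltN h => /eqP /= ->.
by rewrite gt0_muley.
Qed.

Lemma Rintegral_affine a b (u : R -> R) : a != 0 ->
  mu.-integrable setT (EFin \o u) ->
  \int[mu]_x u (a * x + b) = `|a|^-1 * \int[mu]_x u x.
Proof.
move=> a0 iu; have mu' := measurable_int _ iu.
have a1 : `|a| != 0 by rewrite normr_eq0.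
rewrite /Rintegral [X in _ = _ * fine X]integralE.
rewrite (ge0_integral_affine a b _ a0 (measurable_funepos mu'))//.
rewrite (ge0_integral_affine a b _ a0 (measurable_funeneg mu'))//.
have iv := integrable_affine a b u a0 iu.
rewrite integralE.
have f1 := integrable_fin_num measurableT (integrable_funepos measurableT iv).
have f2 := integrable_fin_num measurableT (integrable_funeneg measurableT iv).
have -> : (\int[mu]_x (EFin \o u)^\+ (a * x + b)%R =
    \int[mu]_x (EFin \o (fun x0 : R => u (a * x0 + b)%R))^\+ x)%E.
  by apply: eq_integral => x _; rewrite !funeposE.
have -> : (\int[mu]_x (EFin \o u)^\- (a * x + b)%R =
    \int[mu]_x (EFin \o (fun x0 : R => u (a * x0 + b)%R))^\- x)%E.
  by apply: eq_integral => x _; rewrite !funenegE.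
by rewrite -(fineK f1) -(fineK f2) -!EFinM -!EFinB /= -mulrBr mulKf.
Qed.

Lemma cintegrable_affine a b (f : R -> R[i]) : a != 0 -> cintegrable mu f ->
  cintegrable mu (fun x => f (a * x + b)).
Proof.
by move=> a0 [f1 f2]; split; [exact: (integrable_affine _ _ _ a0 f1)|exact: (integrable_affine _ _ _ a0 f2)].
Qed.

Lemma cint_affine a b (f : R -> R[i]) : a != 0 -> cintegrable mu f ->
  cint mu (fun x => f (a * x + b)) = (`|a|^-1)%:C * cint mu f.
Proof.
move=> a0 [f1 f2]; rewrite /cint (Rintegral_affine a b (fun x => cRe (f x)))//.
rewrite (Rintegral_affine a b (fun x => cIm (f x)))//.
by apply: complex_ext => /=; ring.
Qed.

Lemma cint_shift b (f : R -> R[i]) : cintegrable mu f ->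
  cint mu (fun x => f (x + b)) = cint mu f.
Proof.
move=> fi; have := cint_affine 1 b f (oner_neq0 _) fi.
by rewrite normr1 invr1 mul1r; under eq_cint do rewrite mul1r.
Qed.

Lemma cint_reflect b (f : R -> R[i]) : cintegrable mu f ->
  cint mu (fun x => f (b - x)) = cint mu f.
Proof.
move=> fi; have N1 : (-1 : R) != 0 by rewrite oppr_eq0 oner_eq0.
have := cint_affine (-1) b f N1 fi.
rewrite normrN1 invr1 mul1r => <-; apply: eq_cint => x; congr f; ring.
Qed.

End Affine.

Section Dominated.
Context {d : measure_display} {T : measurableType d} {R : realType}.
Variable mu : {measure set T -> \bar R}.

Lemma Rintegral_dominated_cvg (u : nat -> T -> R) (v g : T -> R) :
  (forall n, measurable_fun setT (u n)) -> measurable_fun setT v ->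
  mu.-integrable setT (EFin \o g) ->
  (forall n x, `|u n x| <= g x) ->
  {ae mu, forall x, u n x @[n --> \oo] --> v x} ->
  \int[mu]_x u n x @[n --> \oo] --> \int[mu]_x v x.
Proof.
move=> mu_ mv ig ug uv.
have [||||iv _ h] := @dominated_convergence _ _ _ mu setT measurableT
  (fun n => EFin \o u n) (EFin \o v) (EFin \o g) _ _ _ ig.
- by move=> n; exact/measurable_EFinP.
- exact/measurable_EFinP.
- by apply: filterS uv => x hx _; apply: cvg_EFin => //; exact: nearW.
- by apply: aeW => x n _; rewrite lee_fin.
apply: fine_cvg; rewrite fineK; last exact: integrable_fin_num.
exact: h.
Qed.

Definition ccvg (z : nat -> R[i]) (l : R[i]) :=
  (cRe (z n) @[n --> \oo] --> cRe l) /\ (cIm (z n) @[n --> \oo] --> cIm l).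

Lemma cint_dominated_cvg (f : nat -> T -> R[i]) (h : T -> R[i]) (g : T -> R) :
  (forall n, cmeasurable (f n)) -> cmeasurable h ->
  mu.-integrable setT (EFin \o g) ->
  (forall n x, normc (f n x) <= g x) ->
  {ae mu, forall x, ccvg (f ^~ x) (h x)} ->
  ccvg (fun n => cint mu (f n)) (cint mu h).
Proof.
move=> mf [h1 h2] ig fg fh; split => /=; apply: (@Rintegral_dominated_cvg _ _ g) => //.
- by move=> n; case: (mf n).
- by move=> n x; exact: le_trans (normc_ge_cRe _) (fg n x).
- by apply: filterS fh => x [].
- by move=> n; case: (mf n).
- by move=> n x; exact: le_trans (normc_ge_cIm _) (fg n x).
- by apply: filterS fh => x [].
Qed.

End Dominated.

Section ComplexLimits.
Context {R : realType}.
Implicit Types (z w : nat -> R[i]) (l m : R[i]).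

Lemma ccvg_unique z l m : ccvg z l -> ccvg z m -> l = m.
Proof.
by move=> [a1 a2] [b1 b2]; apply: complex_ext; [apply: cvg_unique a1 b1|apply: cvg_unique a2 b2].
Qed.

Lemma ccvg_cst l : ccvg (fun=> l) l.
Proof. by split; exact: cvg_cst. Qed.

Lemma ccvg_mul z w l m : ccvg z l -> ccvg w m -> ccvg (fun n => z n * w n) (l * m).
Proof.
move=> [a1 a2] [b1 b2]; split; under eq_fun do rewrite cE; rewrite cE.
  by apply: cvgB; exact: cvgM.
by apply: cvgD; exact: cvgM.
Qed.

Lemma ccvg_real (x : nat -> R) (a : R) : x n @[n --> \oo] --> a ->
  ccvg (fun n => (x n)%:C) a%:C.
Proof. by move=> h; split => //=; exact: cvg_cst. Qed.

End ComplexLimits.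

(** * Derivatives of complex-valued functions *)

Section RealDerivatives.
Context {R : realType}.
Implicit Types (u v : R -> R) (x a b : R).

Lemma isdD u v x a b : is_derive x 1 u a -> is_derive x 1 v b ->
  is_derive x 1 (fun t => u t + v t) (a + b).
Proof. by move=> hu hv; exact: is_deriveD. Qed.

Lemma isdN u x a : is_derive x 1 u a -> is_derive x 1 (fun t => - u t) (- a).
Proof. by move=> hu; exact: is_deriveN. Qed.

Lemma isdB u v x a b : is_derive x 1 u a -> is_derive x 1 v b ->
  is_derive x 1 (fun t => u t - v t) (a - b).
Proof. by move=> hu hv; exact: is_deriveB. Qed.

Lemma isdM u v x a b : is_derive x 1 u a -> is_derive x 1 v b ->
  is_derive x 1 (fun t => u t * v t) (u x * b + v x * a).
Proof. by move=> hu hv; exact: is_deriveM. Qed.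

Lemma isd_cst c x : is_derive x (1 : R) (fun _ : R => c : R) 0.
Proof. exact: is_derive_cst. Qed.

Lemma isd_affine a b x : is_derive x (1 : R) (fun t : R => a * t + b) a.
Proof.
apply: (@is_derive_eq _ _ _ _ _ _ _ (x * 0 * 0 + (a * 1 + x * 0) + 0)); last by ring.
have h : is_derive x (1:R) (fun t : R => a * t + b) (a * 1 + x * 0 + 0).
  by apply: isdD (isd_cst b x); apply: isdM (isd_cst a x) (is_derive_id _ _).
by apply: is_derive_eq h _; ring.
Qed.

Lemma isd_comp u v x a b : is_derive (v x) 1 u a -> is_derive x 1 v b ->
  is_derive x 1 (fun t => u (v t)) (b * a).
Proof.
move=> hu hv; have := @is_derive1_comp _ u v x a b hu hv.
by rewrite mulrC.
Qed.

Lemma isd_ext u v x a b : is_derive x 1 u a -> u =1 v -> a = b ->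
  is_derive x 1 v b.
Proof. by move=> h /funext <- <-. Qed.

Lemma isd_derive1 u x a : is_derive x 1 u a -> derive1 u x = a.
Proof. by move=> h; rewrite derive1E; exact: derive_val. Qed.

Lemma derivable_isd u x : derivable u x 1 -> is_derive x 1 u (derive1 u x).
Proof. by move=> h; rewrite derive1E; exact: DeriveDef. Qed.

Lemma isd_continuous u : (forall x, derivable u x 1) -> continuous u.
Proof. by move=> h x; apply/differentiable_continuous/derivable1_diffP/h. Qed.

Lemma isd_lipschitz u (u' : R -> R) (M : R) : (forall x, is_derive x 1 u (u' x)) ->
  (forall x, `|u' x| <= M) -> forall x y, `|u y - u x| <= M * `|y - x|.
Proof.
move=> hu uM x y; wlog xy : x y / x <= y => [h|].
  by case/orP: (le_total x y) => /h// ; rewrite distrC [X in M * X]distrC.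
have [|c _ ->] := @MVT_segment _ u u' x y xy (fun z _ => hu z).
  by apply: continuous_subspaceT; apply: isd_continuous => z; case: (hu z).
by rewrite normrM ler_wpM2r.
Qed.

End RealDerivatives.

Section ComplexDerivatives.
Context {R : realType}.
Implicit Types (f g : R -> R[i]) (x a b : R) (z w : R[i]).

Definition cderiv f x z :=
  is_derive x 1 (fun t => cRe (f t)) (cRe z) /\
  is_derive x 1 (fun t => cIm (f t)) (cIm z).

Lemma cderiv_ext f g x z w : cderiv f x z -> f =1 g -> z = w -> cderiv g x w.
Proof. by move=> h /funext <- <-. Qed.

Lemma cderiv_add f g x z w : cderiv f x z -> cderiv g x w ->
  cderiv (fun t => f t + g t) x (z + w).
Proof.
move=> [a1 a2] [b1 b2]; split; rewrite cE.
  by apply: isd_ext (isdD _ _ _ _ _ a1 b1) _ _ => // t; rewrite cE.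
by apply: isd_ext (isdD _ _ _ _ _ a2 b2) _ _ => // t; rewrite cE.
Qed.

Lemma cderiv_mul f g x z w : cderiv f x z -> cderiv g x w ->
  cderiv (fun t => f t * g t) x (z * g x + f x * w).
Proof.
move=> [a1 a2] [b1 b2]; split.
  apply: isd_ext (isdB _ _ _ _ _ (isdM _ _ _ _ _ a1 b1) (isdM _ _ _ _ _ a2 b2)) _ _ => //.
    by move=> t; rewrite cE.
  by rewrite !cE; ring.
apply: isd_ext (isdD _ _ _ _ _ (isdM _ _ _ _ _ a1 b2) (isdM _ _ _ _ _ a2 b1)) _ _ => //.
  by move=> t; rewrite cE.
by rewrite !cE; ring.
Qed.

Lemma cderiv_cst w x : cderiv (fun=> w) x 0.
Proof. by split; exact: isd_cst. Qed.

Lemma cderiv_scale w f x z : cderiv f x z -> cderiv (fun t => w * f t) x (w * z).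
Proof.
move=> h; apply: cderiv_ext (cderiv_mul _ _ _ _ _ (cderiv_cst w x) h) _ _ => //.
by rewrite mul0r add0r.
Qed.

Lemma cderiv_conj f x z : cderiv f x z -> cderiv (fun t => (f t)^*) x z^*.
Proof.
move=> [a1 a2]; split; rewrite cE.
  by apply: isd_ext a1 _ _ => // t; rewrite cE.
by apply: isd_ext (isdN _ _ _ a2) _ _ => // t; rewrite cE.
Qed.

Lemma cderiv_real (u : R -> R) x a : is_derive x 1 u a ->
  cderiv (fun t => (u t)%:C) x a%:C.
Proof. by move=> h; split => //=; exact: isd_cst. Qed.

Lemma cderiv_affine f a b x z : cderiv f (a * x + b) z ->
  cderiv (fun t => f (a * t + b)) x (a%:C * z).
Proof.
move=> [a1 a2]; split.
  apply: isd_ext (isd_comp (fun t => cRe (f t)) (fun t => a * t + b) _ _ _ a1 (isd_affine a b x)) _ _ => //.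
  by rewrite cE /= mul0r subr0.
apply: isd_ext (isd_comp (fun t => cIm (f t)) (fun t => a * t + b) _ _ _ a2 (isd_affine a b x)) _ _ => //.
by rewrite cE /= mul0r addr0.
Qed.

Lemma cderiv_expi a x : cderiv (fun t => expi (a * t)) x ((0 +i* a) * expi (a * x)).
Proof.
have h : is_derive x (1 : R) (fun t => a * t) a.
  by apply: isd_ext (isd_affine a 0 x) _ _ => // t; rewrite addr0.
split; rewrite cE /=.
  apply: isd_ext (isd_comp _ _ _ _ _ (is_derive_cos _) h) _ _ => //; ring.
apply: isd_ext (isd_comp _ _ _ _ _ (is_derive_sin _) h) _ _ => //; ring.
Qed.

(** The mean value theorem is available for the real and imaginary parts separately; adding the two
    bounds produces the factor 2. *)
Lemma cderiv_lipschitz f f' (M : R) : (forall x, cderiv f x (f' x)) ->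
  (forall x, normc (f' x) <= M) ->
  forall x y, normc (f y - f x) <= 2 * M * `|y - x|.
Proof.
move=> hf fM x y; apply: (le_trans (normc_le_sum _)).
rewrite !cE -mulrA mulr_natl mulr2n lerD//.
  apply: (isd_lipschitz (fun t => cRe (f t)) (fun t => cRe (f' t))) => t; first by case: (hf t).
  exact: le_trans (normc_ge_cRe _) (fM t).
apply: (isd_lipschitz (fun t => cIm (f t)) (fun t => cIm (f' t))) => t; first by case: (hf t).
exact: le_trans (normc_ge_cIm _) (fM t).
Qed.

Lemma cderiv_cmeasurable f f' : (forall x, cderiv f x (f' x)) ->
  cmeasurable (f : measurableTypeR R -> R[i]).
Proof.
move=> hf; split; apply: continuous_measurable_fun; apply: isd_continuous => x.
  by case: (hf x) => [[]].
by case: (hf x) => _ [].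
Qed.

Lemma cmeasurable_expi a : cmeasurable (fun x : measurableTypeR R => expi (a * x)).
Proof. exact: cderiv_cmeasurable (cderiv_expi a). Qed.

Lemma cderiv_unique f x z w : cderiv f x z -> cderiv f x w -> z = w.
Proof.
move=> [a1 a2] [b1 b2]; apply: complex_ext.
  by rewrite -(isd_derive1 _ _ _ a1) -(isd_derive1 _ _ _ b1).
by rewrite -(isd_derive1 _ _ _ a2) -(isd_derive1 _ _ _ b2).
Qed.

Section UnderIntegral.
Context {d : measure_display} {Y : measurableType d}.
Variable mu : {measure set Y -> \bar R}.

(** Domination is asked only on an open interval around the point, since the kernels differentiated
    below are dominated for bounded parameters only. *)
Lemma cderiv_cint (F F' : R -> Y -> R[i]) (G : Y -> R) (x0 a b : R) :
  x0 \in `]a, b[ ->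
  (forall x, x \in `]a, b[ -> cintegrable mu (F x)) ->
  (forall x y, x \in `]a, b[ -> cderiv (F ^~ y) x (F' x y)) ->
  mu.-integrable setT (EFin \o G) ->
  (forall x y, x \in `]a, b[ -> normc (F' x y) <= G y) ->
  cderiv (fun x => cint mu (F x)) x0 (cint mu (F' x0)).
Proof.
move=> x0ab iF dF iG FG.
have G0 y : 0 <= G y by apply: le_trans (FG x0 y x0ab); exact: normc_ge0.
have iF1 x : `]a, b[%classic x -> mu.-integrable setT (EFin \o (fun y => cRe (F x y))).
  by move=> /iF [].
have iF2 x : `]a, b[%classic x -> mu.-integrable setT (EFin \o (fun y => cIm (F x y))).
  by move=> /iF [].
have d1 x y : `]a, b[%classic x -> setT y -> derivable ((fun x y => cRe (F x y))^~ y) x 1.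
  by move=> xab _; case: (dF x y xab) => [[]].
have d2 x y : `]a, b[%classic x -> setT y -> derivable ((fun x y => cIm (F x y))^~ y) x 1.
  by move=> xab _; case: (dF x y xab) => _ [].
have b1 x y : `]a, b[%classic x -> setT y ->
    `|partial1of2 (fun x y => cRe (F x y)) x y| <= G y.
  move=> xab _; rewrite /partial1of2 (isd_derive1 _ _ _ (dF x y xab).1).
  exact: le_trans (normc_ge_cRe _) (FG x y xab).
have b2 x y : `]a, b[%classic x -> setT y ->
    `|partial1of2 (fun x y => cIm (F x y)) x y| <= G y.
  move=> xab _; rewrite /partial1of2 (isd_derive1 _ _ _ (dF x y xab).2).
  exact: le_trans (normc_ge_cIm _) (FG x y xab).
split => /=.
  apply: isd_ext (derivable_isd _ _ (derivable_under_integral measurableT x0ab iF1 d1 G0 iG b1)) _ _ => //.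
  rewrite (differentiation_under_integral measurableT x0ab iF1 d1 G0 iG b1).
  by apply: eq_Rintegral => y _; exact: isd_derive1 (dF x0 y x0ab).1.
apply: isd_ext (derivable_isd _ _ (derivable_under_integral measurableT x0ab iF2 d2 G0 iG b2)) _ _ => //.
rewrite (differentiation_under_integral measurableT x0ab iF2 d2 G0 iG b2).
by apply: eq_Rintegral => y _; exact: isd_derive1 (dF x0 y x0ab).2.
Qed.

Lemma cderiv_cintT (F F' : R -> Y -> R[i]) (G : Y -> R) (x0 : R) :
  (forall x, cintegrable mu (F x)) ->
  (forall x y, cderiv (F ^~ y) x (F' x y)) ->
  mu.-integrable setT (EFin \o G) ->
  (forall x y, normc (F' x y) <= G y) ->
  cderiv (fun x => cint mu (F x)) x0 (cint mu (F' x0)).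
Proof.
move=> iF dF iG FG; apply: (cderiv_cint _ _ G x0 (x0 - 1) (x0 + 1)) => //.
by rewrite in_itv/= ltrBlDr ltrDl ltr01.
Qed.

End UnderIntegral.

End ComplexDerivatives.

(** * The integrable majorant 1 / (1 + x^2) *)

Section InverseSquareWeight.
Context {R : realType}.

(** The common majorant in all dominations: Schwartz functions on the line are bounded by a multiple
    of it, and the interpolating kernels by a multiple of the product of two copies. *)
Definition isq (x : R) : R := (1 + x ^+ 2)^-1.

Lemma isq_gt0 x : 0 < isq x.
Proof. by rewrite invr_gt0 ltr_pwDl// sqr_ge0. Qed.

Lemma isq_ge0 x : 0 <= isq x.
Proof. exact/ltW/isq_gt0. Qed.

Lemma measurable_isq : measurable_fun setT (isq : measurableTypeR R -> R).
Proof. exact: continuous_measurable_fun (@continuous_oneDsqrV R). Qed.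

(** The reflection [x -> - x] carries the negative half-line into the positive one, where the
    integral is finite by assumption. *)
Lemma integrable_even (u : R -> R) : measurable_fun setT (u : measurableTypeR R -> R) -> (forall x, 0 <= u x) ->
  (forall x, u (- x) = u x) -> (\int[leb]_(x in `[0%R, +oo[) (u x)%:E < +oo)%E ->
  leb.-integrable setT (EFin \o u).
Proof.
move=> mu u0 ue h0; have m0 : measurable_fun setT (fun x : measurableTypeR R => (u x)%:E) by exact/measurable_EFinP.
apply/integrableP; split=> //; under eq_integral => x _ do rewrite /= ger0_norm ?u0//.
rewrite -(setUv `[(0 : R), +oo[%classic) ge0_integral_setU//=; last 4 first.
- exact: measurableC.
- by rewrite setUv.
- by move=> x _; rewrite lee_fin u0.
- by rewrite disj_set2E setICr.
rewrite lte_add_pinfty//; apply: le_lt_trans h0.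
rewrite integral_mkcond [leRHS]integral_mkcond (ge0_integral_affine (-1) 0).
- rewrite normrN1 mul1e; apply: ge0_le_integral => //.
  + by move=> x _; rewrite /patch; case: ifP => // _; rewrite lee_fin u0.
  + apply: (measurableT_comp _ (measurable_affine (-1) 0)).
    by apply/(measurable_restrictT _ _).1; [exact: measurableC|exact: measurable_funTS].
  + by apply/(measurable_restrictT _ _).1 => //; exact: measurable_funTS.
  + move=> x _; rewrite /patch.
    have -> : u (-1 * x + 0) = u x by rewrite mulN1r addr0 ue.
    case: ifPn => [|_]; last by case: ifP => // _; rewrite lee_fin u0.
    rewrite inE /= in_itv/= andbT => /negP; rewrite -ltNge mulN1r addr0 oppr_lt0 => x0.
    by rewrite ifT// inE /= in_itv/= andbT ltW.
- by rewrite oppr_eq0 oner_eq0.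
- by apply/(measurable_restrictT _ _).1; [exact: measurableC|exact: measurable_funTS].
- by move=> x; rewrite /patch; case: ifP => // _; rewrite lee_fin u0.
Qed.

Lemma integrable_isq : leb.-integrable setT (EFin \o isq).
Proof.
apply: integrable_even; [exact: measurable_isq|exact: isq_ge0| |].
  by move=> x; rewrite /isq sqrrN.
by rewrite [ltLHS](@integral0y_oneDsqr R) ltry.
Qed.

Lemma integrable_cisq (K : R) : leb.-integrable setT (EFin \o (fun x : R => K * isq x)).
Proof. exact/integrable_scaler/integrable_isq. Qed.

End InverseSquareWeight.

(** * Schwartz functions and their Fourier transforms *)

Section SchwartzClass.
Context {R : realType}.
Implicit Types (f g : R -> R[i]) (x a b : R).

(** With [1 + |x|] in place of [|x|], the bound of order [m] controls all lower orders and is stable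
    under affine substitutions. *)
Definition rapid f := forall m : nat, exists M : R, forall x,
  (1 + `|x|) ^+ m * normc (f x) <= M.

Lemma rapid_pow f : (forall m : nat, exists M : R, forall x, `|x| ^+ m * normc (f x) <= M) ->
  rapid f.
Proof.
move=> h m; have [M hM] := h m; have [M0 hM0] := h 0%N.
exists (2 ^+ m * (M0 + M)) => x; have [x1|x1] := leP `|x| 1.
  apply: (@le_trans _ _ (2 ^+ m * normc (f x))).
    by rewrite ler_wpM2r ?normc_ge0// lerXn2r ?nnegrE ?addr_ge0//; lra.
  rewrite ler_wpM2l ?exprn_ge0//; have := hM0 x; rewrite expr0 mul1r => /le_trans; apply.
  by rewrite lerDl (le_trans _ (hM x))// mulr_ge0 ?normc_ge0// exprn_ge0.
apply: (@le_trans _ _ ((2 * `|x|) ^+ m * normc (f x))).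
  by rewrite ler_wpM2r ?normc_ge0// lerXn2r ?nnegrE ?addr_ge0 ?mulr_ge0//; lra.
rewrite exprMn -mulrA ler_wpM2l ?exprn_ge0// (le_trans (hM x))// lerDr.
by have := hM0 x; rewrite expr0 mul1r; apply: le_trans; exact: normc_ge0.
Qed.

Lemma rapid_bound f : rapid f -> exists2 M : R, 0 <= M & forall x, normc (f x) <= M.
Proof.
move=> /(_ 0%N)[M hM]; exists M; last by move=> x; have := hM x; rewrite expr0 mul1r.
by apply: le_trans (hM 0); rewrite expr0 mul1r normc_ge0.
Qed.

(** A coinductive form of the Schwartz property: in a set of rapidly decreasing functions stable
    under differentiation, iterated derivatives never leave the set, so each of them decreases
    rapidly ([schwartz_of_class]). *)
Definition schwartz_class (P : (R -> R[i]) -> Prop) := forall f, P f ->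
  rapid f /\ exists2 f', P f' & forall x, cderiv f x (f' x).

Lemma schwartz_of_class P f : schwartz_class P -> P f -> schwartz f.
Proof.
move=> HP Pf.
have H n : exists g, [/\ P g, derive1n n (fun x => cRe (f x)) = (fun x => cRe (g x)) &
    derive1n n (fun x => cIm (f x)) = (fun x => cIm (g x))].
  elim: n => [|n [g [Pg g1 g2]]]; first by exists f.
  have [_ [g' Pg' dg]] := HP _ Pg; exists g'; split => //.
    by rewrite derive1nS g1; apply/funext => x; exact: isd_derive1 (dg x).1.
  by rewrite derive1nS g2; apply/funext => x; exact: isd_derive1 (dg x).2.
have norm_le g m M x : (forall x, (1 + `|x|) ^+ m * normc (g x) <= M) ->
    forall r, `|r| <= normc (g x) -> `|x ^+ m * r| <= M.
  move=> hM r rg; rewrite normrM normrX; apply: le_trans (hM x).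
  by rewrite ler_pM ?exprn_ge0// lerXn2r ?nnegrE ?addr_ge0// lerDr.
split; split.
- move=> n x; have [g [Pg -> _]] := H n; have [_ [g' _ dg]] := HP _ Pg.
  by case: (dg x) => [[]].
- move=> m n; have [g [Pg -> _]] := H n; have [/(_ m)[M hM] _] := HP _ Pg.
  by exists M => x; apply: norm_le hM _ _; exact: normc_ge_cRe.
- move=> n x; have [g [Pg _ ->]] := H n; have [_ [g' _ dg]] := HP _ Pg.
  by case: (dg x) => _ [].
- move=> m n; have [g [Pg _ ->]] := H n; have [/(_ m)[M hM] _] := HP _ Pg.
  by exists M => x; apply: norm_le hM _ _; exact: normc_ge_cIm.
Qed.

Lemma derive1n_shift n (u : R -> R) : derive1n n (derive1 u) = derive1n n.+1 u.
Proof. by rewrite /derive1n iterSr. Qed.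

Lemma rschwartz_derive1 (u : R -> R) : rschwartz u -> rschwartz (derive1 u).
Proof.
move=> [h1 h2]; split.
- by move=> n x; rewrite derive1n_shift; exact: h1.
- by move=> m n; have [M hM] := h2 m n.+1; exists M => x; rewrite derive1n_shift.
Qed.

Lemma schwartz_schwartz_class : schwartz_class schwartz.
Proof.
move=> f [s1 s2]; split.
  apply: rapid_pow => m.
  have [M1 h1] := s1.2 m 0%N; have [M2 h2] := s2.2 m 0%N.
  exists (M1 + M2) => x; apply: (@le_trans _ _ (`|x| ^+ m * (`|cRe (f x)| + `|cIm (f x)|))).
    by rewrite ler_wpM2l ?exprn_ge0// normc_le_sum.
  by rewrite mulrDr -normrX -!normrM lerD.
exists (fun x => derive1 (fun x => cRe (f x)) x +i* derive1 (fun x => cIm (f x)) x).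
  by split; exact: rschwartz_derive1.
by move=> x; split; apply: derivable_isd; [exact: (s1.1 0%N)|exact: (s2.1 0%N)].
Qed.

Lemma schwartz_rapid f : schwartz f -> rapid f.
Proof. by move=> /schwartz_schwartz_class[]. Qed.

Lemma schwartz_deriv f : schwartz f -> exists2 f', schwartz f' & forall x, cderiv f x (f' x).
Proof. by move=> /schwartz_schwartz_class[]. Qed.

(** The derivative of each constructor is a combination of constructors. Closing under all the
    operations at once therefore gives a set stable under differentiation, and every stability
    property of Schwartz functions follows from one induction. *)
Inductive schwartz_hull : (R -> R[i]) -> Prop :=
| hull_base f : schwartz f -> schwartz_hull f
| hull_add f g : schwartz_hull f -> schwartz_hull g -> schwartz_hull (fun x => f x + g x)
| hull_scale c f : schwartz_hull f -> schwartz_hull (fun x => c * f x)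
| hull_mulx f : schwartz_hull f -> schwartz_hull (fun x => x%:C * f x)
| hull_affine a b f : a != 0 -> schwartz_hull f -> schwartz_hull (fun x => f (a * x + b))
| hull_expi a f : schwartz_hull f -> schwartz_hull (fun x => expi (a * x) * f x)
| hull_conj f : schwartz_hull f -> schwartz_hull (fun x => (f x)^*)
| hull_mul f g : schwartz_hull f -> schwartz_hull g -> schwartz_hull (fun x => f x * g x).

Lemma onePnorm_affine a b x : a != 0 ->
  1 + `|x| <= (1 + (1 + `|b|) / `|a|) * (1 + `|a * x + b|).
Proof.
move=> a0; have a1 : 0 < `|a| by rewrite normr_gt0.
set y := a * x + b; have -> : x = (y - b) / a by rewrite /y; field.
rewrite normf_div; apply: (@le_trans _ _ (1 + (`|y| + `|b|) / `|a|)).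
  by rewrite lerD2l ler_wpM2r ?invr_ge0// ler_normB.
set z := `|a|^-1; have z0 : 0 <= z by rewrite invr_ge0.
have : 0 <= `|y| := normr_ge0 _; have : 0 <= `|b| := normr_ge0 _.
move: `|y| `|b| => s t t0 s0.
have -> : (1 + (1 + t) * z) * (1 + s) = 1 + (s + t) * z + (s + z + t * s * z) by ring.
by rewrite lerDl !addr_ge0 ?mulr_ge0.
Qed.

Lemma hull_class : schwartz_class schwartz_hull.
Proof.
move=> f; elim=> {f}.
- move=> f sf; split; first exact: schwartz_rapid.
  by have [f' sf' df] := schwartz_deriv f sf; exists f' => //; exact: hull_base.
- move=> f g _ [rf [f' hf' df]] _ [rg [g' hg' dg]]; split.
    move=> m; have [M1 h1] := rf m; have [M2 h2] := rg m; exists (M1 + M2) => x.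
    apply: (@le_trans _ _ ((1 + `|x|) ^+ m * (normc (f x) + normc (g x)))).
      by rewrite ler_wpM2l ?normc_add// exprn_ge0// addr_ge0.
    by rewrite mulrDr lerD.
  by exists (fun x => f' x + g' x); [exact: hull_add|move=> x; exact: cderiv_add].
- move=> c f _ [rf [f' hf' df]]; split.
    move=> m; have [M1 h1] := rf m; exists (normc c * M1) => x.
    by rewrite normc_mul mulrCA ler_wpM2l ?normc_ge0.
  by exists (fun x => c * f' x); [exact: hull_scale|move=> x; exact: cderiv_scale].
- move=> f hf [rf [f' hf' df]]; split.
    move=> m; have [M1 h1] := rf m.+1; exists M1 => x; apply: le_trans (h1 x).
    rewrite normc_mul normc_real exprS mulrA ler_wpM2r ?normc_ge0// mulrC.
    by rewrite ler_wpM2r ?exprn_ge0 ?addr_ge0// lerDr.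
  exists (fun x => f x + x%:C * f' x); first by apply: hull_add => //; exact: hull_mulx.
  move=> x; apply: cderiv_ext (cderiv_mul _ _ _ _ _ (cderiv_real id x 1 (is_derive_id _ _)) (df x)) _ _ => //.
  by rewrite mul1r.
- move=> a b f a0 _ [rf [f' hf' df]]; split.
    move=> m; have [M1 h1] := rf m; exists ((1 + (1 + `|b|) / `|a|) ^+ m * M1) => x.
    apply: (@le_trans _ _ (((1 + (1 + `|b|) / `|a|) * (1 + `|a * x + b|)) ^+ m * normc (f (a * x + b)))).
      rewrite ler_wpM2r ?normc_ge0// lerXn2r ?nnegrE ?onePnorm_affine ?mulr_ge0 ?addr_ge0 ?divr_ge0 ?addr_ge0//.
    by rewrite exprMn -mulrA ler_wpM2l ?exprn_ge0 ?addr_ge0 ?divr_ge0 ?addr_ge0.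
  exists (fun x => a%:C * f' (a * x + b)); first by apply: hull_scale; exact: hull_affine.
  by move=> x; exact: cderiv_affine.
- move=> a f hf [rf [f' hf' df]]; split.
    move=> m; have [M1 h1] := rf m; exists M1 => x.
    by rewrite normc_mul normc_expi mul1r.
  exists (fun x => (0 +i* a) * (expi (a * x) * f x) + expi (a * x) * f' x).
    by apply: hull_add; [apply: hull_scale; exact: hull_expi|exact: hull_expi].
  move=> x; apply: cderiv_ext (cderiv_mul _ _ _ _ _ (cderiv_expi a x) (df x)) _ _ => //.
  by rewrite mulrA.
- move=> f _ [rf [f' hf' df]]; split.
    by move=> m; have [M1 h1] := rf m; exists M1 => x; rewrite normc_conj.
  by exists (fun x => (f' x)^*); [exact: hull_conj|move=> x; exact: cderiv_conj].
- move=> f g hf [rf [f' hf' df]] hg [rg [g' hg' dg]]; split.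
    move=> m; have [M1 h1] := rf m; have [M2 M20 h2] := rapid_bound g rg; exists (M1 * M2) => x.
    by rewrite normc_mul mulrA ler_pM ?normc_ge0 ?mulr_ge0 ?normc_ge0// exprn_ge0 ?addr_ge0.
  exists (fun x => f' x * g x + f x * g' x).
    by apply: hull_add; exact: hull_mul.
  by move=> x; exact: cderiv_mul.
Qed.

Lemma hull_schwartz f : schwartz_hull f -> schwartz f.
Proof. exact: schwartz_of_class hull_class. Qed.

Lemma schwartz_add f g : schwartz f -> schwartz g -> schwartz (fun x => f x + g x).
Proof. by move=> hf hg; apply: hull_schwartz; apply: hull_add; exact: hull_base. Qed.

Lemma schwartz_scale c f : schwartz f -> schwartz (fun x => c * f x).
Proof. by move=> hf; apply: hull_schwartz; apply: hull_scale; exact: hull_base. Qed.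

Lemma schwartz_mulx f : schwartz f -> schwartz (fun x => x%:C * f x).
Proof. by move=> hf; apply: hull_schwartz; apply: hull_mulx; exact: hull_base. Qed.

Lemma schwartz_affine a b f : a != 0 -> schwartz f -> schwartz (fun x => f (a * x + b)).
Proof. by move=> a0 hf; apply: hull_schwartz; apply: hull_affine => //; exact: hull_base. Qed.

Lemma schwartz_expi a f : schwartz f -> schwartz (fun x => expi (a * x) * f x).
Proof. by move=> hf; apply: hull_schwartz; apply: hull_expi; exact: hull_base. Qed.

Lemma schwartz_conj f : schwartz f -> schwartz (fun x => (f x)^*).
Proof. by move=> hf; apply: hull_schwartz; apply: hull_conj; exact: hull_base. Qed.

Lemma schwartz_mul f g : schwartz f -> schwartz g -> schwartz (fun x => f x * g x).
Proof. by move=> hf hg; apply: hull_schwartz; apply: hull_mul; exact: hull_base. Qed.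

Lemma schwartz_cmeasurable f : schwartz f -> cmeasurable (f : measurableTypeR R -> R[i]).
Proof. by move=> /schwartz_deriv[f' _ df]; exact: cderiv_cmeasurable df. Qed.

Lemma rapid_isq f : rapid f -> exists2 M : R, 0 <= M & forall x, normc (f x) <= M * isq x.
Proof.
move=> /(_ 2%N)[M hM]; exists M.
  by apply: le_trans (hM 0); rewrite mulr_ge0 ?normc_ge0// sqr_ge0.
move=> x; rewrite /isq ler_pdivlMr ?ltr_pwDl ?sqr_ge0//; apply: le_trans (hM x).
rewrite mulrC ler_wpM2r ?normc_ge0// -[x ^+ 2]ger0_norm ?sqr_ge0// normrX.
by have := normr_ge0 x; nra.
Qed.

Lemma schwartz_cintegrable f : schwartz f -> cintegrable leb f.
Proof.
move=> sf; have [M M0 hM] := rapid_isq f (schwartz_rapid f sf).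
exact: cintegrable_dom (schwartz_cmeasurable f sf) (integrable_cisq M) hM.
Qed.

(** The integral of the translate [f (x + h)] does not depend on [h]; differentiating it at [h = 0]
    under the integral sign gives the integral of [f']. *)
Lemma cint_deriv_schwartz f f' : schwartz f -> schwartz f' ->
  (forall x, cderiv f x (f' x)) -> cint leb f' = 0.
Proof.
move=> sf sf' df.
have fi := schwartz_cintegrable f sf; have fi' := schwartz_cintegrable f' sf'.
have [M M0 hM] := rapid_isq f' (schwartz_rapid f' sf').
have h : cderiv (fun h => cint leb (fun x => f (x + h))) 0 (cint leb (fun x => f' (x + 0))).
  apply: (cderiv_cint leb (fun h x => f (x + h)) (fun h x => f' (x + h)) (fun x => (4 * M) * isq x) 0 (-1) 1).
  - by rewrite in_itv/=; lra.
  - move=> a _; have := cintegrable_affine 1 a f (oner_neq0 _) fi.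
    by congr cintegrable; apply/funext => x; rewrite mul1r.
  - move=> a x _; apply: cderiv_ext (cderiv_affine f 1 x a _ (df _)) _ _.
      by move=> t; rewrite mul1r addrC.
    by rewrite !mul1r addrC.
  - exact: integrable_cisq.
  (* For [|a| < 1] a translation by [a] costs at most a factor 4 in [isq], by [(3 x + 4 a) ^ 2 >= 0]
     and [a ^ 2 <= 1]. *)
  - move=> a x; rewrite in_itv/= => /andP[a1 a2]; apply: (le_trans (hM _)).
    rewrite mulrAC [M * _]mulrC ler_wpM2r// /isq.
    rewrite -[4]invrK -invfM lef_pV2 ?posrE ?mulr_gt0 ?ltr_pwDl ?sqr_ge0//.
    have : 0 <= (1 - a) * (1 + a) by apply: mulr_ge0; lra.
    have : 0 <= (3 * x + 4 * a : R) ^+ 2 by rewrite sqr_ge0.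
    by move: (x : R) => y; lra.
have h0 : cderiv (fun h => cint leb (fun x => f (x + h))) 0 0.
  by apply: cderiv_ext (cderiv_cst (cint leb f) 0) _ _ => // t /=; rewrite cint_shift.
have := cderiv_unique _ _ _ _ h h0.
by under eq_cint do rewrite addr0.
Qed.

End SchwartzClass.

Section FourierSchwartz.
Context {R : realType}.
Implicit Types (f g : R -> R[i]) (x a b : R).

Lemma normc_imc a : normc (0 +i* a : R[i]) = `|a|.
Proof. by rewrite /= expr0n add0r sqrtr_sqr. Qed.

Lemma imcM a b : (0 +i* (a * b)) = (0 +i* a) * b%:C :> R[i].
Proof. by apply: complex_ext; rewrite cE /=; ring. Qed.

Lemma fourierE f xi : fourier f xi = cint leb (fun x => expi (- (2 * pi * xi) * x) * f x).
Proof. by apply: eq_cint => x; congr (expi _ * _); ring. Qed.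

Lemma cintegrable_expi a f : cintegrable leb f ->
  cintegrable leb (fun x => expi (a * x) * f x).
Proof.
move=> fi; apply: (cintegrable_boundedM _ _ _ 1 _ fi); first exact: cmeasurable_expi.
by move=> x; rewrite normc_expi.
Qed.

Lemma fourier_bound f xi : cintegrable leb f ->
  normc (fourier f xi) <= \int[leb]_x normc (f x).
Proof.
move=> fi; rewrite fourierE.
apply: (le_trans (normc_cint_le _ _ (cintegrable_expi _ f fi))).
by under eq_Rintegral do rewrite normc_mul normc_expi mul1r.
Qed.

Lemma fourier_scale c f : schwartz f ->
  fourier (fun x => c * f x) =1 (fun xi => c * fourier f xi).
Proof.
move=> sf xi; rewrite !fourierE -cint_scale; last exact/cintegrable_expi/schwartz_cintegrable.
by apply: eq_cint => x; ring.
Qed.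

Lemma fourier_add f g : schwartz f -> schwartz g ->
  fourier (fun x => f x + g x) =1 (fun xi => fourier f xi + fourier g xi).
Proof.
move=> sf sg xi; rewrite !fourierE -cint_add; try exact/cintegrable_expi/schwartz_cintegrable.
by apply: eq_cint => x; ring.
Qed.

Lemma cderiv_fourier f xi : schwartz f ->
  cderiv (fourier f) xi (fourier (fun x => (0 +i* (- (2 * pi))) * (x%:C * f x)) xi).
Proof.
move=> sf; have sxf := schwartz_mulx f sf.
have [M M0 hM] := rapid_isq _ (schwartz_rapid _ sxf).
pose F (xi x : R) : R[i] := expi ((- (2 * pi) * x) * xi) * f x.
pose F' (xi x : R) : R[i] := ((0 +i* (- (2 * pi) * x)) * expi ((- (2 * pi) * x) * xi)) * f x.
apply: (@cderiv_ext _ (fun xi => cint leb (F xi)) _ _ (cint leb (F' xi))).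
- apply: (cderiv_cintT leb F F' (fun x => (2 * pi * M) * isq x)).
  + move=> a; have := cintegrable_expi (- (2 * pi * a)) f (schwartz_cintegrable f sf).
    by congr cintegrable; apply/funext => x; congr (expi _ * _); ring.
  + move=> a x; rewrite /F /F'.
    apply: cderiv_ext (cderiv_mul _ _ _ _ _ (cderiv_expi (- (2 * pi) * x) a) (cderiv_cst (f x) a)) _ _ => //.
    by rewrite mulr0 addr0.
  + exact: integrable_cisq.
  + move=> a x; rewrite /F' imcM.
    have -> : (0 +i* (- (2 * pi))) * x%:C * expi (- (2 * pi) * x * a) * f x =
      (0 +i* (- (2 * pi))) * (expi (- (2 * pi) * x * a) * (x%:C * f x)) by ring.
    rewrite 2!normc_mul normc_expi mul1r normc_imc normrN ger0_norm ?mulr_ge0 ?pi_ge0//.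
    by rewrite -mulrA ler_wpM2l// mulr_ge0 ?pi_ge0.
- by move=> a; apply: eq_cint => x; rewrite /F; congr (expi _ * _); ring.
- apply: eq_cint => x; rewrite /F'.
  have -> : - (2 * pi) * x * xi = - (2 * pi * x * xi) by ring.
  by rewrite imcM; ring.
Qed.

(** Integration by parts: the derivative of [expi (a x) f x] has integral zero. *)
Lemma fourier_deriv f f' xi : schwartz f -> schwartz f' ->
  (forall x, cderiv f x (f' x)) ->
  fourier f' xi = (0 +i* (2 * pi * xi)) * fourier f xi.
Proof.
move=> sf sf' df; set a := - (2 * pi * xi).
have h : cint leb (fun x => (0 +i* a) * (expi (a * x) * f x) + expi (a * x) * f' x) = 0.
  apply: (cint_deriv_schwartz (fun x => expi (a * x) * f x)).
  - exact: schwartz_expi.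
  - by apply: schwartz_add; [apply: schwartz_scale; exact: schwartz_expi|exact: schwartz_expi].
  - move=> x; apply: cderiv_ext (cderiv_mul _ _ _ _ _ (cderiv_expi a x) (df x)) _ _ => //.
    by rewrite mulrA.
have i1 := cintegrable_expi a f (schwartz_cintegrable f sf).
have i2 := cintegrable_expi a f' (schwartz_cintegrable f' sf').
move: h; rewrite cint_add//; last exact: cintegrable_scale.
rewrite cint_scale// !fourierE -/a => /eqP; rewrite addrC addr_eq0 => /eqP ->.
rewrite -mulNr; congr (_ * _); apply: complex_ext => /=; rewrite /a; ring.
Qed.

(** Each factor [|xi|] is traded for one derivative of [f]; when none is left, the transform is
    bounded by the L^1 norm. *)
Lemma rapid_fourier f : schwartz f -> rapid (fourier f).
Proof.
move=> sf; apply: rapid_pow => m; elim: m f sf => [|m IH] f sf.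
  exists (\int[leb]_x normc (f x)) => x; rewrite expr0 mul1r.
  exact/fourier_bound/schwartz_cintegrable.
have [f' sf' df] := schwartz_deriv f sf; have [M hM] := IH f' sf'.
exists ((2 * pi)^-1 * M) => x; rewrite ler_pdivlMl ?mulr_gt0 ?pi_gt0//.
apply: le_trans (hM x); rewrite (fourier_deriv f f')// normc_mul.
rewrite normc_imc normrM [`|2 * pi|]ger0_norm ?mulr_ge0 ?pi_ge0//.
by rewrite exprSr le_eqVlt; apply/orP; left; apply/eqP; ring.
Qed.

(** The transforms of Schwartz functions form a stable set, the derivative of a transform being the
    transform of [- 2 pi i x f]. *)
Lemma schwartz_fourier f : schwartz f -> schwartz (fourier f).
Proof.
move=> sf; pose P g := exists2 f : R -> R[i], schwartz f & g = fourier f.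
apply: (@schwartz_of_class _ P); last by exists f.
move=> _ [g sg ->]; split; first exact: rapid_fourier.
exists (fourier (fun x => (0 +i* (- (2 * pi))) * (x%:C * g x))).
  by exists (fun x => (0 +i* (- (2 * pi))) * (x%:C * g x)) => //; apply: schwartz_scale; exact: schwartz_mulx.
by move=> x; exact: cderiv_fourier.
Qed.

End FourierSchwartz.

(** * Bump functions and Fourier inversion *)

Section Bump.
Context {R : realType}.
Implicit Types (P Q : {poly R}) (x y n l r : R).

(** The classical smooth functions with all derivatives zero at the origin. The polynomial in
    [1 / x] makes the family stable under differentiation. *)
Definition flat P x : R := if 0 < x then P.[x^-1] * expR (- x^-1) else 0.

Lemma pow_expRN_le (k : nat) y : 0 <= y -> y ^+ k * expR (- y) <= k`!%:R.
Proof.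
move=> y0; rewrite expRN ler_pdivrMr ?expR_gt0//; case: k => [|k].
  by rewrite expr0 fact0 mul1r (le_trans _ (expR_ge1Dx y))// lerDl.
rewrite mulrC -ler_pdivrMr ?ltr0n ?fact_gt0//.
by apply: le_trans (expR_ge1Dxn k y0); rewrite lerDr.
Qed.

Lemma horner_expRN_bounded P : exists2 K : R, 0 <= K &
  forall y, 0 <= y -> `|P.[y] * expR (- y)| <= K.
Proof.
exists (\sum_(i < size P) `|P`_i| * i`!%:R).
  by apply: sumr_ge0 => i _; rewrite mulr_ge0.
move=> y y0; rewrite horner_coef mulr_suml.
apply: (le_trans (ler_norm_sum _ _ _)); apply: ler_sum => i _.
rewrite -mulrA normrM ler_wpM2l// ger0_norm ?pow_expRN_le//.
by rewrite mulr_ge0 ?exprn_ge0 ?expR_ge0.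
Qed.

Lemma flat_bounded P : exists2 K : R, 0 <= K & forall x, `|flat P x| <= K.
Proof.
have [K K0 h] := horner_expRN_bounded P; exists K => // x; rewrite /flat.
by case: ifP => [x0|_]; [apply: h; rewrite invr_ge0 ltW|rewrite normr0].
Qed.

(** Meant for the derivative of [flat] at the origin, where a quadratic bound takes the place of the
    formula; the difference quotient is at most [K |z - x|]. *)
Lemma isd_quadratic (u : R -> R) (x K : R) :
  (forall z, `|u z - u x| <= K * `|z - x| ^+ 2) -> is_derive x 1 u 0.
Proof.
move=> h; apply/is_derive1_caratheodory.
exists (fun z => if z == x then 0 else (u z - u x) / (z - x)); split.
- move=> z; case: eqP => [->|/eqP]; first by rewrite !subrr mulr0.
  by rewrite -subr_eq0 => /divfK->.
- have K0 : 0 <= K.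
    have := h (x + 1); rewrite addrAC subrr add0r normr1 expr1n mulr1.
    exact: le_trans.
  apply/cvgrPdist_le => e e0; rewrite /= eqxx.
  near=> z; rewrite sub0r normrN; case: eqP => [_|/eqP zx]; first by rewrite normr0 ltW.
  rewrite normf_div ler_pdivrMr ?normr_gt0 ?subr_eq0//.
  apply: (le_trans (h z)); rewrite expr2 mulrA ler_wpM2r//.
  apply: (@le_trans _ _ ((K + 1) * `|z - x|)); first by rewrite ler_wpM2r// lerDl.
  rewrite mulrC -ler_pdivlMr ?ltr_pwDr// distrC.
  by near: z; apply: cvgr_dist_le; [exact: cvg_id|rewrite divr_gt0// ltr_pwDr].
- by rewrite eqxx.
Unshelve. all: by end_near. Qed.

(** With [y = 1 / x], the derivative of [P(y) exp(- y)] in [y] is [(P' - P)(y) exp(- y)], and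
    [dy / dx = - y ^ 2]. *)
Lemma flat_deriv P x : is_derive x 1 (flat P) (flat ((P - P^`()) * 'X^2) x).
Proof.
have [x0|x0|->] := ltgtP x 0.
- rewrite /flat ltNge ltW//=.
  apply: (near_eq_is_derive _ (isd_cst 0 x)).
  by near=> z; rewrite ifF//; apply/negbTE; rewrite -leNgt ltW//; near: z; exact: lt_nbhsl.
- have xn0 : x != 0 by rewrite gt_eqF.
  have dV : is_derive x (1:R) (fun z : R => z^-1) (- (x ^- 2)).
    by apply: is_derive_eq (is_deriveV xn0 (is_derive_id x (1:R))) _; rewrite /GRing.scale/= mulr1.
  have h : is_derive x (1:R) (fun z => P.[z^-1] * expR (- z^-1)) (flat ((P - P^`()) * 'X^2) x).
    apply: isd_ext (isdM _ _ _ _ _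
      (isd_comp (horner P) (fun z => z^-1) _ _ _ (is_derive_poly P _) dV)
      (isd_comp expR (fun z => - z^-1) _ _ _ (is_derive_expR _) (isdN _ _ _ dV))) _ _ => //.
    rewrite /flat x0 hornerM hornerD hornerN hornerXn -exprVn; ring.
  apply: (near_eq_is_derive _ h).
  by near=> z; rewrite /flat ifT//; near: z; exact: lt_nbhsr.
(* At the origin, the bound for the polynomial [P X ^ 2] reads [|flat P z| <= K z ^ 2]. *)
- have [K K0 hK] := horner_expRN_bounded (P * 'X^2).
  apply: is_derive_eq; last by rewrite /flat ltxx.
  apply: (isd_quadratic _ _ K) => z; rewrite subr0 {2}/flat ltxx subr0 /flat.
  case: ifP => [z0|_]; last by rewrite normr0 mulr_ge0// exprn_ge0.
  have := hK z^-1; rewrite invr_ge0 => /(_ (ltW z0)).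
  rewrite hornerM hornerXn mulrAC normrM [`|_ ^+ 2|]ger0_norm ?sqr_ge0// (gtr0_norm z0).
  by rewrite exprVn ler_pdivrMr// exprn_gt0.
Unshelve. all: by end_near. Qed.

Lemma flat_le0 P x : x <= 0 -> flat P x = 0.
Proof. by move=> x0; rewrite /flat ltNge x0. Qed.

(** Combinations of products of two flat functions, one for each end of the interval: supported
    between [l] and [r], stable under differentiation, with [n] governing the steepness at the
    ends. *)
Inductive bump_class (n l r : R) : (R -> R) -> Prop :=
| bump_prod P Q : bump_class n l r (fun x => flat P (n * (x - l)) * flat Q (n * (r - x)))
| bump_add u v : bump_class n l r u -> bump_class n l r v ->
    bump_class n l r (fun x => u x + v x)
| bump_scale a u : bump_class n l r u -> bump_class n l r (fun x => a * u x).

Lemma bump_class_bounded n l r u : bump_class n l r u ->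
  exists2 K : R, 0 <= K & forall x, `|u x| <= K.
Proof.
elim=> {u}.
- move=> P Q; have [K K0 h] := flat_bounded P; have [L L0 g] := flat_bounded Q.
  by exists (K * L); [exact: mulr_ge0|move=> x; rewrite normrM ler_pM].
- move=> u v _ [K K0 h] _ [L L0 g]; exists (K + L); first exact: addr_ge0.
  by move=> x; rewrite (le_trans (ler_normD _ _))// lerD.
- move=> a u _ [K K0 h]; exists (`|a| * K); first exact: mulr_ge0.
  by move=> x; rewrite normrM ler_wpM2l.
Qed.

Lemma bump_class_supp n l r u x : 0 < n -> bump_class n l r u -> x <= l \/ r <= x -> u x = 0.
Proof.
move=> n0 hu xlr; elim: hu => {u}.
- move=> P Q; case: xlr => h; first by rewrite flat_le0 ?mul0r// pmulr_rle0// subr_le0.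
  by rewrite [X in _ * X]flat_le0 ?mulr0// pmulr_rle0// subr_le0.
- by move=> u v _ -> _ ->; rewrite addr0.
- by move=> a u _ ->; rewrite mulr0.
Qed.

Lemma bump_class_deriv n l r u : bump_class n l r u ->
  exists2 u', bump_class n l r u' & forall x, is_derive x 1 u (u' x).
Proof.
elim=> {u}.
- move=> P Q.
  exists (fun x => n * (flat ((P - P^`()) * 'X^2) (n * (x - l)) * flat Q (n * (r - x))) +
     (- n) * (flat P (n * (x - l)) * flat ((Q - Q^`()) * 'X^2) (n * (r - x)))).
    by apply: bump_add; apply: bump_scale; exact: bump_prod.
  move=> x.
  have d1 : is_derive x (1:R) (fun z : R => n * (z - l)) n.
    by apply: isd_ext (isd_affine n (- (n * l)) x) _ _ => // z; ring.
  have d2 : is_derive x (1:R) (fun z : R => n * (r - z)) (- n).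
    by apply: isd_ext (isd_affine (- n) (n * r) x) _ _ => // z; ring.
  apply: isd_ext (isdM _ _ _ _ _
    (isd_comp _ (fun z => n * (z - l)) _ _ _ (flat_deriv P _) d1)
    (isd_comp _ (fun z => n * (r - z)) _ _ _ (flat_deriv Q _) d2)) _ _ => //.
  by ring.
- move=> u v _ [u' hu du] _ [v' hv dv]; exists (fun x => u' x + v' x).
    exact: bump_add.
  by move=> x; exact: isdD.
- move=> a u _ [u' hu du]; exists (fun x => a * u' x); first exact: bump_scale.
  move=> x; apply: isd_ext (isdM _ _ _ _ _ (isd_cst a x) (du x)) _ _ => //.
  by rewrite mulr0 addr0.
Qed.

Lemma bump_schwartz n l r u : 0 < n -> bump_class n l r u -> schwartz (fun x => (u x)%:C).
Proof.
move=> n0; pose P (f : R -> R[i]) := exists2 u, bump_class n l r u & f = fun x => (u x)%:C.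
move=> hu; apply: (@schwartz_of_class _ P); last by exists u.
move=> _ [v hv ->]; split.
  move=> m; have [K K0 hK] := bump_class_bounded _ _ _ _ hv.
  exists ((1 + `|l| + `|r|) ^+ m * K) => x; rewrite normc_real.
  have h0 : 0 <= (1 + `|l| + `|r|) ^+ m * K by rewrite mulr_ge0 ?exprn_ge0 ?addr_ge0.
  have [xl|lx] := leP x l.
    by rewrite (bump_class_supp _ _ _ _ x n0 hv) ?normr0 ?mulr0//; left.
  have [rx|xr] := leP r x.
    by rewrite (bump_class_supp _ _ _ _ x n0 hv) ?normr0 ?mulr0//; right.
  rewrite ler_pM ?exprn_ge0 ?addr_ge0// lerXn2r ?nnegrE ?addr_ge0// -addrA lerD2l.
  have [x0|x0] := leP 0 x; first by rewrite ger0_norm//; have := ler_norm r; have := normr_ge0 l; lra.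
  by rewrite ltr0_norm//; have := ler_norm (- l); rewrite normrN; have := normr_ge0 r; lra.
have [v' hv' dv] := bump_class_deriv _ _ _ _ hv.
by exists (fun x => (v' x)%:C); [exists v'|move=> x; exact: cderiv_real].
Qed.

(* Increases with n to the indicator of ]l, r[. *)
Definition plateau n l r x : R := expR (- (n * (x - l))^-1) * expR (- (n * (r - x))^-1) *
  (if l < x < r then 1 else 0).

Lemma plateau_bump n l r : 0 < n -> bump_class n l r (plateau n l r).
Proof.
move=> n0; rewrite (_ : plateau n l r = fun x => flat 1 (n * (x - l)) * flat 1 (n * (r - x))).
  exact: bump_prod.
apply/funext => x; rewrite /plateau /flat !pmulr_rgt0// !subr_gt0 !hornerC !mul1r.
by case: ltP => _; case: ltP => _; rewrite ?mulr1 ?mulr0 ?mul0r.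
Qed.

Lemma plateau_ge0 n l r x : 0 <= plateau n l r x.
Proof. by rewrite /plateau !mulr_ge0 ?expR_ge0//; case: ifP. Qed.

Lemma plateau_le1 n l r x : 0 < n -> plateau n l r x <= (if l < x < r then 1 else 0).
Proof.
move=> n0; rewrite /plateau; case: ifP => [/andP[lx xr]|_]; last by rewrite mulr0.
rewrite mulr1 mulr_ile1 ?expR_ge0// -[1]expR0 ler_expR oppr_le0 invr_ge0 mulr_ge0 ?ltW//.
  by rewrite subr_gt0.
by rewrite subr_gt0.
Qed.

Lemma plateau_cvg l r x :
  plateau k.+1%:R l r x @[k --> \oo] --> (if l < x < r then 1 else 0 : R).
Proof.
rewrite /plateau; case: ifP => [/andP[lx xr]|_]; last first.
  by under eq_fun do rewrite mulr0; exact: cvg_cst.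
have h (a : R) : 0 < a -> expR (- (k.+1%:R * a)^-1) @[k --> \oo] --> (1 : R).
  move=> a0; suff : expR (- (k.+1%:R * a)^-1) @[k --> \oo] --> expR (- (0 * a^-1)).
    by rewrite mul0r oppr0 expR0.
  apply: (@cvg_comp _ _ _ (fun k : nat => - (k.+1%:R * a)^-1) expR _ (nbhs (- (0 * a^-1)))); last exact: continuous_expR.
  apply: cvgN; under eq_fun do rewrite invfM.
  by apply: cvgM; [exact: cvg_harmonic|exact: cvg_cst].
under eq_fun do rewrite mulr1.
have p1 : 0 < x - l by rewrite subr_gt0.
have p2 : 0 < r - x by rewrite subr_gt0.
by have := cvgM (h _ p1) (h _ p2); rewrite mulr1; apply.
Qed.

End Bump.

(** * The multiplication formula and Fourier inversion up to a constant *)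

Section Inversion.
Context {R : realType}.
Implicit Types (f g kappa : R -> R[i]) (x a b : R).

Lemma cintegrable2_dom (F : R * R -> R[i]) (g h : R -> R) :
  cmeasurable (F : measurableTypeR R * measurableTypeR R -> R[i]) ->
  leb.-integrable setT (EFin \o g) -> leb.-integrable setT (EFin \o h) ->
  (forall x y, normc (F (x, y)) <= g x * h y) -> cintegrable leb2 F.
Proof. exact: (@cintegrable_tensor_dom _ _ _ _ _ (@lebesgue_measure R) (@lebesgue_measure R)). Qed.

Lemma cint2_fubini (F : R * R -> R[i]) : cintegrable leb2 F ->
  cintegrable leb (fun x => cint leb (fun y => F (x, y))) /\
  cint leb2 F = cint leb (fun x => cint leb (fun y => F (x, y))).
Proof. exact: (@cint_fubini _ _ _ _ _ (@lebesgue_measure R) (@lebesgue_measure R)). Qed.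

Lemma cint2_swap (F : R * R -> R[i]) : cintegrable leb2 F ->
  cint leb (fun x => cint leb (fun y => F (x, y))) =
  cint leb (fun y => cint leb (fun x => F (x, y))).
Proof. exact: (@cint_fubini_swap _ _ _ _ _ (@lebesgue_measure R) (@lebesgue_measure R)). Qed.

Lemma integrable_normc_schwartz f : schwartz f ->
  (@leb R).-integrable setT (EFin \o (fun x => normc (f x))).
Proof. by move=> sf; apply: integrable_normc; exact: schwartz_cintegrable. Qed.

Lemma cmeasurable_comp {d : measure_display} {T : measurableType d}
  (f : R -> R[i]) (u : T -> R) :
  cmeasurable (f : measurableTypeR R -> R[i]) -> measurable_fun setT u ->
  cmeasurable (fun z => f (u z)).
Proof. by move=> [f1 f2] mu; split; [exact: (measurableT_comp f1)|exact: (measurableT_comp f2)]. Qed.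

Lemma cmeasurable_expiT {d : measure_display} {T : measurableType d} (u : T -> R) :
  measurable_fun setT u -> cmeasurable (fun z => expi (u z) : R[i]).
Proof.
move=> mu; have := cmeasurable_comp (fun x => expi (1 * x)) u (cmeasurable_expi 1) mu.
by congr cmeasurable; apply/funext => z; rewrite mul1r.
Qed.

Lemma ccvg_of_cderiv f f' (u : nat -> R) a : (forall x, cderiv f x (f' x)) ->
  u n @[n --> \oo] --> a -> ccvg (fun n => f (u n)) (f a).
Proof.
move=> df ua; split.
- apply: (@cvg_comp _ _ _ u (fun x => cRe (f x)) _ (nbhs a)) => //.
  by apply: isd_continuous => x; case: (df x) => [[]].
- apply: (@cvg_comp _ _ _ u (fun x => cIm (f x)) _ (nbhs a)) => //.
  by apply: isd_continuous => x; case: (df x) => _ [].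
Qed.

Definition ifourier (g : R -> R[i]) x := cint leb (fun xi => expi (2 * pi * x * xi) * g xi).

(** Both sides are iterated integrals of [expi (- 2 pi x xi) f x g xi]. *)
Lemma fourier_multiplication f g : schwartz f -> schwartz g ->
  cint leb (fun xi => fourier f xi * g xi) = cint leb (fun x => f x * fourier g x).
Proof.
move=> sf sg; pose F (z : R * R) := expi (- (2 * pi * z.2 * z.1)) * f z.2 * g z.1.
have mfst : measurable_fun setT (fst : measurableTypeR R * measurableTypeR R -> R).
  exact: measurable_fst.
have msnd : measurable_fun setT (snd : measurableTypeR R * measurableTypeR R -> R).
  exact: measurable_snd.
have Fi : cintegrable leb2 F.
  apply: (cintegrable2_dom F _ _ _ (integrable_normc_schwartz g sg) (integrable_normc_schwartz f sf)).
    apply: cmeasurable_mul; [apply: cmeasurable_mul|]; last exact: cmeasurable_comp (schwartz_cmeasurable g sg) mfst.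
      apply: cmeasurable_expiT; apply: measurable_funN.
      by apply: measurable_funM => //; exact: measurable_funM.
    exact: cmeasurable_comp (schwartz_cmeasurable f sf) msnd.
  by move=> x y; rewrite /F /= !normc_mul normc_expi mul1r mulrC.
transitivity (cint leb (fun xi => cint leb (fun x => F (xi, x)))).
  apply: eq_cint => xi; rewrite fourierE mulrC -cint_scale; last exact/cintegrable_expi/schwartz_cintegrable.
  by apply: eq_cint => x; rewrite /F /= mulrC; congr (expi _ * _ * _); ring.
rewrite (cint2_swap F Fi); apply: eq_cint => x.
rewrite fourierE -cint_scale; last exact/cintegrable_expi/schwartz_cintegrable.
by apply: eq_cint => xi; rewrite /F /= mulNr; ring.
Qed.

Lemma fourier_dilate kappa a x xi : 0 < a -> schwartz kappa ->
  fourier (fun t => expi (2 * pi * x * t) * kappa (a * t + 0)) xi =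
  (a^-1)%:C * fourier kappa (a^-1 * (xi - x)).
Proof.
move=> a0 sk; have an0 : a != 0 by rewrite gt_eqF.
pose h t := expi (- (2 * pi * (a^-1 * (xi - x))) * t) * kappa t.
have hi : cintegrable leb h by exact/cintegrable_expi/schwartz_cintegrable.
have := cint_affine a 0 h an0 hi; rewrite gtr0_norm// [X in _ = _ * X](_ : _ = fourier kappa (a^-1 * (xi - x))); last by rewrite fourierE.
move=> <-; rewrite fourierE; apply: eq_cint => t; rewrite /h mulrA -expiD.
by congr (expi _ * _); field.
Qed.

(** A regularising factor [kappa (d xi)] is inserted in the inversion integral. As [d] tends to 0
    the factor disappears by dominated convergence. For fixed [d], the multiplication formula and a
    rescaling give the integral of [f (d t + x)] against the transform of [kappa], which tends to
    [f x] times the integral of that transform. *)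
Lemma fourier_inversion kappa f x : schwartz kappa -> kappa 0 = 1 -> schwartz f ->
  ifourier (fourier f) x = cint leb (fourier kappa) * f x.
Proof.
move=> sk k0 sf.
pose d (n : nat) : R := n.+1%:R^-1.
have d0 n : 0 < d n by rewrite invr_gt0.
have dcvg : d n @[n --> \oo] --> 0 by exact: cvg_harmonic.
have sFf := schwartz_fourier f sf; have sFk := schwartz_fourier kappa sk.
have [Mk Mk0 hMk] := rapid_bound kappa (schwartz_rapid kappa sk).
have [Mf Mf0 hMf] := rapid_bound f (schwartz_rapid f sf).
have [k' sk' dk] := schwartz_deriv kappa sk; have [f' sf' df] := schwartz_deriv f sf.
pose z n := cint leb (fun xi => fourier f xi * (expi (2 * pi * x * xi) * kappa (d n * xi + 0))).
have z1 : ccvg z (ifourier (fourier f) x).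
  apply: (cint_dominated_cvg leb (fun n xi => fourier f xi * (expi (2 * pi * x * xi) * kappa (d n * xi + 0))) _ (fun xi => Mk * normc (fourier f xi))).
  - move=> n; apply: cmeasurable_mul; first exact: schwartz_cmeasurable.
    apply: schwartz_cmeasurable; apply: schwartz_expi; apply: schwartz_affine => //.
    by rewrite gt_eqF.
  - apply: cmeasurable_mul; first exact: cmeasurable_expi.
    exact: schwartz_cmeasurable.
  - exact/integrable_scaler/integrable_normc_schwartz.
  - move=> n xi; rewrite !normc_mul normc_expi mul1r mulrC ler_wpM2r ?normc_ge0//.
  - apply: aeW => xi; rewrite [X in ccvg _ X]mulrC; apply: ccvg_mul; first exact: ccvg_cst.
    rewrite -[X in ccvg _ X]mulr1 -k0; apply: ccvg_mul; first exact: ccvg_cst.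
    apply: ccvg_of_cderiv dk _; under eq_fun do rewrite addr0.
    by rewrite -(mul0r xi); apply: cvgM => //; exact: cvg_cst.
have z2 n : z n = cint leb (fun t => f (d n * t + x) * fourier kappa t).
  have dn0 : d n != 0 by rewrite gt_eqF.
  rewrite /z (fourier_multiplication f (fun t => expi (2 * pi * x * t) * kappa (d n * t + 0)) sf (schwartz_expi _ _ (schwartz_affine _ _ _ dn0 sk))).
  under eq_cint do rewrite (fourier_dilate _ _ _ _ (d0 n) sk).
  pose h t := f t * fourier kappa ((d n)^-1 * (t - x)).
  have hi : cintegrable leb h.
    apply: schwartz_cintegrable; apply: schwartz_mul => //.
    have := schwartz_affine (d n)^-1 (- ((d n)^-1 * x)) _ (invr_neq0 dn0) sFk.
    by congr schwartz; apply/funext => t; rewrite mulrBr.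
  have := cint_affine (d n) x h dn0 hi; rewrite gtr0_norm//.
  rewrite -cint_scale// => e.
  transitivity (cint leb (fun t => h (d n * t + x))).
    by rewrite e; apply: eq_cint => t; rewrite /h; ring.
  by apply: eq_cint => t; rewrite /h; congr (_ * fourier _ _); field.
have z3 : ccvg z (cint leb (fun t => f x * fourier kappa t)).
  rewrite (_ : z = fun n => cint leb (fun t => f (d n * t + x) * fourier kappa t)); last first.
    exact/funext.
  apply: (cint_dominated_cvg leb (fun n t => f (d n * t + x) * fourier kappa t) _ (fun t => Mf * normc (fourier kappa t))).
  - move=> n; apply: cmeasurable_mul; last exact: schwartz_cmeasurable.
    by apply: schwartz_cmeasurable; apply: schwartz_affine => //; rewrite gt_eqF.
  - by apply: cmeasurable_mul; [exact: cmeasurable_cst|exact: schwartz_cmeasurable].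
  - exact/integrable_scaler/integrable_normc_schwartz.
  - by move=> n t; rewrite normc_mul ler_wpM2r ?normc_ge0.
  - apply: aeW => t; apply: ccvg_mul; last exact: ccvg_cst.
    apply: ccvg_of_cderiv df _; rewrite -[X in _ --> X]add0r; apply: cvgD; last exact: cvg_cst.
    by rewrite -(mul0r t); apply: cvgM => //; exact: cvg_cst.
rewrite (ccvg_unique _ _ _ z1 z3) cint_scale; first by rewrite mulrC.
exact: schwartz_cintegrable.
Qed.

End Inversion.

(** * The Plancherel identity *)

Section Plancherel.
Context {R : realType}.
Implicit Types (f g kappa : R -> R[i]) (x a b : R).

Lemma Rintegral_gt0_near0 (u : R -> R) (m delta : R) : 0 < m -> 0 < delta ->
  leb.-integrable setT (EFin \o u) -> (forall x, 0 <= u x) ->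
  (forall x, 0 <= x <= delta -> m <= u x) -> 0 < \int[leb]_x u x.
Proof.
move=> m0 d0 iu u0 um.
have mI : measurable (`[0, delta]%classic : set (measurableTypeR R)) by exact: measurable_itv.
have iI : leb.-integrable setT (EFin \o (\1_(`[0, delta]%classic) : R -> R)).
  apply/integrableP; split; first exact/measurable_EFinP/measurable_indic.
  under eq_integral do rewrite /= ger0_norm//.
  rewrite integral_indic// setIT.
  by rewrite [ltLHS](@lebesgue_measure_itv R `[0, delta]) /= lte_fin d0 ltry.
have im : leb.-integrable setT (EFin \o (fun x : R => m * \1_(`[0, delta]%classic) x)).
  exact/integrable_scaler.
have : \int[leb]_x (m * \1_(`[0, delta]%classic) x) <= \int[leb]_x u x.
  apply: le_Rintegral => // x _; rewrite indicE; case: (boolP (x \in _)) => [|_].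
    by rewrite inE /= in_itv /= mulr1; exact: um.
  by rewrite mulr0.
apply: lt_le_trans; rewrite RintegralZl//.
rewrite mulr_gt0// /Rintegral integral_indic// setIT.
rewrite [X in fine X](@lebesgue_measure_itv R `[0, delta]) /= lte_fin d0 /=.
by rewrite subr0.
Qed.

Lemma normc_near0 f f' (M : R) : (forall x, cderiv f x (f' x)) ->
  (forall x, normc (f' x) <= M) -> f 0 != 0 ->
  exists2 delta : R, 0 < delta & forall x, 0 <= x <= delta -> normc (f 0) / 2 <= normc (f x).
Proof.
move=> df fM f0.
have M0 : 0 <= M := le_trans (normc_ge0 _) (fM 0).
have N0 : 0 < normc (f 0).
  by rewrite lt_neqAle normc_ge0 eq_sym andbT; apply: contra_neq f0 => /normc_eq0.
exists (normc (f 0) / (4 * (M + 1))); first by rewrite divr_gt0 ?mulr_gt0 ?ltr_pwDr.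
move=> x /andP[x0 xd].
have h := cderiv_lipschitz f f' M df fM 0 x; rewrite subr0 ger0_norm// in h.
have h2 : normc (f 0) <= normc (f x) + normc (f x - f 0).
  by have := normc_add (f x) (- (f x - f 0)); rewrite normc_opp opprB addrC subrK.
have : x * (4 * (M + 1)) <= normc (f 0) by rewrite -ler_pdivlMr// mulr_gt0 ?ltr_pwDr.
nra.
Qed.

Lemma integrable_normc2_schwartz f : schwartz f ->
  (@leb R).-integrable setT (EFin \o (fun x => normc (f x) ^+ 2)).
Proof.
move=> sf; have := integrable_normc_schwartz _ (schwartz_mul _ _ sf sf).
by congr integrable; apply/funext => x /=; rewrite normc_mul expr2.
Qed.

Lemma schwartz_nonzero_at0 f : schwartz f -> f 0 != 0 ->
  0 < \int[leb]_x normc (f x) /\ 0 < \int[leb]_x normc (f x) ^+ 2.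
Proof.
move=> sf f0; have [f' sf' df] := schwartz_deriv f sf.
have [M M0 hM] := rapid_bound _ (schwartz_rapid _ sf').
have [delta d0 h] := normc_near0 f f' M df hM f0.
have N0 : 0 < normc (f 0) / 2.
  by rewrite divr_gt0// lt_neqAle normc_ge0 eq_sym andbT; apply: contra_neq f0 => /normc_eq0.
split.
  apply: Rintegral_gt0_near0 N0 d0 (integrable_normc_schwartz _ sf) _ h.
  by move=> x; exact: normc_ge0.
apply: (Rintegral_gt0_near0 _ ((normc (f 0) / 2) ^+ 2) _ _ d0 (integrable_normc2_schwartz _ sf)).
- by rewrite exprn_gt0.
- by move=> x; rewrite sqr_ge0.
- by move=> x xd; rewrite lerXn2r ?nnegrE ?normc_ge0 ?h ?(ltW N0).
Qed.

Lemma fourier_conj_ifourier f x : schwartz f ->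
  fourier (fun xi => (f xi)^*) x = (ifourier f x)^*.
Proof.
move=> sf; rewrite fourierE /ifourier -cint_conj.
  apply: eq_cint => xi; have -> : - (2 * pi * x) * xi = - (2 * pi * x * xi) by ring.
  by rewrite -conj_expi; apply: complex_ext; rewrite !cE; ring.
exact/cintegrable_expi/schwartz_cintegrable.
Qed.

(** The inversion constant is left abstract, and only its positivity is established: Plancherel's
    identity for the bump [kappa] itself writes it as the quotient [B / A] of two positive squared
    norms. *)
Lemma inversion_plancherel : exists2 c : R, 0 < c &
  (forall f x, schwartz f -> ifourier (fourier f) x = c%:C * f x) /\
  (forall f, schwartz f ->
     \int[leb]_x normc (fourier f x) ^+ 2 = c * \int[leb]_x normc (f x) ^+ 2).
Proof.
pose p x : R := plateau 1 (-1) 1 x / plateau 1 (-1) 1 0.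
have q0 : plateau 1 (-1) 1 0 != 0 :> R.
  rewrite /plateau !mulf_neq0 ?gt_eqF ?expR_gt0//.
  by rewrite ltrN10 ltr01/= ltr01.
pose kappa x := (p x)%:C.
have sk : schwartz kappa.
  apply: (bump_schwartz 1 (-1) 1) => //.
  have := bump_scale 1 (-1) 1 (plateau 1 (-1) 1 0)^-1 _ (plateau_bump 1 (-1) 1 (@ltr01 R)).
  by congr bump_class; apply/funext => x; rewrite mulrC.
have k0 : kappa 0 = 1 by rewrite /kappa /p divff.
set c0 := cint leb (fourier kappa).
have inv f x : schwartz f -> ifourier (fourier f) x = c0 * f x.
  by move=> sf; exact: fourier_inversion.
(* The multiplication formula moves the transform onto the conjugate of [fourier f], where inversion
   produces the conjugate of [c0 f]. *)
have pl f : schwartz f -> (\int[leb]_x normc (fourier f x) ^+ 2)%:C =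
    c0^* * (\int[leb]_x normc (f x) ^+ 2)%:C.
  move=> sf; have sF := schwartz_fourier f sf.
  transitivity (cint leb (fun xi => fourier f xi * (fourier f xi)^*)).
    by rewrite -cint_real; apply: eq_cint => x; rewrite conj_mulE.
  rewrite fourier_multiplication//; last exact: schwartz_conj.
  under eq_cint => x do rewrite fourier_conj_ifourier// inv// conjcM mulrCA.
  rewrite cint_scale; last by apply: schwartz_cintegrable; apply: schwartz_mul => //; exact: schwartz_conj.
  by congr (_ * _); rewrite -cint_real; apply: eq_cint => x; rewrite conj_mulE.
have kn0 : kappa 0 != 0 by rewrite k0 oner_eq0.
have [A1 A2] := schwartz_nonzero_at0 kappa sk kn0.
set A := \int[leb]_x normc (kappa x) ^+ 2 in A2.
(* As [kappa] is nonnegative, its transform at 0 equals its L^1 norm, which is positive; this makes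
   [B] positive. *)
have F0 : fourier kappa 0 != 0.
  have : fourier kappa 0 = (\int[leb]_x normc (kappa x))%:C.
    rewrite fourierE -cint_real; apply: eq_cint => x.
    rewrite mulr0 oppr0 mul0r expi0 mul1r /kappa normc_real ger0_norm//.
    by rewrite /p divr_ge0 ?plateau_ge0.
  by move=> ->; apply: contraTneq A1 => -[->]; rewrite ltxx.
have [_ B2] := schwartz_nonzero_at0 _ (schwartz_fourier _ sk) F0.
set B := \int[leb]_x normc (fourier kappa x) ^+ 2 in B2.
have c0E : c0 = (B / A)%:C.
  have h := pl kappa sk; have h1 := congr1 (@cRe R) h; have h2 := congr1 (@cIm R) h.
  rewrite -/A -/B !cE /= mulr0 subr0 in h1; rewrite -/A -/B !cE /= mulr0 add0r in h2.
  apply: complex_ext => /=; first by rewrite h1 mulfK// gt_eqF.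
  by apply/eqP; move/esym/eqP: h2; rewrite mulf_eq0 oppr_eq0 (gt_eqF A2) orbF.
exists (B / A); first by rewrite divr_gt0.
split=> [f x sf|f sf]; first by rewrite inv// c0E.
have h := congr1 (@cRe R) (pl f sf); move: h; rewrite c0E !cE /= mulr0 subr0.
by [].
Qed.

End Plancherel.

(** * The space of square-integrable functions *)

Section AlmostEverywhere.
Context {d : measure_display} {T : measurableType d} {R : realType}.
Variable mu : {measure set T -> \bar R}.

Lemma ae_imp (P Q : T -> Prop) : {ae mu, forall x, P x} ->
  (forall x, P x -> Q x) -> {ae mu, forall x, Q x}.
Proof. by move=> hP PQ; apply: filterS hP. Qed.

Lemma ae_imp2 (P Q S : T -> Prop) : {ae mu, forall x, P x} -> {ae mu, forall x, Q x} ->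
  (forall x, P x -> Q x -> S x) -> {ae mu, forall x, S x}.
Proof. by move=> hP hQ PQ; apply: filterS2 hP hQ. Qed.

End AlmostEverywhere.

Section SquareIntegrable.
Context {R : realType}.
Implicit Types (f g h : R -> R[i]) (x a b : R) (z : R[i]).

(** A real number, meaningful for functions in L^2; an infinite integral gives the default value
    0. *)
Definition nsq f : R := \int[leb]_x normc (f x) ^+ 2.
Definition nrm f : R := Num.sqrt (nsq f).

Lemma nsq_ge0 f : 0 <= nsq f.
Proof. by apply: Rintegral_ge0 => x _; rewrite sqr_ge0. Qed.

Lemma nrm_ge0 f : 0 <= nrm f.
Proof. exact: sqrtr_ge0. Qed.

Lemma nrm2 f : nrm f ^+ 2 = nsq f.
Proof. by rewrite sqr_sqrtr// nsq_ge0. Qed.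

Lemma measurable_normc2 f : cmeasurable (f : measurableTypeR R -> R[i]) ->
  measurable_fun setT (fun x : measurableTypeR R => normc (f x) ^+ 2).
Proof. by move=> mf; apply: measurable_funX; exact: measurable_normc. Qed.

Lemma L2norm_integral f :
  L2norm f = ((\int[leb]_x (normc (f x) ^+ 2)%:E) `^ (2^-1))%E.
Proof.
rewrite /L2norm /cLnorm unlock; congr (_ `^ _)%E; apply: eq_integral => x _ /=.
by rewrite ger0_norm ?normc_ge0// powR_mulrn ?normc_ge0.
Qed.

Lemma inL2P f : inL2 f <-> cmeasurable (f : measurableTypeR R -> R[i]) /\
  leb.-integrable setT (EFin \o (fun x => normc (f x) ^+ 2)).
Proof.
rewrite /inL2 L2norm_integral; split=> -[mf h]; split=> //.
  apply/integrableP; split; first by apply/measurable_EFinP; exact: measurable_normc2.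
  under eq_integral => x _ do rewrite /= ger0_norm ?sqr_ge0//.
  rewrite ltey; apply: contraTN h => /eqP ->.
  by rewrite poweRyr ?invr_neq0// ltxx.
apply: poweR_lty; have /integrableP[_] := h; congr (_ < _)%E.
by apply: eq_integral => x _; rewrite /= ger0_norm ?sqr_ge0.
Qed.

Lemma L2normE f : inL2 f -> L2norm f = (nrm f)%:E.
Proof.
move=> /inL2P[mf h]; rewrite L2norm_integral.
have := integrable_fin_num measurableT h; rewrite /comp => /fineK <-.
by rewrite poweR_EFin powR12_sqrt// nsq_ge0.
Qed.

Lemma inL2_dom f (u : R -> R) : cmeasurable (f : measurableTypeR R -> R[i]) ->
  leb.-integrable setT (EFin \o u) -> (forall x, normc (f x) ^+ 2 <= u x) -> inL2 f.
Proof.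
move=> mf iu fu; apply/inL2P; split=> //; apply: le_integrable iu => //.
  by apply/measurable_EFinP; exact: measurable_normc2.
by move=> x _ /=; rewrite lee_fin ger0_norm ?sqr_ge0// (le_trans (fu x))// ler_norm.
Qed.

Lemma inL2_cmeasurable f : inL2 f -> cmeasurable (f : measurableTypeR R -> R[i]).
Proof. by case. Qed.

Lemma normc_add_sqr z w : normc (z + w) ^+ 2 =
  normc z ^+ 2 + 2 * cRe (z * w^*) + normc w ^+ 2.
Proof. by rewrite !normcE2 !cE; ring. Qed.

Lemma inL2_add f g : inL2 f -> inL2 g -> inL2 (fun x => f x + g x).
Proof.
move=> /inL2P[mf hf] /inL2P[mg hg].
apply: (inL2_dom _ (fun x => 2 * normc (f x) ^+ 2 + 2 * normc (g x) ^+ 2)).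
- exact: cmeasurable_add.
- rewrite (_ : _ \o _ = (fun x => (EFin \o (fun x => (2 * normc (f x) ^+ 2))%R) x + (EFin \o (fun x => (2 * normc (g x) ^+ 2))%R) x)%E).
    by apply: integrableD => //; exact: integrable_scaler.
  by apply/funext => x /=; rewrite EFinD.
- move=> x; apply: (@le_trans _ _ ((normc (f x) + normc (g x)) ^+ 2)).
    by rewrite lerXn2r ?nnegrE ?addr_ge0 ?normc_ge0// normc_add.
  have := sqr_ge0 (normc (f x) - normc (g x)); nra.
Qed.

Lemma inL2_scale z f : inL2 f -> inL2 (fun x => z * f x).
Proof.
move=> /inL2P[mf hf]; apply: (inL2_dom _ (fun x => normc z ^+ 2 * normc (f x) ^+ 2)).
- by apply: cmeasurable_mul => //; exact: cmeasurable_cst.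
- exact: integrable_scaler.
- by move=> x; rewrite normc_mul exprMn.
Qed.

Lemma inL2_sub f g : inL2 f -> inL2 g -> inL2 (fun x => f x - g x).
Proof.
move=> hf hg; have := inL2_add f _ hf (inL2_scale (-1) g hg).
by congr inL2; apply/funext => x; rewrite mulN1r.
Qed.

Lemma inL2_conj f : inL2 f -> inL2 (fun x => (f x)^*).
Proof.
move=> /inL2P[mf hf]; apply: (inL2_dom _ _ _ hf); first exact: cmeasurable_conj.
by move=> x; rewrite normc_conj.
Qed.

Lemma schwartz_inL2 f : schwartz f -> inL2 f.
Proof.
move=> sf; apply/inL2P; split; first exact: schwartz_cmeasurable.
exact: integrable_normc2_schwartz.
Qed.

Lemma nsq_ae_eq f g : inL2 f -> inL2 g -> ceq_ae leb f g -> nsq f = nsq g.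
Proof.
move=> [mf _] [mg _] fg; apply: Rintegral_ae_eq.
- exact: measurable_normc2.
- exact: measurable_normc2.
- by apply: filterS fg => x ->.
Qed.

Lemma nsq_eq0 f : inL2 f -> nsq f = 0 -> ceq_ae leb f (fun=> 0).
Proof.
move=> /inL2P[mf hf] f0.
have m2 : measurable_fun setT (fun x : measurableTypeR R => (normc (f x) ^+ 2)%:E).
  by apply/measurable_EFinP; exact: measurable_normc2.
have : (\int[leb]_x `|(normc (f x) ^+ 2)%:E| = 0)%E.
  rewrite -[RHS]/(0%R%:E) -f0 /nsq /Rintegral fineK; last exact: integrable_fin_num.
  by apply: eq_integral => x _; rewrite /= ger0_norm ?sqr_ge0.
move/(ae_eq_integral_abs leb measurableT m2).1; apply: filterS => x /(_ I) [] /eqP.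
by rewrite sqrf_eq0 => /eqP/normc_eq0.
Qed.

Lemma cintegrable_mulL2 f g : inL2 f -> inL2 g -> cintegrable leb (fun x => f x * g x).
Proof.
move=> /inL2P[mf hf] /inL2P[mg hg].
apply: (cintegrable_dom leb _ (fun x : R => normc (f x) ^+ 2 + normc (g x) ^+ 2)).
- exact: cmeasurable_mul.
- rewrite (_ : _ \o _ = (fun x => (EFin \o (fun x => (normc (f x) ^+ 2))%R) x + (EFin \o (fun x => (normc (g x) ^+ 2))%R) x)%E).
    exact: integrableD.
  by apply/funext => x /=; rewrite EFinD.
- move=> x; rewrite normc_mul.
  have := sqr_ge0 (normc (f x) - normc (g x)); have := normc_ge0 (f x); have := normc_ge0 (g x); nra.
Qed.

Lemma le_sqrt_mul (X A B : R) : 0 <= A -> 0 <= B ->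
  (forall t, 0 < t -> 2 * X <= t * A + t^-1 * B) -> X <= Num.sqrt A * Num.sqrt B.
Proof.
move=> A0 B0 h.
have key u v : 0 < u -> 0 < v -> A <= u ^+ 2 -> B <= v ^+ 2 -> X <= u * v.
  move=> u0 v0 Au Bv; have := h (v / u) (divr_gt0 v0 u0); rewrite invf_div.
  have : v / u * A <= u * v.
    apply: (le_trans (ler_wpM2l (ltW (divr_gt0 v0 u0)) Au)).
    by rewrite le_eqVlt; apply/orP; left; apply/eqP; field; rewrite gt_eqF.
  have : u / v * B <= u * v.
    apply: (le_trans (ler_wpM2l (ltW (divr_gt0 u0 v0)) Bv)).
    by rewrite le_eqVlt; apply/orP; left; apply/eqP; field; rewrite gt_eqF.
  lra.
apply/ler_addgt0Pr => e e0.
have sA := sqrtr_ge0 A; have sB := sqrtr_ge0 B.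
set a := Num.sqrt A; set b := Num.sqrt B.
(* As [d <= 1], the difference [(a + d) (b + d) - a b] is at most [d (a + b + 1)], hence at most
   [e]. *)
pose d := Num.min 1 (e / (a + b + 1)).
have ab1 : 0 < a + b + 1 by rewrite ltr_pwDr// addr_ge0.
have d0 : 0 < d by rewrite lt_min ltr01 divr_gt0.
have d1 : d <= 1 by rewrite ge_min lexx.
have d2 : d * (a + b + 1) <= e by rewrite -ler_pdivlMr// ge_min lexx orbT.
apply: le_trans (key (a + d) (b + d) _ _ _ _) _.
- by rewrite ltr_wpDl.
- by rewrite ltr_wpDl.
- by rewrite -[leLHS](sqr_sqrtr A0) lerXn2r ?nnegrE ?addr_ge0 ?lerDl ?(ltW d0).
- by rewrite -[leLHS](sqr_sqrtr B0) lerXn2r ?nnegrE ?addr_ge0 ?lerDl ?(ltW d0).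
- nra.
Qed.

Lemma cauchy_schwarz_int f g : inL2 f -> inL2 g ->
  \int[leb]_x (normc (f x) * normc (g x)) <= nrm f * nrm g.
Proof.
move=> hf hg; have /inL2P[mf if2] := hf; have /inL2P[mg ig2] := hg.
apply: le_sqrt_mul; rewrite ?nsq_ge0// => t t0.
have ifg : leb.-integrable setT (EFin \o (fun x => normc (f x) * normc (g x))).
  have := integrable_normc _ _ (cintegrable_mulL2 f g hf hg).
  by congr integrable; apply/funext => x /=; rewrite normc_mul.
rewrite -!RintegralZl// -RintegralD//; try exact: integrable_scaler.
apply: le_Rintegral => //; first exact: integrable_scaler.
  rewrite (_ : _ \o _ = (fun x => (EFin \o (fun x => (t * normc (f x) ^+ 2))%R) x + (EFin \o (fun x => (t^-1 * normc (g x) ^+ 2))%R) x)%E).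
    by apply: integrableD => //; exact: integrable_scaler.
  by apply/funext => x /=; rewrite EFinD.
move=> x _; set u := normc (f x); set v := normc (g x).
have -> : t * u ^+ 2 + t^-1 * v ^+ 2 = 2 * (u * v) + t^-1 * (t * u - v) ^+ 2 by field; rewrite gt_eqF.
by rewrite lerDl mulr_ge0 ?sqr_ge0// invr_ge0 ltW.
Qed.

Lemma normc_cint_mulL2 f g : inL2 f -> inL2 g ->
  normc (cint leb (fun x => f x * g x)) <= nrm f * nrm g.
Proof.
move=> hf hg; apply: le_trans (cauchy_schwarz_int f g hf hg).
apply: (le_trans (normc_cint_le _ _ (cintegrable_mulL2 f g hf hg))).
by under eq_Rintegral do rewrite normc_mul.
Qed.

Definition rip f g : R := cRe (cint leb (fun x => f x * (g x)^*)).

Lemma nsq_add f g : inL2 f -> inL2 g ->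
  nsq (fun x => f x + g x) = nsq f + 2 * rip f g + nsq g.
Proof.
move=> hf hg; have /inL2P[mf if2] := hf; have /inL2P[mg ig2] := hg.
have [ifg _] := cintegrable_mulL2 f _ hf (inL2_conj g hg).
rewrite /rip /cint /= /nsq -RintegralZl// -RintegralD//; last exact: integrable_scaler.
rewrite -RintegralD//; last first.
  rewrite (_ : _ \o _ = (fun x => (EFin \o (fun x => (normc (f x) ^+ 2))%R) x + (EFin \o (fun x => (2 * cRe (f x * (g x)^*))%R)) x)%E).
    by apply: integrableD => //; exact: integrable_scaler.
  by apply/funext => x /=; rewrite EFinD.
by apply: eq_Rintegral => x _; exact: normc_add_sqr.
Qed.

Lemma rip_le f g : inL2 f -> inL2 g -> `|rip f g| <= nrm f * nrm g.
Proof.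
move=> hf hg; have hg' := inL2_conj g hg.
apply: (le_trans (normc_ge_cRe _)); apply: (le_trans (normc_cint_mulL2 f _ hf hg')).
by rewrite ler_wpM2l ?nrm_ge0// /nrm /nsq; under eq_Rintegral do rewrite normc_conj.
Qed.

Lemma nsq_scale z f : inL2 f -> nsq (fun x => z * f x) = normc z ^+ 2 * nsq f.
Proof.
move=> /inL2P[mf hf]; rewrite /nsq -RintegralZl//.
by apply: eq_Rintegral => x _; rewrite normc_mul exprMn.
Qed.

Lemma nrm_scale z f : inL2 f -> nrm (fun x => z * f x) = normc z * nrm f.
Proof.
move=> hf; rewrite /nrm nsq_scale// sqrtrM ?sqr_ge0// sqrtr_sqr ger0_norm ?normc_ge0//.
Qed.

Lemma nrm_conj f : nrm (fun x => (f x)^*) = nrm f.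
Proof. by rewrite /nrm /nsq; under eq_Rintegral do rewrite normc_conj. Qed.

Lemma nrm_add f g : inL2 f -> inL2 g -> nrm (fun x => f x + g x) <= nrm f + nrm g.
Proof.
move=> hf hg; rewrite -(@ler_pXn2r _ 2)// ?nnegrE ?addr_ge0 ?nrm_ge0//.
rewrite sqrrD !nrm2 nsq_add// lerD2r lerD2l mulr2n.
by have := le_trans (ler_norm _) (rip_le f g hf hg); lra.
Qed.

Lemma nrm_sub_sym f g : inL2 f -> inL2 g -> nrm (fun x => f x - g x) = nrm (fun x => g x - f x).
Proof.
move=> hf hg; rewrite /nrm /nsq; congr Num.sqrt; apply: eq_Rintegral => x _.
by rewrite -normc_opp opprB.
Qed.

Lemma nrm_sub_le f g : inL2 f -> inL2 g -> nrm f <= nrm g + nrm (fun x => f x - g x).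
Proof.
move=> hf hg; have := nrm_add g _ hg (inL2_sub f g hf hg).
by rewrite (_ : (fun x => g x + (f x - g x)) = f)//; apply/funext => x; rewrite addrC subrK.
Qed.

(** Completeness of L^2 for rapidly Cauchy sequences: summability of the weighted increments gives
    convergence almost everywhere, and Fatou's lemma bounds the distance to the limit. *)
Lemma nsq_complete (u : nat -> R -> R[i]) : (forall n, inL2 (u n)) ->
  (forall n m, (n <= m)%N -> nsq (fun x => u n x - u m x) <= (16^-1) ^+ n) ->
  exists2 h, inL2 h & forall n, nsq (fun x => u n x - h x) <= (16^-1) ^+ n.
Proof.
move=> hu cu.
(* The rate [16 ^ - n] is split in two: after multiplication by [4 ^ n] the integrals are still
   summable, and the boundedness of [w n x] in [n] still gives increments of size [2 ^ - n]. *)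
pose w (n : nat) (x : R) : R := 4 ^+ n * normc (u n x - u n.+1 x) ^+ 2.
have hd n m : inL2 (fun x => u n x - u m x) by exact: inL2_sub.
have mw n : measurable_fun setT (fun x : measurableTypeR R => (w n x)%:E).
  apply/measurable_EFinP; apply: measurable_funM => //.
  by apply: measurable_normc2; exact: inL2_cmeasurable.
have w0 n x : (0 <= (w n x)%:E)%E by rewrite lee_fin /w mulr_ge0 ?sqr_ge0// exprn_ge0.
have iw n : (\int[leb]_x (w n x)%:E <= ((4^-1) ^+ n)%:E)%E.
  have /inL2P[_ i2] := hd n n.+1.
  rewrite (_ : \int[leb]_x (w n x)%:E = (4 ^+ n * nsq (fun x => u n x - u n.+1 x))%:E)%E.
    rewrite lee_fin (le_trans (ler_wpM2l _ (cu _ _ (leqnSn n))))// ?exprn_ge0//.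
    by rewrite -exprMn (_ : 4 * 16^-1 = 4^-1 :> R)//; field.
  rewrite EFinM /nsq /Rintegral fineK; last exact: integrable_fin_num.
  rewrite -ge0_integralZl//; try (by rewrite lee_fin exprn_ge0); try (by move=> x _; rewrite lee_fin sqr_ge0);
    try (by apply/measurable_EFinP; apply: measurable_normc2; exact: inL2_cmeasurable).
have sw : (\int[leb]_x (\sum_(n <oo) (w n x)%:E) < +oo)%E.
  rewrite integral_nneseries//.
  apply: (@le_lt_trans _ _ (\sum_(n <oo) ((4^-1 : R) ^+ n)%:E)%E).
    by apply: lee_nneseries => n *; [apply: integral_ge0|exact: iw].
  have c4 : cvgn (series (geometric (1:R) (4^-1))).
    by apply: is_cvg_geometric_series; rewrite ger0_norm//; lra.
  rewrite (_ : (fun _ => _) = EFin \o series (geometric (1:R) (4^-1))); last first.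
    apply/funext => n /=; rewrite /series /= -sumEFin; apply: eq_bigr => i _.
    by rewrite mul1r.
  by rewrite EFin_lim// ltry.
have aefin : {ae leb, forall x, (\sum_(n <oo) (w n x)%:E < +oo)%E}.
  have : leb.-integrable setT (fun x => \sum_(n <oo) (w n x)%:E)%E.
    apply/integrableP; split; first exact: ge0_emeasurable_sum.
    by under eq_integral => x _ do rewrite gee0_abs ?nneseries_ge0//.
  move/(integrable_ae measurableT) => hae; apply: (ae_imp leb _ _ hae) => x /(_ I).
  by rewrite ge0_fin_numE// nneseries_ge0.
have aecv : {ae leb, forall x, exists l, ccvg (u ^~ x) l}.
  apply: (ae_imp leb _ _ aefin) => x Sx.
  have S0 : (0 <= \sum_(n <oo) (w n x)%:E)%E by exact: nneseries_ge0.
  pose K := fine (\sum_(n <oo) (w n x)%:E)%E.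
  have KE : (\sum_(n <oo) (w n x)%:E)%E = K%:E by rewrite fineK// ge0_fin_numE.
  have wK n : w n x <= K.
    rewrite -lee_fin -KE; apply: le_trans (nneseries_lim_ge n.+1 _) => //.
    by rewrite big_nat_recr//= leeDr// sume_ge0.
  have K0 : 0 <= K by rewrite -lee_fin -KE.
  have dn n : normc (u n.+1 x - u n x) <= Num.sqrt K * (2^-1) ^+ n.
    rewrite -normc_opp opprB -(@ler_pXn2r _ 2)// ?nnegrE ?normc_ge0 ?mulr_ge0 ?sqrtr_ge0 ?exprn_ge0//.
    rewrite exprMn sqr_sqrtr// -exprM mulnC exprM.
    have := wK n; rewrite /w mulrC -ler_pdivlMr ?exprn_gt0// => /le_trans; apply.
    by rewrite -exprVn (_ : 4^-1 = (2^-1) ^+ 2 :> R)//; field.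
  have cv (p : R[i] -> R) : (forall z w, p (z - w) = p z - p w) ->
      (forall z, `|p z| <= normc z) -> cvgn (fun n => p (u n x)).
    move=> pB pn.
    have : cvgn (series (telescope (fun n => p (u n x)))).
      apply: (@normed_cvg R R^o); apply: (series_le_cvg _ _ _ _ (v_ := geometric (Num.sqrt K) (2^-1))).
      - by move=> n /=.
      - by move=> n /=; rewrite mulr_ge0 ?sqrtr_ge0 ?exprn_ge0.
      - move=> n; have := le_trans (pn _) (dn n).
        by rewrite pB.
      - by apply: is_cvg_geometric_series; rewrite ger0_norm//; lra.
    rewrite telescopeK => /cvg_ex[/= l hl]; apply/cvg_ex; exists (l + p (u 0%N x)).
    rewrite (_ : (fun n => p (u n x)) = (fun n => (p (u n x) - p (u 0%N x)) + p (u 0%N x))).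
      by apply: cvgD hl _; exact: cvg_cst.
    by apply/funext => n; rewrite subrK.
  have /cvg_ex[l1 h1] := cv _ (fun z w => etrans (cRe_add z (- w)) (congr1 _ (cRe_opp w))) normc_ge_cRe.
  have /cvg_ex[l2 h2] := cv _ (fun z w => etrans (cIm_add z (- w)) (congr1 _ (cIm_opp w))) normc_ge_cIm.
  by exists (l1 +i* l2).
(* The upper limits are measurable and defined at every point; they agree with the limit wherever
   the sequence converges. *)
pose h x := fine (limn_esup (fun n => (cRe (u n x))%:E)) +i* fine (limn_esup (fun n => (cIm (u n x))%:E)).
have mh : cmeasurable (h : measurableTypeR R -> R[i]).
  split=> /=; apply: measurableT_comp => //; apply: measurable_fun_limn_esup => n; apply/measurable_EFinP.
    by case: (inL2_cmeasurable _ (hu n)).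
  by case: (inL2_cmeasurable _ (hu n)).
have aeh : {ae leb, forall x, ccvg (u ^~ x) (h x)}.
  apply: (ae_imp leb _ _ aecv) => x [l [l1 l2]].
  have e (s : nat -> R) (r : R) : s n @[n --> \oo] --> r -> fine (limn_esup (fun n => (s n)%:E)) = r.
    move=> sr; have /cvg_limn_einf_sup[_ ->//] : (s n)%:E @[n --> \oo] --> r%:E.
    by apply: cvg_EFin => //; exact: nearW.
  by rewrite /h /ccvg /= (e _ _ l1) (e _ _ l2).
(* Fatou's lemma for [u n - u m], with [n] fixed and [m] tending to infinity. *)
have fat n : (\int[leb]_x (normc (u n x - h x) ^+ 2)%:E <= ((16^-1) ^+ n)%:E)%E.
  pose F (m : nat) (x : R) : \bar R := (normc (u n x - u m x) ^+ 2)%:E.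
  have mF m : measurable_fun setT (F m : measurableTypeR R -> \bar R).
    by apply/measurable_EFinP; apply: measurable_normc2; exact: inL2_cmeasurable.
  have F0 m x : (0 <= F m x)%E by rewrite lee_fin sqr_ge0.
  have aeF : {ae leb, forall x, setT x -> limn_einf (F ^~ x) = (normc (u n x - h x) ^+ 2)%:E}.
    apply: (ae_imp leb _ _ aeh) => x [h1 h2] _.
    suff /cvg_limn_einf_sup[-> //] : F m x @[m --> \oo] --> (normc (u n x - h x) ^+ 2)%:E.
    apply: cvg_EFin; first exact: nearW.
    rewrite (_ : fine \o _ = fun m => (cRe (u n x) - cRe (u m x)) ^+ 2 + (cIm (u n x) - cIm (u m x)) ^+ 2).
      rewrite normcE2 !cE; apply: cvgD; apply: cvgM; apply: cvgB => //; exact: cvg_cst.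
    by apply/funext => m /=; rewrite normcE2 !cE.
  have mL : measurable_fun setT (fun x : measurableTypeR R => limn_einf (F ^~ x)).
    rewrite (_ : (fun _ => _) = (fun x => - limn_esup (fun m => - F m x))%E).
      by apply: measurableT_comp => //; apply: measurable_fun_limn_esup => m; exact: measurableT_comp.
    by apply/funext => x; rewrite -limn_einfN; congr limn_einf; apply/funext => m; exact: esym (oppeK _).
  have mN : measurable_fun setT (fun x : measurableTypeR R => (normc (u n x - h x) ^+ 2)%:E).
    apply/measurable_EFinP; apply: measurable_normc2; apply: cmeasurable_add; first exact: inL2_cmeasurable.
    exact: cmeasurable_opp.
  have -> : (\int[leb]_x (normc (u n x - h x) ^+ 2)%:E = \int[leb]_x limn_einf (F ^~ x))%E.
    by apply: ae_eq_integral => //; apply: (ae_imp leb _ _ aeF) => x e /e.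
  apply: (le_trans (fatou leb measurableT mF (fun m x _ => F0 m x))).
  rewrite limn_einf_lim; apply: lime_le; first exact: is_cvg_einfs.
  (* The infimum over the indices past [k] is bounded by its value at [maxn k n], an index to which
     the Cauchy estimate applies. *)
  near=> k; apply: ge_ereal_inf; exists (\int[leb]_x F (maxn k n) x)%E.
    by exists (maxn k n) => //=; exact: leq_maxl.
  have /inL2P[_ i2] := hd n (maxn k n).
  by rewrite -[leLHS]fineK ?lee_fin; [exact: (cu n (maxn k n) (leq_maxr _ _))|exact: integrable_fin_num].
have hdiff n : inL2 (fun x => u n x - h x).
  apply/inL2P; split.
    by apply: cmeasurable_add; [exact: inL2_cmeasurable|exact: cmeasurable_opp].
  apply/integrableP; split.
    apply/measurable_EFinP; apply: measurable_normc2; apply: cmeasurable_add; first exact: inL2_cmeasurable.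
    exact: cmeasurable_opp.
  apply: le_lt_trans (ltry ((16^-1) ^+ n)); apply: le_trans (fat n).
  by rewrite le_eqVlt; apply/orP; left; apply/eqP; apply: eq_integral => x _; rewrite /= ger0_norm ?sqr_ge0.
exists h.
  have := inL2_sub _ _ (hu 0%N) (hdiff 0%N).
  by congr inL2; apply/funext => x; rewrite opprB addrC subrK.
move=> n; have /inL2P[_ i2] := hdiff n.
by rewrite -lee_fin /nsq /Rintegral fineK; [exact: fat|exact: integrable_fin_num].
Unshelve. all: by end_near. Qed.

End SquareIntegrable.

(** * Bounded bilinear forms on Schwartz functions *)

Lemma choice_fun {A B : Type} (P : A -> B -> Prop) : (forall a, exists b, P a b) ->
  exists f, forall a, P a (f a).
Proof. by move=> h; exists (fun a => sval (cid (h a))) => a; case: cid. Qed.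

Section Riesz.
Context {R : realType}.
Implicit Types (f g h : R -> R[i]) (x a b : R) (z : R[i]).

(** The closure of the Schwartz functions in L^2, within which an element is determined by its
    pairings with Schwartz functions ([closure_orthogonal]). *)
Definition schwartz_closure h := forall e : R, 0 < e ->
  exists2 g, schwartz g & nrm (fun x => h x - g x) <= e.

Lemma schwartz0 : schwartz (fun _ : R => 0 : R[i]).
Proof.
have := bump_schwartz 1 (-1) 1 _ (@ltr01 R) (bump_scale 1 (-1) 1 0 _ (plateau_bump 1 (-1) 1 (@ltr01 R))).
by congr schwartz; apply/funext => x; rewrite mul0r.
Qed.

Lemma ler_geom (X c : R) : (forall n, X <= c * (4^-1) ^+ n) -> X <= 0.
Proof.
move=> h; have h4 : c * (4^-1) ^+ n @[n --> \oo] --> (c * 0 : R).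
  apply: cvgM; first exact: cvg_cst.
  by apply: cvg_expr; rewrite ger0_norm//; lra.
rewrite mulr0 in h4; rewrite -(cvg_lim _ h4)//; apply: limr_ge.
  by apply/cvg_ex; exists 0.
exact: nearW.
Qed.

Lemma rip_addl f g h : inL2 f -> inL2 g -> inL2 h ->
  rip (fun x => f x + g x) h = rip f h + rip g h.
Proof.
move=> hf hg hh; have hh' := inL2_conj h hh; rewrite /rip -cRe_add -cint_add; try exact: cintegrable_mulL2.
by congr cRe; apply: eq_cint => x; rewrite mulrDl.
Qed.

Lemma rip_scaler f g a : inL2 f -> inL2 g -> rip f (fun x => a%:C * g x) = a * rip f g.
Proof.
move=> hf hg; have hg' := inL2_conj g hg; rewrite /rip.
transitivity (cRe (a%:C * cint leb (fun x => f x * (g x)^*))); last by rewrite cE /= mul0r subr0.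
rewrite -cint_scale; last exact: cintegrable_mulL2.
by congr cRe; apply: eq_cint => x; apply: complex_ext; rewrite !cE /=; ring.
Qed.

Lemma rip_self f : inL2 f -> rip f f = nsq f.
Proof.
move=> hf; rewrite /rip /nsq -[RHS]/(cRe (\int[leb]_x normc (f x) ^+ 2)%:C) -cint_real.
by congr cRe; apply: eq_cint => x; rewrite conj_mulE.
Qed.

(** For Schwartz [g], orthogonality gives [nsq h = rip h (h - g)], and [g] may be taken arbitrarily
    close to [h]. *)
Lemma closure_orthogonal h : inL2 h -> schwartz_closure h ->
  (forall g, schwartz g -> cint leb (fun x => h x * g x) = 0) -> ceq_ae leb h (fun=> 0).
Proof.
move=> hh ch oh; apply: nsq_eq0 => //; apply/eqP; rewrite eq_le nsq_ge0 andbT.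
have N0 := nrm_ge0 h.
apply/ler_addgt0Pr => e e0; rewrite add0r.
have d0 : 0 < e / (nrm h + 1) by rewrite divr_gt0// ltr_pwDr.
have [g sg hg] := ch _ d0; have ig := schwartz_inL2 g sg.
have id := inL2_sub h g hh ig.
have -> : nsq h = rip h (fun x => h x - g x).
  rewrite -rip_self// /rip (_ : cint leb (fun x => h x * (h x - g x)^*) =
    cint leb (fun x => h x * (h x)^*) - cint leb (fun x => h x * (g x)^*)).
    by rewrite (oh (fun x => (g x)^*)) ?subr0//; exact: schwartz_conj.
  rewrite -cint_sub; try by apply: cintegrable_mulL2 => //; exact: inL2_conj.
  by apply: eq_cint => x; apply: complex_ext; rewrite !cE; ring.
apply: (le_trans (ler_norm _)); apply: (le_trans (rip_le _ _ hh id)).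
apply: (@le_trans _ _ ((nrm h + 1) * (e / (nrm h + 1)))).
  by rewrite ler_pM ?nrm_ge0// lerDl.
by rewrite mulrC divfK// gt_eqF// ltr_pwDr.
Qed.

Lemma schwartz_closure_lin z f g : inL2 f -> inL2 g -> schwartz_closure f -> schwartz_closure g ->
  schwartz_closure (fun x => z * f x + g x).
Proof.
move=> if_ ig cf cg e e0.
have N0 := normc_ge0 z.
have d0 : 0 < e / 2 / (normc z + 1) by rewrite !divr_gt0// ltr_pwDr.
have e20 : 0 < e / 2 by rewrite divr_gt0.
have [f' sf' hf'] := cf _ d0; have [g' sg' hg'] := cg _ e20.
exists (fun x => z * f' x + g' x); first by apply: schwartz_add => //; exact: schwartz_scale.
rewrite (_ : (fun x => _) = (fun x => z * (f x - f' x) + (g x - g' x))); last first.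
  by apply/funext => x; ring.
have i1 := inL2_sub _ _ if_ (schwartz_inL2 _ sf').
have i2 := inL2_sub _ _ ig (schwartz_inL2 _ sg').
apply: (le_trans (nrm_add _ _ (inL2_scale z _ i1) i2)); rewrite nrm_scale//.
rewrite [e]splitr lerD//; apply: (@le_trans _ _ ((normc z + 1) * (e / 2 / (normc z + 1)))).
  by rewrite ler_pM ?nrm_ge0// lerDl.
by rewrite mulrC divfK// gt_eqF// ltr_pwDr.
Qed.

Section RieszRepresentation.
Variables (lam : (R -> R[i]) -> R[i]) (K : R).
Hypothesis K0 : 0 <= K.
Hypothesis lam_lin : forall z g h, schwartz g -> schwartz h ->
  lam (fun x => z * g x + h x) = z * lam g + lam h.
Hypothesis lam_le : forall g, schwartz g -> normc (lam g) <= K * nrm g.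

(** The conjugation converts the bilinear pairing of the functional [lam] into the Hermitian inner
    product. A minimiser of the quadratic functional [J] built on [l] then satisfies [rip u g = l g]
    for all Schwartz [g]. *)
Let l g := cRe (lam (fun x => (g x)^*)).
Let J u := nsq u - 2 * l u.

Let l_lin t g h : schwartz g -> schwartz h -> l (fun x => h x + t%:C * g x) = l h + t * l g.
Proof.
move=> sg sh; rewrite /l (_ : (fun x => _) = (fun x => t%:C * (g x)^* + (h x)^*)).
  rewrite lam_lin; try exact: schwartz_conj.
  by rewrite !cE /= mul0r subr0 addrC.
by apply/funext => x; apply: complex_ext; rewrite !cE /=; ring.
Qed.

Let J_exp u g t : schwartz u -> schwartz g ->
  J (fun x => u x + t%:C * g x) = J u + 2 * t * (rip u g - l g) + t ^+ 2 * nsq g.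
Proof.
move=> su sg; have iu := schwartz_inL2 u su; have ig := schwartz_inL2 g sg.
rewrite /J l_lin// nsq_add//; last exact: inL2_scale.
rewrite rip_scaler// nsq_scale// normc_real real_normK ?num_real//; ring.
Qed.

Let J_ge u : schwartz u -> - K ^+ 2 <= J u.
Proof.
move=> su; rewrite /J -nrm2.
have : l u <= K * nrm u.
  rewrite -[nrm u]nrm_conj; apply: le_trans (lam_le _ (schwartz_conj u su)).
  exact: le_trans (ler_norm _) (normc_ge_cRe _).
have := sqr_ge0 (nrm u - K); nra.
Qed.

(* The representing function is the limit of a minimizing sequence of J over the Schwartz functions. *)
Lemma riesz : exists h, [/\ inL2 h, schwartz_closure h,
  forall g, schwartz g -> cint leb (fun x => h x * g x) = lam g & nrm h <= K].
Proof.
pose E := [set J u | u in schwartz].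
have infE : has_inf E.
  split; first by exists (J (fun=> 0)), (fun=> 0) => //; exact: schwartz0.
  by exists (- K ^+ 2) => _ [u su <-]; exact: J_ge.
pose d := inf E.
have dJ u : schwartz u -> d <= J u.
  by move=> su; apply: ge_inf; [case: infE|exists u].
(* The parallelogram identity bounds the squared distance of two terms by [2 (delta n + delta m)];
   dividing by 4 here yields the rate required by [nsq_complete]. *)
pose delta n : R := (16^-1) ^+ n / 4.
have delta0 n : 0 < delta n by rewrite divr_gt0// exprn_gt0// invr_gt0.
have [u hu] : exists u : nat -> R -> R[i], forall n, schwartz (u n) /\ J (u n) < d + delta n.
  apply: (@choice_fun _ _ (fun n u => schwartz u /\ J u < d + delta n)) => n.
  by have [_ [v sv <-] hv] := inf_adherent (delta0 n) infE; exists v.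
have su n := (hu n).1; have Ju n := (hu n).2; have iu n := schwartz_inL2 _ (su n).
have cau n m : (n <= m)%N -> nsq (fun x => u n x - u m x) <= (16^-1) ^+ n.
  move=> nm; pose w x := u n x - u m x.
  have sw : schwartz w.
    have := schwartz_add _ _ (su n) (schwartz_scale (-1) _ (su m)).
    by congr schwartz; apply/funext => x; rewrite mulN1r.
  (* Expanding [J] from [u m] at the end [u n] of the segment and at its midpoint, where [J] is at
     least [d], gives the parallelogram identity. *)
  have e1 := J_exp (u m) w 1 (su m) sw.
  have e1' : (fun x => u m x + 1%:C * w x) = u n.
    by apply/funext => x; rewrite mul1r /w addrC subrK.
  rewrite e1' in e1.
  have e2 := J_exp (u m) w (2^-1) (su m) sw.
  have smid : schwartz (fun x => u m x + (2^-1)%:C * w x).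
    by apply: schwartz_add => //; exact: schwartz_scale.
  have := dJ _ smid; rewrite e2 => h2.
  have dnm : delta m <= delta n.
    by rewrite ler_pM2r ?invr_gt0// ler_wiXn2l//; lra.
  have := Ju n; have := Ju m; rewrite /delta in dnm *; rewrite -/w.
  by move: e1 h2 dnm; lra.
have [h ih hh] := nsq_complete u iu cau.
have hn n : nrm (fun x => h x - u n x) <= (4^-1) ^+ n.
  rewrite nrm_sub_sym// -(@ler_pXn2r _ 2)// ?nnegrE ?nrm_ge0 ?exprn_ge0//.
  by rewrite nrm2 (le_trans (hh n))// -exprM mulnC exprM le_eqVlt; apply/orP; left; apply/eqP; congr (_ ^+ _); field.
have ch : schwartz_closure h.
  move=> e e0; have : (4^-1) ^+ n @[n --> \oo] --> (0 : R).
    by apply: cvg_expr; rewrite ger0_norm//; lra.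
  move/cvgr0_norm_le => /(_ e e0) [n _ /(_ n (leqnn n))] /=.
  rewrite ger0_norm ?exprn_ge0// => he.
  by exists (u n) => //; exact: le_trans (hn n) he.
have idf n : inL2 (fun x => h x - u n x) by exact: inL2_sub.
have ripl g : schwartz g -> rip h g = l g.
  move=> sg; have ig := schwartz_inL2 g sg; have g0 := nsq_ge0 g.
  apply/eqP; rewrite -subr_eq0 -normr_le0.
  apply: (ler_geom _ (nsq g + 1 + nrm g)) => n.
  pose A := rip (u n) g - l g.
  have -> : rip h g - l g = A + rip (fun x => h x - u n x) g.
    rewrite /A addrAC -rip_addl//; congr (rip _ g - _); apply/funext => x.
    by rewrite addrC subrK.
  apply: (le_trans (ler_normD _ _)); rewrite mulrDl lerD//; last first.
    by apply: (le_trans (rip_le _ _ (idf n) ig)); rewrite mulrC ler_wpM2l ?nrm_ge0.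
  have G1 : 0 < nsq g + 1 by rewrite ltr_wpDl.
  (* The step along [g] that nearly minimises [J], with [nsq g + 1] instead of [nsq g] to avoid a
     division by 0. Near-minimality of [u n] then bounds [A ^ 2] by a multiple of [delta n]. *)
  have st : schwartz (fun x => u n x + (- A / (nsq g + 1))%:C * g x).
    by apply: schwartz_add => //; exact: schwartz_scale.
  have := dJ _ st; rewrite J_exp// -/A => h1.
  have h2 : A ^+ 2 <= (nsq g + 1) * delta n.
    have : A ^+ 2 / (nsq g + 1) <= delta n.
      have e : 2 * (- A / (nsq g + 1)) * A + (- A / (nsq g + 1)) ^+ 2 * nsq g =
         - (A ^+ 2 / (nsq g + 1)) - A ^+ 2 / (nsq g + 1) ^+ 2.
        by field; rewrite gt_eqF.
      have : 0 <= A ^+ 2 / (nsq g + 1) ^+ 2 by rewrite divr_ge0 ?sqr_ge0.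
      have := Ju n; move: h1 e; lra.
    by rewrite ler_pdivrMr// mulrC.
  rewrite -(@ler_pXn2r _ 2)// ?nnegrE ?mulr_ge0 ?exprn_ge0 ?(ltW G1)//.
  rewrite real_normK ?num_real// (le_trans h2)// exprMn expr2 -[leRHS]mulrA.
  rewrite ler_wpM2l ?(ltW G1)// -exprM mulnC exprM (_ : (4^-1) ^+ 2 = 16^-1 :> R); last by field.
  rewrite /delta; have : 0 <= (16^-1 : R) ^+ n by rewrite exprn_ge0.
  by move: g0; nra.
have main g : schwartz g -> cint leb (fun x => h x * g x) = lam g.
  have re g' : schwartz g' -> cRe (cint leb (fun x => h x * g' x)) = cRe (lam g').
    move=> sg'; have := ripl _ (schwartz_conj g' sg'); rewrite /rip /l.
    have -> : (fun x => ((g' x)^*)^*) = g'.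
      by apply/funext => x; apply: complex_ext; rewrite !cE ?opprK.
    by move=> <-; congr cRe; apply: eq_cint => x; congr (_ * _); apply: complex_ext; rewrite !cE ?opprK.
  move=> sg; apply: complex_ext; first exact: re.
  (* The real part for [- i g] is the imaginary part for [g]. *)
  have := re _ (schwartz_scale (0 +i* (-1)) g sg).
  rewrite (_ : (fun x => (0 +i* (-1)) * g x) = (fun x => (0 +i* (-1)) * g x + 0)); last first.
    by apply/funext => x; rewrite addr0.
  rewrite lam_lin//; last exact: schwartz0.
  have l0 : lam (fun=> 0) = 0.
    have e : (fun _ : R => 1 * 0 + 0 : R[i]) = (fun=> 0).
      by apply/funext => x; rewrite mulr0 addr0.
    have := lam_lin 1 _ _ schwartz0 schwartz0; rewrite e mul1r => e0.
    by apply: (addrI (lam (fun=> 0))); rewrite addr0 -e0.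
  rewrite l0 addr0 (_ : cint leb _ = (0 +i* (-1)) * cint leb (fun x => h x * g x)).
    by rewrite !cE /= !mul0r !sub0r !mulN1r !opprK.
  rewrite -cint_scale; last by apply: cintegrable_mulL2 => //; exact: schwartz_inL2.
  by apply: eq_cint => x; ring.
exists h; split=> //.
have N0 := nrm_ge0 h.
(* The bound on [lam] concerns Schwartz functions, so [h] is tested against its approximants [u n]
   rather than against itself. *)
have : nsq h <= K * nrm h.
  rewrite -subr_le0; apply: (ler_geom _ (K + nrm h)) => n.
  rewrite lerBlDr -rip_self//.
  have -> : rip h h = rip h (u n) + rip h (fun x => h x - u n x).
    rewrite /rip -cRe_add -cint_add; try by apply: cintegrable_mulL2 => //; exact: inL2_conj.
    by congr cRe; apply: eq_cint => x; apply: complex_ext; rewrite !cE; ring.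
  have a1 : rip h (u n) <= K * (nrm h + (4^-1) ^+ n).
    rewrite /rip main; last exact: schwartz_conj.
    apply: (le_trans (ler_norm _)); apply: (le_trans (normc_ge_cRe _)).
    apply: (le_trans (lam_le _ (schwartz_conj _ (su n)))); rewrite ler_wpM2l// nrm_conj.
    apply: (le_trans (nrm_sub_le _ h (iu n) ih)).
    by rewrite lerD2l nrm_sub_sym.
  have a2 : rip h (fun x => h x - u n x) <= nrm h * (4^-1) ^+ n.
    apply: (le_trans (ler_norm _)); apply: (le_trans (rip_le _ _ ih (idf n))).
    by rewrite ler_wpM2l.
  by move: a1 a2; lra.
rewrite -nrm2 expr2; have [->//|n0] := eqVneq (nrm h) 0.
by rewrite ler_pM2r// lt_neqAle eq_sym n0.
Qed.

End RieszRepresentation.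

(* T f represents g |-> \int f k_g, where k_g represents b(., g). *)
Lemma bilinear_operator (b : (R -> R[i]) -> (R -> R[i]) -> R[i]) (K : R) : 0 <= K ->
  (forall z f f' g, schwartz f -> schwartz f' -> schwartz g ->
     b (fun x => z * f x + f' x) g = z * b f g + b f' g) ->
  (forall z f g g', schwartz f -> schwartz g -> schwartz g' ->
     b f (fun x => z * g x + g' x) = z * b f g + b f g') ->
  (forall f g, schwartz f -> schwartz g -> normc (b f g) <= K * nrm f * nrm g) ->
  exists T : (R -> R[i]) -> R -> R[i],
    [/\ forall f, inL2 f -> inL2 (T f),
        forall z f g, inL2 f -> inL2 g ->
          ceq_ae leb (T (fun x => z * f x + g x)) (fun x => z * T f x + T g x),
        forall f, inL2 f -> nrm (T f) <= K * nrm f &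
        forall f g, schwartz f -> schwartz g -> cint leb (fun x => T f x * g x) = b f g].
Proof.
move=> K0 bl br bK.
(* Representing functions in the closure are unique, which turns linearity of the pairings into
   linearity almost everywhere of the functions. *)
have uniq h1 h2 z h3 : inL2 h1 -> inL2 h2 -> inL2 h3 ->
    schwartz_closure h1 -> schwartz_closure h2 -> schwartz_closure h3 ->
    (forall g, schwartz g -> cint leb (fun x => h3 x * g x) =
       z * cint leb (fun x => h1 x * g x) + cint leb (fun x => h2 x * g x)) ->
    ceq_ae leb h3 (fun x => z * h1 x + h2 x).
  move=> i1 i2 i3 c1 c2 c3 e.
  have i12 : inL2 (fun x => z * h1 x + h2 x) by apply: inL2_add => //; exact: inL2_scale.
  have c12 := schwartz_closure_lin z h1 h2 i1 i2 c1 c2.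
  have h0 : ceq_ae leb (fun x => -1 * (z * h1 x + h2 x) + h3 x) (fun=> 0).
    apply: closure_orthogonal.
    - by apply: inL2_add => //; exact: inL2_scale.
    - exact: schwartz_closure_lin.
    - move=> g sg; have ig := schwartz_inL2 g sg.
      have j1 := cintegrable_mulL2 h1 g i1 ig; have j2 := cintegrable_mulL2 h2 g i2 ig.
      have j3 := cintegrable_mulL2 h3 g i3 ig.
      rewrite (_ : cint leb _ = cint leb (fun x => h3 x * g x - (z * (h1 x * g x) + h2 x * g x))).
        rewrite cint_sub//; last by apply: cintegrable_add => //; exact: cintegrable_scale.
        rewrite cint_add//; last exact: cintegrable_scale.
        by rewrite cint_scale// e// subrr.
      by apply: eq_cint => x; ring.
  apply: (ae_imp leb _ _ h0) => x e0; apply/eqP; rewrite -subr_eq0 -e0; apply/eqP; ring.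
have [k hk] : exists k : (R -> R[i]) -> (R -> R[i]), forall g, schwartz g ->
   [/\ inL2 (k g), schwartz_closure (k g),
    forall f, schwartz f -> cint leb (fun x => k g x * f x) = b f g & nrm (k g) <= K * nrm g].
  apply: (@choice_fun _ _ (fun g kg => schwartz g -> [/\ inL2 kg, schwartz_closure kg,
    forall f, schwartz f -> cint leb (fun x => kg x * f x) = b f g & nrm kg <= K * nrm g])) => g.
  have [sg|nsg] := pselect (schwartz g); last by exists (fun=> 0).
  have [|||h hh] := riesz (fun f => b f g) (K * nrm g) _ _ _.
  - by rewrite mulr_ge0 ?nrm_ge0.
  - by move=> z f h sf sh; exact: bl.
  - by move=> f sf; rewrite mulrAC; exact: bK.
  by exists h.
have klin z g g' : schwartz g -> schwartz g' ->
    ceq_ae leb (k (fun x => z * g x + g' x)) (fun x => z * k g x + k g' x).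
  move=> sg sg'; have sz : schwartz (fun x => z * g x + g' x).
    by apply: schwartz_add => //; exact: schwartz_scale.
  have [i1 c1 e1 _] := hk _ sg; have [i2 c2 e2 _] := hk _ sg'; have [i3 c3 e3 _] := hk _ sz.
  by apply: uniq => // f sf; rewrite e1// e2// e3// br.
(* [T f] is defined for every [f] in L^2 at once, since the pairing of [f] with [k g] makes sense
   for all of them. *)
have [T hT] : exists T : (R -> R[i]) -> (R -> R[i]), forall f, inL2 f ->
   [/\ inL2 (T f), schwartz_closure (T f),
    forall g, schwartz g -> cint leb (fun x => T f x * g x) = cint leb (fun x => f x * k g x) &
    nrm (T f) <= K * nrm f].
  apply: (@choice_fun _ _ (fun f Tf => inL2 f -> [/\ inL2 Tf, schwartz_closure Tf,
    forall g, schwartz g -> cint leb (fun x => Tf x * g x) = cint leb (fun x => f x * k g x) &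
    nrm Tf <= K * nrm f])) => f.
  have [if_|nif] := pselect (inL2 f); last by exists (fun=> 0).
  have [|||h hh] := riesz (fun g => cint leb (fun x => f x * k g x)) (K * nrm f) _ _ _.
  - by rewrite mulr_ge0 ?nrm_ge0.
  - move=> z g g' sg sg'; have sz : schwartz (fun x => z * g x + g' x).
      by apply: schwartz_add => //; exact: schwartz_scale.
    have [i1 _ _ _] := hk _ sg; have [i2 _ _ _] := hk _ sg'; have [i3 _ _ _] := hk _ sz.
    have j1 := cintegrable_mulL2 f _ if_ i1; have j2 := cintegrable_mulL2 f _ if_ i2.
    rewrite -cint_scale// -cint_add//; last exact: cintegrable_scale.
    apply: cint_ae_eq.
    + by apply: cmeasurable_mul; exact: inL2_cmeasurable.
    + by apply: cmeasurable_add; [apply: cmeasurable_mul; [exact: cmeasurable_cst|]|]; apply: cmeasurable_mul; exact: inL2_cmeasurable.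
    + by apply: (ae_imp leb _ _ (klin z g g' sg sg')) => x ->; ring.
  - move=> g sg; have [i1 _ _ n1] := hk _ sg; apply: (le_trans (normc_cint_mulL2 f _ if_ i1)).
    by rewrite mulrAC mulrC ler_wpM2r ?nrm_ge0.
  by exists h.
exists T; split.
- by move=> f if_; case: (hT _ if_).
- move=> z f g if_ ig; have iz : inL2 (fun x => z * f x + g x).
    by apply: inL2_add => //; exact: inL2_scale.
  have [i1 c1 e1 _] := hT _ if_; have [i2 c2 e2 _] := hT _ ig; have [i3 c3 e3 _] := hT _ iz.
  apply: uniq => // h sh; rewrite e1// e2// e3//.
  have [ik _ _ _] := hk _ sh.
  have j1 := cintegrable_mulL2 f _ if_ ik; have j2 := cintegrable_mulL2 g _ ig ik.
  rewrite -cint_scale// -cint_add//; last exact: cintegrable_scale.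
  by apply: eq_cint => x; ring.
- by move=> f if_; case: (hT _ if_).
- move=> f g sf sg; have [_ _ e _] := hT _ (schwartz_inL2 f sf); rewrite e//.
  have [_ _ e' _] := hk _ sg; rewrite -e'//.
  by apply: eq_cint => x; rewrite mulrC.
Qed.

End Riesz.

(** * Functions vanishing against plateaus *)

Section DynkinZero.
Context {d d' : measure_display} {T : measurableType d} {X : measurableType d'} {R : realType}.
Variables (mu : {measure set T -> \bar R}) (w : T -> R) (E : set T) (phi : T -> X) (G : set (set X)).

(** The sets over whose preimage the integral vanishes form a Dynkin system. The set [E] and the map
    [phi] allow one side of a rectangle to vary while the other is kept fixed. *)
Lemma dynkin_zero : mu.-integrable setT (EFin \o w) -> measurable E -> measurable_fun setT phi ->
  @measurable _ X = <<s G >> -> setI_closed G -> (\int[mu]_(x in E) (w x)%:E = 0)%E ->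
  (forall A, G A -> \int[mu]_(x in E `&` phi @^-1` A) (w x)%:E = 0)%E ->
  forall A, measurable A -> (\int[mu]_(x in E `&` phi @^-1` A) (w x)%:E = 0)%E.
Proof.
move=> iw mE mphi GE GI E0 G0 A mA.
have mpre B : measurable B -> measurable (phi @^-1` B).
  by move=> mB; rewrite -[X in measurable X]setTI; exact: mphi.
have mw : measurable_fun setT (EFin \o w) := measurable_int _ iw.
pose P B := (\int[mu]_(x in E `&` phi @^-1` B) (w x)%:E = 0)%E.
rewrite -/(P A); have sA : <<s G >> A by rewrite -GE.
apply: (@dynkin_induction _ X G P GE GI _ _ _ _ A sA).
- by rewrite /P preimage_setT setIT.
- exact: G0.
- move=> S mS PS; rewrite /P.
  have := E0; rewrite -{1}(setIT E) -(setUCr (phi @^-1` S)) setIUr integral_setU//; last first.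
  + by apply/disj_setPS => x [[_ a] [_ b]]; exact: b.
  + exact: measurable_funS mw.
  + by apply: measurableI => //; apply: measurableC; exact: mpre.
  + by apply: measurableI => //; exact: mpre.
  by rewrite PS add0e.
- move=> F mF tF PF; rewrite /P preimage_bigcup setI_bigcupr integral_bigcup.
  + by apply: eseries0 => i _ _; exact: PF.
  + apply/trivIsetP => i j _ _ ij; move/trivIsetP : tF => /(_ i j I I ij) FF.
    rewrite -subset0 => x [[_ a] [_ b]]; rewrite -[set0]/(set0 : set X) in FF *.
    by have : (F i `&` F j) (phi x) by []; rewrite FF.
  + by move=> k; apply: measurableI => //; exact: mpre.
  + apply: integrableS iw => //; apply: bigcupT_measurable => k; apply: measurableI => //; exact: mpre.
Qed.
End DynkinZero.

Lemma Rintegral_dominated0 {d : measure_display} {T : measurableType d} {R : realType}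
    (mu : {measure set T -> \bar R}) (u : nat -> T -> R) (v g : T -> R) :
  (forall n, measurable_fun setT (u n)) -> measurable_fun setT v ->
  mu.-integrable setT (EFin \o g) -> (forall n x, `|u n x| <= g x) ->
  (forall x, u n x @[n --> \oo] --> v x) -> (forall n, \int[mu]_x u n x = 0) ->
  \int[mu]_x v x = 0.
Proof.
move=> mu_ mv ig ug uv u0.
have := Rintegral_dominated_cvg mu u v g mu_ mv ig ug (aeW mu uv).
by under eq_fun do rewrite u0; move=> h; apply: (cvg_unique _ h) => //; exact: cvg_cst.
Qed.

Section ZeroFromBoxes.
Context {R : realType}.
Implicit Types (l r x y M : R).
Local Notation mR := (measurableTypeR R).

Definition ind l r x : R := if l < x < r then 1 else 0.

Lemma ind_ge0 l r x : 0 <= ind l r x.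
Proof. by rewrite /ind; case: ifP. Qed.

Lemma ind_le1 l r x : ind l r x <= 1.
Proof. by rewrite /ind; case: ifP. Qed.

Lemma indE l r : ind l r = \1_(`]l, r[%classic : set R).
Proof. by apply/funext => x; rewrite indicE /ind mem_setE in_itv; case: ifP. Qed.

Lemma measurable_ind l r : measurable_fun setT (ind l r : mR -> R).
Proof. by rewrite indE; exact: measurable_indic. Qed.

Lemma ind_max l r l' r' x : ind (Num.max l l') (Num.min r r') x = ind l r x * ind l' r' x.
Proof.
rewrite /ind gt_max lt_min.
by case: (l < x); case: (l' < x); case: (x < r); case: (x < r'); rewrite /= ?mulr1 ?mulr0.
Qed.

Lemma plateau_ind k l r x : 0 <= plateau k.+1%:R l r x <= ind l r x.
Proof. by rewrite plateau_ge0 plateau_le1// ltr0n. Qed.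

Lemma measurable_plateau k l r : measurable_fun setT (plateau k.+1%:R l r : mR -> R).
Proof.
have k0 : 0 < k.+1%:R :> R by rewrite ltr0n.
have [+ _] := schwartz_cmeasurable _ (bump_schwartz _ _ _ _ k0 (plateau_bump _ l r k0)).
by [].
Qed.

Lemma ind_eventually x : \forall n \near \oo, ind (- n%:R) n%:R x = 1.
Proof.
near=> n; rewrite /ind -ltr_norml.
by have -> : `|x| < n%:R by near: n; exact: nbhs_infty_gtr.
Unshelve. all: by end_near.
Qed.

Lemma RGenOpensI : setI_closed (@RGenOpens.G R).
Proof.
move=> _ _ [a [b ->]] [c [e ->]]; exists (Num.max a c), (Num.min b e).
apply/seteqP; split => x /=; rewrite !in_itv/= gt_max lt_min => h.
  by case: h => /andP[-> ->] /andP[-> ->].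
by case/andP: h => /andP[-> ->] /andP[-> ->].
Qed.

Lemma zero_of_intervals (w : R -> R) : leb.-integrable setT (EFin \o w) ->
  \int[leb]_x w x = 0 -> (forall l r, \int[leb]_x (w x * ind l r x) = 0) ->
  {ae leb, forall x, w x = 0}.
Proof.
move=> iw w0 wlr.
have E0 l r : (\int[leb]_(x in `]l, r[) (w x)%:E = 0)%E.
  have := wlr l r; rewrite indE.
  have -> : (fun x => w x * \1_(`]l, r[ : set R) x) = w \_ (`]l, r[ : set R).
    by apply/funext => x; rewrite patchE indicE; case: ifP; rewrite ?mulr1 ?mulr0.
  rewrite -Rintegral_mkcond => h; rewrite -[LHS]fineK; first exact: (congr1 EFin h).
  by apply: integrable_fin_num => //; exact: integrableS iw.
have w00 : (\int[leb]_x (w x)%:E = 0)%E.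
  by rewrite -[LHS]fineK; [exact: (congr1 EFin w0)|exact: integrable_fin_num].
have key := dynkin_zero leb w setT id (@RGenOpens.G R) iw measurableT (@measurable_id _ _ _)
  (@RGenOpens.measurableE R) RGenOpensI w00.
have h : ae_eq leb setT (EFin \o w) (cst 0%E).
  apply: integral_ae_eq => // A _ mA; rewrite integral0.
  rewrite -[A in LHS]setTI; apply: (key _ A mA) => _ [a [b ->]].
  by rewrite setTI; exact: E0.
by apply: (ae_imp leb _ _ h) => x /(_ I) [].
Qed.

(** Dominated convergence replaces plateaus by indicators of intervals; the windows between [- M]
    and [M] reduce a locally integrable function to integrable ones. *)
Lemma zero_of_plateaus (v : R -> R) : measurable_fun setT (v : mR -> R) ->
  (forall M, leb.-integrable setT (EFin \o (fun x => v x * ind (- M) M x))) ->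
  (forall k l r, \int[leb]_x (v x * plateau k.+1%:R l r x) = 0) ->
  {ae leb, forall x, v x = 0}.
Proof.
move=> mv iv h.
have lim l r M : \int[leb]_x (v x * ind (- M) M x * ind l r x) = 0.
  have -> : (fun x => v x * ind (- M) M x * ind l r x) = fun x => v x * ind (Num.max (- M) l) (Num.min M r) x.
    by apply/funext => x; rewrite ind_max mulrA.
  set l' := Num.max _ _; set r' := Num.min _ _.
  apply: (Rintegral_dominated0 leb (fun k x => v x * plateau k.+1%:R l' r' x)
    (fun x => v x * ind l' r' x) (fun x => `|v x * ind (- M) M x|) _ _ _ _ _ _) => //.
  - by move=> k; apply: measurable_funM => //; exact: measurable_plateau.
  - by apply: measurable_funM => //; exact: measurable_ind.
  - by have := integrable_norm (iv M); congr (_.-integrable _ _).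
  - move=> k x; have /andP[p0 p1] := plateau_ind k l' r' x; rewrite !normrM ler_wpM2l//.
    rewrite !ger0_norm ?ind_ge0//; apply: (le_trans p1); rewrite ind_max.
    by rewrite ler_piMr ?ind_ge0 ?ind_le1.
  - by move=> x; apply: cvgM; [exact: cvg_cst|exact: plateau_cvg].
have hn n : {ae leb, forall x, v x * ind (- n%:R) n%:R x = 0}.
  apply: zero_of_intervals; [exact: iv| |by move=> l r; exact: lim].
  rewrite -[RHS](lim (- n%:R) n%:R n%:R); apply: eq_Rintegral => x _.
  by rewrite /ind; case: ifP; rewrite ?mulr1 ?mulr0.
have hall : {ae leb, forall x, forall n : nat, v x * ind (- n%:R) n%:R x = 0} by apply: ae_foralln.
apply: (ae_imp leb _ _ hall) => x hx.
have [N _ /(_ N (leqnn N)) e1] := ind_eventually x.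
by have := hx N; rewrite e1 mulr1.
Qed.

Local Notation mu2 := (@lebesgue_measure R \x @lebesgue_measure R)%E.

(** The Dynkin argument is run in the first coordinate, then in the second, and finally on the
    measurable rectangles, which generate the product sigma-algebra. *)
Lemma zero_of_boxes (w : R * R -> R) : mu2.-integrable setT (EFin \o w) ->
  (forall A B, (A = setT \/ RGenOpens.G A) -> (B = setT \/ RGenOpens.G B) ->
     (\int[mu2]_(z in A `*` B) (w z)%:E = 0)%E) ->
  {ae mu2, forall z, w z = 0}.
Proof.
move=> iw h.
have s1 B : (B = setT \/ RGenOpens.G B) -> forall A, measurable (A : set mR) ->
    (\int[mu2]_(z in A `*` B) (w z)%:E = 0)%E.
  move=> hB A mA.
  have mB : measurable (setT `*` B : set (mR * mR)).
    by apply: measurableX => //; case: hB => [->//|[a [b ->]]].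
  have e1 A' : A' `*` B = (setT `*` B) `&` (fst @^-1` A').
    by apply/seteqP; split => z /= [a b]; split => //; case: a.
  rewrite e1; apply: (dynkin_zero mu2 w _ fst (@RGenOpens.G R) iw mB measurable_fst
    (@RGenOpens.measurableE R) RGenOpensI) => //; first by apply: h => //; left.
  by move=> A' GA'; rewrite -e1; apply: h => //; right.
have s2 A B : measurable (A : set mR) -> measurable (B : set mR) ->
    (\int[mu2]_(z in A `*` B) (w z)%:E = 0)%E.
  move=> mA mB.
  have mA' : measurable (A `*` setT : set (mR * mR)) by exact: measurableX.
  have e1 B' : A `*` B' = (A `*` setT) `&` (snd @^-1` B').
    by apply/seteqP; split => z /= [a b]; split => //; case: a.
  rewrite e1; apply: (dynkin_zero mu2 w _ snd (@RGenOpens.G R) iw mA' measurable_snd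
    (@RGenOpens.measurableE R) RGenOpensI) => //; first by apply: s1 => //; left.
  by move=> B' GB'; rewrite -e1; apply: s1 => //; right.
have GI : setI_closed [set A `*` B | A in [set A : set mR | measurable A] & B in [set B : set mR | measurable B]].
  move=> _ _ [A mA [B mB <-]] [A' mA' [B' mB' <-]].
  exists (A `&` A'); first exact: measurableI.
  by exists (B `&` B'); [exact: measurableI|rewrite setXI].
have key := dynkin_zero mu2 w setT id _ iw measurableT (@measurable_id _ _ _)
  (measurable_prod_measurableType mR mR) GI.
have h0 : ae_eq mu2 setT (EFin \o w) (cst 0%E).
  apply: integral_ae_eq => // A _ mA; rewrite integral0.
  rewrite -[A in LHS]setTI; apply: (key _ _ A mA); first by rewrite -setXTT; exact: s2.
  by move=> _ [a ma [b mb <-]]; rewrite setTI; exact: s2.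
by apply: (ae_imp mu2 _ _ h0) => x /(_ I) [].
Qed.

Lemma zero_of_plateaus2 (v : R * R -> R) : measurable_fun setT (v : mR * mR -> R) ->
  (forall M, leb2.-integrable setT (EFin \o (fun z => v z * (ind (- M) M z.1 * ind (- M) M z.2)))) ->
  (forall k l r l' r', \int[leb2]_z (v z * (plateau k.+1%:R l r z.1 * plateau k.+1%:R l' r' z.2)) = 0) ->
  {ae leb2, forall z, v z = 0}.
Proof.
move=> mv iv h.
have mi l r l' r' : measurable_fun setT (fun z : mR * mR => ind l r z.1 * ind l' r' z.2).
  by apply: measurable_funM; [exact: measurableT_comp (measurable_ind l r) measurable_fst|
    exact: measurableT_comp (measurable_ind l' r') measurable_snd].
have mp k l r l' r' : measurable_fun setT (fun z : mR * mR => plateau k.+1%:R l r z.1 * plateau k.+1%:R l' r' z.2).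
  by apply: measurable_funM; [exact: measurableT_comp (measurable_plateau k l r) measurable_fst|
    exact: measurableT_comp (measurable_plateau k l' r') measurable_snd].
pose b M (z : R * R) : R := ind (- M) M z.1 * ind (- M) M z.2.
have lim l r l' r' M : \int[mu2]_z (v z * b M z * (ind l r z.1 * ind l' r' z.2)) = 0.
  have -> : (fun z => v z * b M z * (ind l r z.1 * ind l' r' z.2)) = fun z => v z *
      (ind (Num.max (- M) l) (Num.min M r) z.1 * ind (Num.max (- M) l') (Num.min M r') z.2).
    by apply/funext => x; rewrite !ind_max /b; ring.
  set a1 := Num.max _ _; set b1 := Num.min _ _; set a2 := Num.max _ _; set b2 := Num.min _ _.
  apply: (Rintegral_dominated0 mu2
    (fun k z => v z * (plateau k.+1%:R a1 b1 z.1 * plateau k.+1%:R a2 b2 z.2))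
    (fun z => v z * (ind a1 b1 z.1 * ind a2 b2 z.2)) (fun z => `|v z * b M z|) _ _ _ _ _ _) => //.
  - by move=> k; apply: measurable_funM => //; exact: mp.
  - by apply: measurable_funM => //; exact: mi.
  - by have := integrable_norm (iv M); congr (_.-integrable _ _).
  - move=> k z; have /andP[p0 p1] := plateau_ind k a1 b1 z.1; have /andP[q0 q1] := plateau_ind k a2 b2 z.2.
    rewrite !normrM ler_wpM2l// !ger0_norm ?ind_ge0// ler_pM//.
      by apply: (le_trans p1); rewrite ind_max ler_piMr ?ind_ge0 ?ind_le1.
    by apply: (le_trans q1); rewrite ind_max ler_piMr ?ind_ge0 ?ind_le1.
  - by move=> z; apply: cvgM; [exact: cvg_cst|apply: cvgM; exact: plateau_cvg].
have hn n : {ae mu2, forall z, v z * b n%:R z = 0}.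
  have iw : mu2.-integrable setT (EFin \o (fun z => v z * b n%:R z)) := iv n%:R.
  apply: zero_of_boxes => // A B hA hB.
  (* Inside the window, a whole line has the same indicator as the interval from [- n] to [n]. *)
  have sub A0 : (A0 = setT \/ RGenOpens.G A0) -> exists l r, forall x : R,
      ind (- n%:R) n%:R x * \1_A0 x = ind (- n%:R) n%:R x * ind l r x.
    case=> [->|[l [r ->]]]; last by exists l, r => x; rewrite (indE l r).
    exists (- n%:R), n%:R => x; rewrite indicE in_setT mulr1 /ind.
    by case: ifP; rewrite ?mulr1 ?mulr0.
  have [l [r hl]] := sub A hA; have [l' [r' hl']] := sub B hB.
  have mG A0 : (A0 = setT \/ RGenOpens.G A0) -> measurable (A0 : set mR) by case=> [->//|[? [? ->]]].
  have mAB : measurable (A `*` B : set (mR * mR)) by apply: measurableX; exact: mG.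
  rewrite -[LHS]fineK; last by apply: integrable_fin_num => //; exact: integrableS iw.
  congr EFin; rewrite -[RHS](lim l r l' r' n%:R) -[LHS]/(\int[mu2]_(z in A `*` B) (v z * b n%:R z)).
  rewrite Rintegral_mkcond; apply: eq_Rintegral => z _.
  transitivity (v z * ((ind (- n%:R) n%:R z.1 * \1_A z.1) * (ind (- n%:R) n%:R z.2 * \1_B z.2))); last first.
    by rewrite hl hl' /b; ring.
  rewrite patchE !indicE in_setX /b.
  by case: (z.1 \in A); case: (z.2 \in B); rewrite /= ?mulr1 ?mulr0 ?mul0r ?mulr0.
have hall : {ae mu2, forall z, forall n : nat, v z * b n%:R z = 0} by apply: ae_foralln.
apply: (ae_imp mu2 _ _ hall) => z hz.
have [N1 _ e1] := ind_eventually z.1; have [N2 _ e2] := ind_eventually z.2.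
have := hz (maxn N1 N2); rewrite /b e1 ?e2 ?mulr1//=; first exact: leq_maxr.
exact: leq_maxl.
Qed.

End ZeroFromBoxes.

(** * The interpolating kernel *)

Section Wigner.
Context {R : realType}.
Implicit Types (F H : R -> R[i]) (t x xi eta : R) (z : R * R).

Definition kern t F H xi eta : R[i] := F (t * eta + xi) * H ((1 - t) * eta + - xi).

(* For t = 0 and t = 1 these are the integrands of the two operators; differentiating in t amounts to
   differentiating once in each variable. *)
Definition wig t F H z : R[i] := ifourier (kern t F H z.2) z.1.

Definition mx F (x : R) : R[i] := x%:C * F x.

(** For [t = 0] or [t = 1] one of the factors is constant in [eta] and does not decay, but the other
    one does; otherwise both are affine substitutions. *)
Lemma schwartz_kern t F H xi : schwartz F -> schwartz H -> schwartz (kern t F H xi).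
Proof.
move=> sF sH; have [->|t0] := eqVneq t 0.
  have := schwartz_scale (F xi) _ (schwartz_affine 1 (- xi) H (oner_neq0 _) sH).
  by congr schwartz; apply/funext => s; rewrite /kern mul0r add0r subr0.
have [->|t1] := eqVneq t 1.
  have := schwartz_scale (H (- xi)) _ (schwartz_affine 1 xi F (oner_neq0 _) sF).
  by congr schwartz; apply/funext => s; rewrite /kern subrr mul0r add0r mulrC.
by apply: schwartz_mul; apply: schwartz_affine => //; rewrite subr_eq0 eq_sym.
Qed.

Lemma rapid_isq2 F : rapid F -> exists2 M : R, 0 <= M & forall x, normc (F x) <= M * isq x ^+ 2.
Proof.
move=> /(_ 4%N)[M hM]; exists M.
  by apply: le_trans (hM 0); rewrite mulr_ge0 ?normc_ge0// exprn_ge0// addr_ge0.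
move=> x; have p0 : 0 < 1 + x ^+ 2 by rewrite ltr_pwDl ?sqr_ge0.
have h2 : 1 + x ^+ 2 <= (1 + `|x|) ^+ 2.
  by rewrite sqrrD expr1n mul1r (real_normK (num_real x)) lerD2r lerDl mulrn_wge0.
rewrite /isq exprVn ler_pdivlMr ?exprn_gt0//; apply: le_trans (hM x).
rewrite mulrC ler_wpM2r ?normc_ge0// (_ : 4 = 2 * 2)%N// exprM lerXn2r ?nnegrE ?exprn_ge0 ?addr_ge0 ?sqr_ge0//.
Qed.

Lemma isq_mul_le a b u v (K : R) : 0 < K -> 1 + (a * u + b * v) ^+ 2 <= K * ((1 + u ^+ 2) * (1 + v ^+ 2)) ->
  isq u * isq v <= K * isq (a * u + b * v).
Proof.
move=> K0 h; rewrite /isq -invfM ler_pdivlMr ?ltr_pwDl ?sqr_ge0//.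
by rewrite mulrC ler_pdivrMr// mulr_gt0 ?ltr_pwDl ?sqr_ge0.
Qed.

(** Both [eta] and [xi] are combinations of the arguments [u], [v] of the two factors, with
    coefficients bounded for [|t| <= 2]. One copy of [isq u * isq v] is spent on the decay in [eta],
    at the cost of a factor 2, another on the decay in [xi], at the cost of 18. The range of [t]
    leaves room to differentiate at the ends of the unit interval. *)
Lemma kern_bound F H : schwartz F -> schwartz H -> exists2 M : R, 0 <= M &
  forall t xi eta, `|t| <= 2 -> normc (kern t F H xi eta) <= M * isq xi * isq eta.
Proof.
move=> sF sH; have [M M0 hM] := rapid_isq2 F (schwartz_rapid F sF).
have [N N0 hN] := rapid_isq2 H (schwartz_rapid H sH).
exists (M * N * 36); first by rewrite !mulr_ge0.
move=> t xi eta; rewrite ler_norml => /andP[t1 t2].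
rewrite /kern normc_mul; set u := t * eta + xi; set v := (1 - t) * eta + - xi.
have e1 : eta = 1 * u + 1 * v by rewrite /u /v; ring.
have e2 : xi = (1 - t) * u + (- t) * v by rewrite /u /v; ring.
have k1 : isq u * isq v <= 2 * isq eta.
  rewrite e1; apply: isq_mul_le => //.
  have := sqr_ge0 (u - v); have := sqr_ge0 (u * v); rewrite !expr2; nra.
have k2 : isq u * isq v <= 18 * isq xi.
  rewrite e2; apply: isq_mul_le => //.
  have a1 : (1 - t) ^+ 2 <= 9 by rewrite expr2; nra.
  have a2 : t ^+ 2 <= 9 by rewrite expr2; nra.
  have b1 := ler_wpM2r (sqr_ge0 u) a1; have b2 := ler_wpM2r (sqr_ge0 v) a2.
  have := sqr_ge0 ((1 - t) * u + t * v); have := sqr_ge0 (u * v); have := sqr_ge0 u; have := sqr_ge0 v.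
  move: b1 b2; rewrite !expr2; lra.
have p1 := isq_ge0 u; have p2 := isq_ge0 v; have p12 := mulr_ge0 p1 p2.
apply: (@le_trans _ _ (M * isq u ^+ 2 * (N * isq v ^+ 2))); first by rewrite ler_pM ?normc_ge0.
rewrite (_ : M * isq u ^+ 2 * (N * isq v ^+ 2) = M * N * ((isq u * isq v) * (isq u * isq v))); last by ring.
rewrite (_ : M * N * 36 * isq xi * isq eta = M * N * ((18 * isq xi) * (2 * isq eta))); last by ring.
by rewrite ler_wpM2l ?mulr_ge0// ler_pM.
Qed.

(** The arguments of the two factors add up to [eta]. *)
Lemma kern_mx t F H xi eta : eta%:C * kern t F H xi eta = kern t (mx F) H xi eta + kern t F (mx H) xi eta.
Proof.
rewrite /kern /mx -[X in X%:C * _](_ : (t * eta + xi) + ((1 - t) * eta - xi) = eta); last by ring.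
by apply: complex_ext; rewrite !cE /=; ring.
Qed.

Lemma cderiv_kern_eta t F H F' H' xi eta : (forall x, cderiv F x (F' x)) -> (forall x, cderiv H x (H' x)) ->
  cderiv (kern t F H xi) eta (t%:C * kern t F' H xi eta + (1 - t)%:C * kern t F H' xi eta).
Proof.
move=> dF dH; apply: cderiv_ext (cderiv_mul _ _ _ _ _ (cderiv_affine F t xi eta _ (dF _))
  (cderiv_affine H (1 - t) (- xi) eta _ (dH _))) _ _ => //.
by rewrite /kern; ring.
Qed.

Lemma cderiv_kern_xi t F H F' H' xi eta : (forall x, cderiv F x (F' x)) -> (forall x, cderiv H x (H' x)) ->
  cderiv (fun xi => kern t F H xi eta) xi (kern t F' H xi eta - kern t F H' xi eta).
Proof.
move=> dF dH; have h1 := cderiv_affine F 1 (t * eta) xi _ (dF _).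
have h2 := cderiv_affine H (-1) ((1 - t) * eta) xi _ (dH _).
apply: cderiv_ext (cderiv_mul _ _ _ _ _ h1 h2) _ _.
  by move=> s; rewrite /kern; congr (F _ * H _); ring.
rewrite /kern (_ : 1 * xi + t * eta = t * eta + xi); last by ring.
rewrite (_ : -1 * xi + (1 - t) * eta = (1 - t) * eta + - xi); last by ring.
by apply: complex_ext; rewrite !cE /=; ring.
Qed.

Lemma cderiv_kern_t t F H F' H' xi eta : (forall x, cderiv F x (F' x)) -> (forall x, cderiv H x (H' x)) ->
  cderiv (fun t => kern t F H xi eta) t (eta%:C * (kern t F' H xi eta - kern t F H' xi eta)).
Proof.
move=> dF dH; have h1 := cderiv_affine F eta xi t _ (dF _).
have h2 := cderiv_affine H (- eta) (eta - xi) t _ (dH _).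
apply: cderiv_ext (cderiv_mul _ _ _ _ _ h1 h2) _ _.
  by move=> s; rewrite /kern; congr (F _ * H _); ring.
rewrite /kern (_ : eta * t + xi = t * eta + xi); last by ring.
rewrite (_ : - eta * t + (eta - xi) = (1 - t) * eta + - xi); last by ring.
by apply: complex_ext; rewrite !cE /=; ring.
Qed.

Lemma ifourier_fourier (f : R -> R[i]) x : ifourier f x = fourier f (- x).
Proof. by apply: eq_cint => s; congr (expi _ * _); ring. Qed.

Lemma cintegrable_wig t F H z : schwartz F -> schwartz H ->
  cintegrable leb (fun eta => expi (2 * pi * z.1 * eta) * kern t F H z.2 eta).
Proof.
by move=> sF sH; apply: cintegrable_expi; apply: schwartz_cintegrable; exact: schwartz_kern.
Qed.

(** In a Fourier integral over [eta], a factor [x] outside is a derivative in [eta] of the kernel,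
    which the chain rule distributes with coefficients [t] and [1 - t]. *)
Lemma wig_x t F H F' H' z : schwartz F -> schwartz H -> schwartz F' -> schwartz H' ->
  (forall x, cderiv F x (F' x)) -> (forall x, cderiv H x (H' x)) ->
  (0 +i* (- (2 * pi * z.1))) * wig t F H z = t%:C * wig t F' H z + (1 - t)%:C * wig t F H' z.
Proof.
move=> sF sH sF' sH' dF dH; rewrite /wig !ifourier_fourier -[X in _ +i* X]mulrN.
rewrite -(fourier_deriv _ (fun s => t%:C * kern t F' H z.2 s + (1 - t)%:C * kern t F H' z.2 s)).
- rewrite fourier_add ?fourier_scale//; try (exact: schwartz_kern);
  by apply: schwartz_scale; exact: schwartz_kern.
- exact: schwartz_kern.
- by apply: schwartz_add; apply: schwartz_scale; exact: schwartz_kern.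
- by move=> s; exact: cderiv_kern_eta.
Qed.

Lemma wig_bound_xi F H : schwartz F -> schwartz H -> exists2 M : R, 0 <= M &
  forall t z, `|t| <= 2 -> normc (wig t F H z) <= M * isq z.2.
Proof.
move=> sF sH; have [M M0 hM] := kern_bound F H sF sH.
have I0 : 0 <= \int[leb]_x (isq x : R) by apply: Rintegral_ge0 => x _; exact: isq_ge0.
exists (M * \int[leb]_x (isq x : R)); first by rewrite mulr_ge0.
move=> t z t2; rewrite mulrAC -RintegralZl//; last exact: integrable_isq.
apply: (normc_cint_le_dom leb _ (fun s : R => (M * isq z.2) * isq s)).
- exact: cintegrable_cmeasurable (cintegrable_wig t F H z sF sH).
- by apply: integrable_scaler; exact: integrable_isq.
- by move=> s; rewrite normc_mul normc_expi mul1r; exact: hM.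
Qed.

(** The coefficients are those of a square [(2 X + 3 Y) ^ 2], where 2 and 3 bound [|t|] and
    [|1 - t|]. *)
Lemma wig_bound_arith (B C E X Y a b e k : R) : X <= 2 * a + 3 * b -> Y <= 2 * b + 3 * e ->
  a <= C * k -> b <= B * k -> e <= E * k -> 2 * X + 3 * Y <= (4 * C + 12 * B + 9 * E) * k.
Proof. lra. Qed.

(** Decay in [x] comes from two applications of [wig_x], which bound [|x| ^ 2] times the kernel by
    the kernels formed with derivatives of total order two. *)
Lemma wig_bound F H : schwartz F -> schwartz H -> exists2 M : R, 0 <= M &
  forall t z, `|t| <= 2 -> normc (wig t F H z) <= M * (isq z.1 * isq z.2).
Proof.
move=> sF sH; have [F1 sF1 dF] := schwartz_deriv F sF; have [F2 sF2 dF1] := schwartz_deriv F1 sF1.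
have [H1 sH1 dH] := schwartz_deriv H sH; have [H2 sH2 dH1] := schwartz_deriv H1 sH1.
have [A A0 hA] := wig_bound_xi F H sF sH; have [B B0 hB] := wig_bound_xi F1 H1 sF1 sH1.
have [C C0 hC] := wig_bound_xi F2 H sF2 sH; have [E E0 hE] := wig_bound_xi F H2 sF sH2.
exists (A + (4 * C + 12 * B + 9 * E)); first by rewrite !addr_ge0 ?mulr_ge0.
move=> t z t2; have := t2; rewrite ler_norml => /andP[t3 t4].
have nt : normc (t%:C : R[i]) <= 2 by rewrite normc_real.
have n1t : normc ((1 - t)%:C : R[i]) <= 3 by rewrite normc_real ler_norml; apply/andP; split; lra.
have p2 : (1 : R) <= 2 * pi by have := @pi_ge2 R; lra.
have step (F0 F0' H0 H0' : R -> R[i]) : schwartz F0 -> schwartz H0 -> schwartz F0' -> schwartz H0' ->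
    (forall x, cderiv F0 x (F0' x)) -> (forall x, cderiv H0 x (H0' x)) ->
    `|z.1| * normc (wig t F0 H0 z) <= 2 * normc (wig t F0' H0 z) + 3 * normc (wig t F0 H0' z).
  move=> a1 a2 a3 a4 a5 a6; have e := wig_x t F0 H0 F0' H0' z a1 a2 a3 a4 a5 a6.
  have n0 := normc_ge0 (wig t F0 H0 z).
  apply: (@le_trans _ _ (normc ((0 +i* (- (2 * pi * z.1))) * wig t F0 H0 z))).
    rewrite normc_mul ler_wpM2r// normc_imc normrN normrM ler_peMl// ger0_norm//.
    by apply: le_trans p2.
  rewrite e; apply: (le_trans (normc_add _ _)); rewrite !normc_mul.
  by apply: lerD; rewrite ler_wpM2r ?normc_ge0.
have q0 := step F F1 H H1 sF sH sF1 sH1 dF dH.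
have q1 := step F1 F2 H H1 sF1 sH sF2 sH1 dF1 dH.
have q2 := step F F1 H1 H2 sF sH1 sF1 sH2 dF dH1.
have r0 := hA t z t2; have r1 := hB t z t2; have r2 := hC t z t2; have r3 := hE t z t2.
have n0 : 0 <= `|z.1| by [].
have z2 : `|z.1| ^+ 2 * normc (wig t F H z) <= (4 * C + 12 * B + 9 * E) * isq z.2.
  rewrite expr2 -mulrA; apply: (le_trans (ler_wpM2l n0 q0)).
  by rewrite mulrDr (mulrCA _ 2) (mulrCA _ 3); exact: wig_bound_arith q1 q2 r2 r1 r3.
have i1 : 0 < 1 + z.1 ^+ 2 by rewrite ltr_pwDl ?sqr_ge0.
rewrite mulrCA /isq mulrC ler_pdivlMr// -/(isq z.2).
rewrite mulrDr mulr1 [_ * z.1 ^+ 2]mulrC -(real_normK (num_real z.1)) [X in _ <= X]mulrDl.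
exact: lerD.
Qed.

Lemma cmeasurable_wig t F H : schwartz F -> schwartz H ->
  cmeasurable (wig t F H : measurableTypeR R * measurableTypeR R -> R[i]).
Proof.
move=> sF sH; pose f (w : (measurableTypeR R * measurableTypeR R) * measurableTypeR R) : R[i] :=
  expi (2 * pi * w.1.1 * w.2) * (F (t * w.2 + w.1.2) * H ((1 - t) * w.2 + - w.1.2)).
have m2 : measurable_fun setT (fun w : (measurableTypeR R * measurableTypeR R) * measurableTypeR R => w.2 : R).
  exact: measurable_snd.
have m11 : measurable_fun setT (fun w : (measurableTypeR R * measurableTypeR R) * measurableTypeR R => w.1.1 : R).
  exact: measurableT_comp measurable_fst measurable_fst.
have m12 : measurable_fun setT (fun w : (measurableTypeR R * measurableTypeR R) * measurableTypeR R => w.1.2 : R).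
  exact: measurableT_comp measurable_snd measurable_fst.
have mf : cmeasurable f.
  apply: cmeasurable_mul.
    by apply: cmeasurable_expiT; apply: measurable_funM => //; exact: measurable_funM.
  apply: cmeasurable_mul; apply: cmeasurable_comp; try exact: schwartz_cmeasurable.
    by apply: measurable_funD => //; exact: measurable_funM.
  by apply: measurable_funD; [exact: measurable_funM|exact: measurableT_comp m12].
exact: (cmeasurable_cint_param (@lebesgue_measure R) f mf).
Qed.

Lemma cderiv_wig_x t F H z : `|t| <= 2 -> schwartz F -> schwartz H ->
  cderiv (fun x => wig t F H (x, z.2)) z.1
    ((0 +i* (2 * pi)) * wig t (mx F) H z + (0 +i* (2 * pi)) * wig t F (mx H) z).
Proof.
move=> t2 sF sH; have sxF := schwartz_mulx F sF; have sxH := schwartz_mulx H sH.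
have [M M0 hM] := kern_bound (mx F) H sxF sH; have [N N0 hN] := kern_bound F (mx H) sF sxH.
pose F0 (x eta : R) : R[i] := expi (2 * pi * x * eta) * kern t F H z.2 eta.
pose F0' (x eta : R) : R[i] := (0 +i* (2 * pi * eta)) * expi (2 * pi * x * eta) * kern t F H z.2 eta.
have ex eta : kern t F H z.2 eta * eta%:C = kern t (mx F) H z.2 eta + kern t F (mx H) z.2 eta.
  by rewrite mulrC kern_mx.
apply: cderiv_ext (cderiv_cintT leb F0 F0' (fun eta : R => (2 * pi * (M + N) * isq z.2) * isq eta) z.1 _ _ _ _) _ _ => //.
- by move=> x; exact: (cintegrable_wig t F H (x, z.2) sF sH).
- move=> x eta; rewrite /F0 /F0'.
  have h := cderiv_mul _ _ _ _ _ (cderiv_expi (2 * pi * eta) x) (cderiv_cst (kern t F H z.2 eta) x).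
  apply: cderiv_ext h _ _; first by move=> s; congr (expi _ * _); ring.
  by rewrite mulr0 addr0; congr (_ * expi _ * _); ring.
- by apply: integrable_scaler; exact: integrable_isq.
- move=> x eta; rewrite /F0'.
  rewrite (_ : _ * _ * _ = (0 +i* (2 * pi)) * expi (2 * pi * x * eta) * (kern t F H z.2 eta * eta%:C)); last first.
    by apply: complex_ext; rewrite !cE /=; ring.
  rewrite ex !normc_mul normc_expi normc_imc mulr1 ger0_norm; last by rewrite mulr_ge0// pi_ge0.
  rewrite -!mulrA ler_wpM2l// ler_wpM2l ?pi_ge0// mulrA; apply: (le_trans (normc_add _ _)).
  by rewrite !mulrDl; apply: lerD; [exact: hM|exact: hN].
- rewrite -mulrDr /wig /ifourier -cint_add; try exact: cintegrable_wig.
  rewrite -cint_scale; last by apply: cintegrable_add; exact: cintegrable_wig.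
  apply: eq_cint => eta; rewrite -mulrDr -ex /F0'.
  by apply: complex_ext; rewrite !cE /=; ring.
Qed.

Lemma cderiv_wig_xi t F H F' H' z : `|t| <= 2 -> schwartz F -> schwartz H -> schwartz F' -> schwartz H' ->
  (forall x, cderiv F x (F' x)) -> (forall x, cderiv H x (H' x)) ->
  cderiv (fun xi => wig t F H (z.1, xi)) z.2 (wig t F' H z - wig t F H' z).
Proof.
move=> t2 sF sH sF' sH' dF dH.
have [M M0 hM] := kern_bound F' H sF' sH; have [N N0 hN] := kern_bound F H' sF sH'.
pose F0 (xi eta : R) : R[i] := expi (2 * pi * z.1 * eta) * kern t F H xi eta.
pose F0' (xi eta : R) : R[i] := expi (2 * pi * z.1 * eta) * (kern t F' H xi eta - kern t F H' xi eta).
apply: cderiv_ext (cderiv_cintT leb F0 F0' (fun eta : R => (M + N) * isq eta) z.2 _ _ _ _) _ _ => //.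
- by move=> xi; exact: (cintegrable_wig t F H (z.1, xi) sF sH).
- by move=> xi eta; apply: cderiv_scale; exact: cderiv_kern_xi.
- by apply: integrable_scaler; exact: integrable_isq.
- move=> xi eta; rewrite /F0' normc_mul normc_expi mul1r.
  apply: (le_trans (normc_add _ _)); rewrite normc_opp mulrDl.
  have i1 : isq xi <= 1 by rewrite /isq invf_le1 ?ltr_pwDl ?sqr_ge0// lerDl sqr_ge0.
  have i0 := isq_ge0 eta; have i2 := isq_ge0 xi.
  apply: lerD; [apply: (le_trans (hM t xi eta t2))|apply: (le_trans (hN t xi eta t2))].
    by rewrite ler_wpM2r// ler_piMr.
  by rewrite ler_wpM2r// ler_piMr.
- rewrite /wig /ifourier -cint_sub; try exact: cintegrable_wig.
  by apply: eq_cint => eta; rewrite /F0' mulrBr.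
Qed.

(** The derivative in [t] brings out a factor [eta]; distributed by [kern_mx], it yields the four
    terms that also make up the mixed derivative in [x] and [xi], up to [2 pi i]. *)
Lemma cderiv_wig_t t F H F' H' z : `|t| < 2 -> schwartz F -> schwartz H -> schwartz F' -> schwartz H' ->
  (forall x, cderiv F x (F' x)) -> (forall x, cderiv H x (H' x)) ->
  cderiv (fun t => wig t F H z) t
    (wig t (mx F') H z + wig t F' (mx H) z - (wig t (mx F) H' z + wig t F (mx H') z)).
Proof.
move=> t2 sF sH sF' sH' dF dH.
have sxF := schwartz_mulx F sF; have sxH := schwartz_mulx H sH.
have sxF' := schwartz_mulx F' sF'; have sxH' := schwartz_mulx H' sH'.
have [M1 M10 hM1] := kern_bound _ _ sxF' sH; have [M2 M20 hM2] := kern_bound _ _ sF' sxH.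
have [M3 M30 hM3] := kern_bound _ _ sxF sH'; have [M4 M40 hM4] := kern_bound _ _ sF sxH'.
pose F0 (t eta : R) : R[i] := expi (2 * pi * z.1 * eta) * kern t F H z.2 eta.
pose F0' (t eta : R) : R[i] := expi (2 * pi * z.1 * eta) *
  (kern t (mx F') H z.2 eta + kern t F' (mx H) z.2 eta - (kern t (mx F) H' z.2 eta + kern t F (mx H') z.2 eta)).
have tI (s : R) : s \in `]-2, 2[ -> `|s| <= 2 by rewrite in_itv/= => /andP[s1 s2]; rewrite ler_norml !ltW.
apply: cderiv_ext (cderiv_cint leb F0 F0' (fun eta : R => (M1 + M2 + (M3 + M4)) * isq z.2 * isq eta) t (-2) 2 _ _ _ _ _) _ _ => //.
- by rewrite in_itv/= -ltr_norml.
- by move=> s _; exact: cintegrable_wig.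
- move=> s eta _; apply: cderiv_scale; apply: cderiv_ext (cderiv_kern_t _ _ _ _ _ _ _ dF dH) _ _ => //.
  by rewrite mulrBr !kern_mx.
- by apply: integrable_scaler; exact: integrable_isq.
- move=> s eta /tI s2; rewrite /F0' normc_mul normc_expi mul1r !mulrDl.
  apply: (le_trans (normc_add _ _)); rewrite normc_opp.
  by apply: lerD; apply: (le_trans (normc_add _ _)); apply: lerD;
    [exact: hM1|exact: hM2|exact: hM3|exact: hM4].
- rewrite /wig /ifourier -!cint_add; try exact: cintegrable_wig.
  rewrite -cint_sub; try by apply: cintegrable_add; exact: cintegrable_wig.
  by apply: eq_cint => eta; rewrite /F0'; ring.
Qed.

End Wigner.

(** * Weak derivatives against smooth integrable functions *)

Section SmoothClass.
Context {R : realType}.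
Implicit Types (phi psi : R * R -> R) (z : R * R).

(** The counterpart in the plane of [schwartz_class]: derivatives of all orders are reached by
    induction without being computed. *)
Definition closed_under_partials (P : (R * R -> R) -> Prop) := forall psi, P psi ->
  (exists2 psi1, P psi1 & forall z, is_derive z.1 (1 : R) (fun x => psi (x, z.2)) (psi1 z)) /\
  (exists2 psi2, P psi2 & forall z, is_derive z.2 (1 : R) (fun x => psi (z.1, x)) (psi2 z)).

Lemma partial1E phi phi1 : (forall z, is_derive z.1 (1 : R) (fun x => phi (x, z.2)) (phi1 z)) ->
  partial1 phi = phi1.
Proof. by move=> h; apply/funext => z; exact: isd_derive1. Qed.

Lemma partial2E phi phi2 : (forall z, is_derive z.2 (1 : R) (fun x => phi (z.1, x)) (phi2 z)) ->
  partial2 phi = phi2.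
Proof. by move=> h; apply/funext => z; exact: isd_derive1. Qed.

Lemma lipschitz2_continuous phi (K1 K2 : R) :
  (forall z w, `|phi w - phi z| <= K1 * `|w.1 - z.1| + K2 * `|w.2 - z.2|) -> continuous phi.
Proof.
move=> h z; apply/subr_cvg0; apply: norm_cvg0.
apply: (@squeeze_cvgr _ _ _ _ (fun=> 0) (fun w : R * R => K1 * `|w.1 - z.1| + K2 * `|w.2 - z.2|)).
- by apply: nearW => w; rewrite normr_ge0 /=; exact: h.
- exact: cvg_cst.
rewrite -[0](_ : K1 * `|z.1 - z.1| + K2 * `|z.2 - z.2| = 0); last by rewrite !subrr normr0 !mulr0 addr0.
apply: cvgD; apply: cvgM; try exact: cvg_cst; apply: cvg_norm; apply: cvgB; try exact: cvg_cst.
  exact: cvg_fst.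
exact: cvg_snd.
Qed.

(** Bounded partial derivatives make a member Lipschitz, hence jointly continuous; stability of the
    class drives the induction on the order. *)
Lemma Ck_of_class (P : (R * R -> R) -> Prop) : closed_under_partials P ->
  (forall psi, P psi -> exists K : R, forall z, `|psi z| <= K) ->
  forall n psi, P psi -> Ck n psi.
Proof.
move=> Pd Pb n; elim: n => [|n IH] psi hpsi.
(* The base case and the induction step share the proof of continuity. *)
all: have [[psi1 P1 d1] [psi2 P2 d2]] := Pd psi hpsi.
all: have cpsi : continuous psi.
1,3: have [K1 hK1] := Pb _ P1; have [K2 hK2] := Pb _ P2.
1,2: apply: (lipschitz2_continuous psi K1 K2) => z w.
1,2: rewrite -(subrKA (psi (w.1, z.2))); apply: (le_trans (ler_normD _ _)).
1,2: have := isd_lipschitz (fun t => psi (w.1, t)) (fun t => psi2 (w.1, t)) K2 (fun t => d2 (w.1, t)) (fun t => hK2 (w.1, t)) z.2 w.2.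
1,2: have := isd_lipschitz (fun t => psi (t, z.2)) (fun t => psi1 (t, z.2)) K1 (fun t => d1 (t, z.2)) (fun t => hK1 (t, z.2)) z.1 w.1.
1,2: by rewrite -!surjective_pairing; lra.
- by split.
split=> //; rewrite (partial1E _ _ d1) (partial2E _ _ d2); split; try exact: IH.
- by move=> z; case: (d1 z).
- by move=> z; case: (d2 z).
Qed.
End SmoothClass.

(** * Extension of weak derivatives beyond compact supports *)

Section WeakPairing.
Context {R : realType}.
Local Notation mR := (measurableTypeR R).
Implicit Types (psi phi : R * R -> R) (z : R * R) (p q : R * R -> R[i]) (u v : R -> R).

(** The functions to which the weak identities are extended from test functions; the decay is what
    allows cutoffs to be removed by dominated convergence. *)
Definition integrable_smooth (P : (R * R -> R) -> Prop) := [/\ closed_under_partials P,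
  forall psi, P psi -> exists2 M : R, 0 <= M & forall z, `|psi z| <= M * (isq z.1 * isq z.2) &
  forall psi, P psi -> measurable_fun setT (psi : mR * mR -> R)].

Definition bounded_symbol p := cmeasurable (p : mR * mR -> R[i]) /\
  exists2 K : R, 0 <= K & forall z, normc (p z) <= K.

(* Measurability of the test functions is only asked for to avoid proving it from continuity. *)
Definition weak_partial2 p r := forall phi, test_function phi -> measurable_fun setT (phi : mR * mR -> R) ->
  measurable_fun setT (partial2 phi : mR * mR -> R) ->
  cint leb2 (fun z => (partial2 phi z)%:C * p z) = - cint leb2 (fun z => (phi z)%:C * r z).

Definition weak_partial12 p q := forall phi, test_function phi -> measurable_fun setT (phi : mR * mR -> R) ->
  measurable_fun setT (partial1 (partial2 phi) : mR * mR -> R) ->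
  cint leb2 (fun z => (partial1 (partial2 phi) z)%:C * p z) = cint leb2 (fun z => (phi z)%:C * q z).

(** Members of [P] cut off at scale [1 / r]; sums are included so that Leibniz's rule stays inside
    the class. *)
Inductive cutoff_class (P : (R * R -> R) -> Prop) (r : R) : (R * R -> R) -> Prop :=
| cutoff_prod u v psi : bump_class 1 (-1) 1 u -> bump_class 1 (-1) 1 v -> P psi ->
    cutoff_class P r (fun z => u (r * z.1) * v (r * z.2) * psi z)
| cutoff_add phi psi : cutoff_class P r phi -> cutoff_class P r psi ->
    cutoff_class P r (fun z => phi z + psi z).

Lemma isd_dilate u (a r x : R) : is_derive (r * x) 1 u a -> is_derive x 1 (fun t => u (r * t)) (r * a).
Proof.
move=> h; apply: isd_ext (isd_comp u (fun t => r * t) x a r h _) _ _ => //.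
by apply: isd_ext (isd_affine r 0 x) _ _ => // t; rewrite addr0.
Qed.

Lemma cutoff_partials P r : closed_under_partials P -> closed_under_partials (cutoff_class P r).
Proof.
move=> Pd psi; elim=> {psi} [u v psi hu hv hpsi|phi psi _ [[p1 P1 d1] [p2 P2 d2]] _ [[q1 Q1 e1] [q2 Q2 e2]]].
  have [u' hu' du] := bump_class_deriv _ _ _ _ hu; have [v' hv' dv] := bump_class_deriv _ _ _ _ hv.
  have [[psi1 P1 d1] [psi2 P2 d2]] := Pd psi hpsi; split.
    exists (fun z => (r * u' (r * z.1)) * v (r * z.2) * psi z + u (r * z.1) * v (r * z.2) * psi1 z).
      apply: cutoff_add; last exact: cutoff_prod.
      by apply: (cutoff_prod P r (fun x => r * u' x) v psi) => //; exact: bump_scale.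
    move=> z; have h := isdM _ _ _ _ _ (isdM _ _ _ _ _ (isd_dilate u _ r z.1 (du _)) (isd_cst (v (r * z.2)) z.1)) (d1 z).
    by apply: isd_ext h _ _ => //=; rewrite -surjective_pairing; ring.
  exists (fun z => u (r * z.1) * (r * v' (r * z.2)) * psi z + u (r * z.1) * v (r * z.2) * psi2 z).
    apply: cutoff_add; last exact: cutoff_prod.
    by apply: (cutoff_prod P r u (fun x => r * v' x) psi) => //; exact: bump_scale.
  move=> z; have h := isdM _ _ _ _ _ (isdM _ _ _ _ _ (isd_cst (u (r * z.1)) z.2) (isd_dilate v _ r z.2 (dv _))) (d2 z).
  by apply: isd_ext h _ _ => //=; rewrite -surjective_pairing; ring.
split.
  by exists (fun z => p1 z + q1 z); [exact: cutoff_add|move=> z; exact: isdD].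
by exists (fun z => p2 z + q2 z); [exact: cutoff_add|move=> z; exact: isdD].
Qed.

Lemma isq_le1 (x : R) : isq x <= 1.
Proof. by rewrite /isq invf_le1 ?ltr_pwDl ?sqr_ge0// lerDl sqr_ge0. Qed.

Lemma cutoff_bounded P r phi : integrable_smooth P -> cutoff_class P r phi ->
  exists K : R, forall z, `|phi z| <= K.
Proof.
move=> [_ Pb _]; elim=> {phi} [u v psi hu hv /Pb[M M0 hM]|phi psi _ [K hK] _ [L hL]]; last first.
  by exists (K + L) => z; apply: (le_trans (ler_normD _ _)); exact: lerD.
have [K K0 hK] := bump_class_bounded _ _ _ _ hu; have [L L0 hL] := bump_class_bounded _ _ _ _ hv.
exists (K * L * M) => z; rewrite !normrM !ler_pM ?mulr_ge0//.
apply: (le_trans (hM z)); rewrite ler_piMr//.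
by rewrite mulr_ile1 ?isq_ge0 ?isq_le1.
Qed.

Lemma cutoff_supp P r phi z : 0 < r -> cutoff_class P r phi ->
  r^-1 < `|z.1| \/ r^-1 < `|z.2| -> phi z = 0.
Proof.
move=> r0 hphi h; elim: hphi => {phi} [u v psi hu hv _|phi psi _ -> _ ->]; last by rewrite addr0.
have key w (x : R) : bump_class 1 (-1) 1 w -> r^-1 < `|x| -> w (r * x) = 0.
  move=> hw; rewrite -div1r ltr_pdivrMr// => hx; apply: (bump_class_supp 1 (-1) 1 w) => //.
  move: hx; have [x0|x0] := leP 0 x; first by rewrite ger0_norm// => /ltW; rewrite mulrC; right.
  by rewrite ltr0_norm// => /ltW; rewrite mulNr lerNr mulrC; left.
by case: h => h; [rewrite (key u)// !mul0r|rewrite (key v)// mulr0 mul0r].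
Qed.

Lemma cutoff_test P r phi : 0 < r -> integrable_smooth P -> cutoff_class P r phi -> test_function phi.
Proof.
move=> r0 hP hphi; split.
  move=> n; apply: (@Ck_of_class _ (cutoff_class P r)) => //.
    by apply: cutoff_partials; case: hP.
  by move=> psi; exact: cutoff_bounded.
by exists r^-1 => z; exact: cutoff_supp hphi.
Qed.

Definition cutoff (x : R) : R := (plateau 1 (-1) 1 0)^-1 * plateau 1 (-1) 1 x.

Lemma cutoff_bump : bump_class 1 (-1) 1 cutoff.
Proof. by apply: bump_scale; exact: plateau_bump. Qed.

Lemma cutoff0 : cutoff 0 = 1.
Proof.
rewrite /cutoff mulVf// /plateau.
by rewrite (_ : -1 < 0 < 1) ?mulr1 ?mulf_neq0 ?gt_eqF ?expR_gt0// ltrN10 ltr01.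
Qed.

Definition rate (n : nat) : R := n.+1%:R^-1.

Lemma rate_gt0 n : 0 < rate n. Proof. by rewrite invr_gt0 ltr0n. Qed.

Lemma rate_le1 n : rate n <= 1.
Proof. by rewrite invf_le1 ?ltr0n// ler1n. Qed.

Lemma rate_cvg : rate n @[n --> \oo] --> 0.
Proof.
by have := @cvg_harmonic R; apply: cvg_trans.
Qed.

Lemma bump_continuous u : bump_class 1 (-1) 1 u -> continuous u.
Proof. by move=> /bump_class_deriv[u' _ du]; apply: isd_continuous => x; case: (du x). Qed.

Lemma bump_rate_cvg u (x : R) : bump_class 1 (-1) 1 u -> u (rate n * x) @[n --> \oo] --> u 0.
Proof.
move=> /bump_continuous cu.
have h : rate n * x @[n --> \oo] --> 0 * x by apply: cvgM; [exact: rate_cvg|exact: cvg_cst].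
by rewrite mul0r in h; apply: (cvg_comp _ _ h); exact: cu.
Qed.

Lemma measurable_bump_rate u (r : R) : bump_class 1 (-1) 1 u -> measurable_fun setT (fun x : mR => u (r * x)).
Proof.
move=> /bump_continuous cu; apply: continuous_measurable_fun => x.
apply: continuous_comp; last exact: cu.
by apply: cvgM; [exact: cvg_cst|exact: cvg_id].
Qed.

Lemma pairing_cvg p (g : nat -> R * R -> R) psi (M : R) : bounded_symbol p ->
  (forall n, measurable_fun setT (g n : mR * mR -> R)) -> measurable_fun setT (psi : mR * mR -> R) ->
  (forall n z, `|g n z| <= M * (isq z.1 * isq z.2)) ->
  (forall z, g n z @[n --> \oo] --> psi z) ->
  ccvg (fun n => cint leb2 (fun z => (g n z)%:C * p z)) (cint leb2 (fun z => (psi z)%:C * p z)).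
Proof.
move=> [mp [K K0 hK]] mg mpsi gM gpsi.
apply: (cint_dominated_cvg leb2 (fun n z => (g n z)%:C * p z) _ (fun z : R * R => (K * M) * (isq z.1 * isq z.2))).
- by move=> n; apply: cmeasurable_mul => //; exact: cmeasurable_real.
- by apply: cmeasurable_mul => //; exact: cmeasurable_real.
- apply: integrable_scaler.
  by apply: (integrable_tensor (@lebesgue_measure R) (@lebesgue_measure R) isq isq); exact: integrable_isq.
- move=> n z; rewrite normc_mul normc_real -mulrA [K * _]mulrC.
  by apply: ler_pM => //; exact: normc_ge0.
- by apply/aeW => z; apply: ccvg_mul; [exact: ccvg_real|exact: ccvg_cst].
Qed.

Section Cutoffs.
Variables (P : (R * R -> R) -> Prop) (hP : integrable_smooth P).

Let term u v psi (n : nat) z := u (rate n * z.1) * v (rate n * z.2) * psi z.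

Lemma measurable_term u v psi n : bump_class 1 (-1) 1 u -> bump_class 1 (-1) 1 v -> P psi ->
  measurable_fun setT (term u v psi n : mR * mR -> R).
Proof.
move=> hu hv hpsi; have [_ _ Pm] := hP; apply: measurable_funM; last exact: Pm.
apply: measurable_funM.
  exact: (measurableT_comp (measurable_bump_rate u (rate n) hu) measurable_fst).
exact: (measurableT_comp (measurable_bump_rate v (rate n) hv) measurable_snd).
Qed.

Lemma term_bound u v psi : bump_class 1 (-1) 1 u -> bump_class 1 (-1) 1 v -> P psi ->
  exists2 M : R, 0 <= M & forall n z, `|term u v psi n z| <= M * (isq z.1 * isq z.2).
Proof.
move=> hu hv hpsi; have [_ Pb _] := hP; have [M M0 hM] := Pb psi hpsi.
have [K K0 hK] := bump_class_bounded _ _ _ _ hu; have [L L0 hL] := bump_class_bounded _ _ _ _ hv.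
exists (K * L * M) => [|n z]; first by rewrite !mulr_ge0.
by rewrite /term !normrM -(mulrA (K * L)); apply: ler_pM => //; rewrite ?mulr_ge0//; exact: ler_pM.
Qed.

Lemma term_cvg u v psi z : bump_class 1 (-1) 1 u -> bump_class 1 (-1) 1 v ->
  term u v psi n z @[n --> \oo] --> u 0 * v 0 * psi z.
Proof.
move=> hu hv; apply: cvgM; last exact: cvg_cst.
by apply: cvgM; exact: bump_rate_cvg.
Qed.

Lemma rate_bound (M x b : R) n : 0 <= M -> 0 <= b -> `|x| <= M * b -> `|rate n * x| <= M * b.
Proof.
move=> M0 b0 h; rewrite normrM ger0_norm ?(ltW (rate_gt0 n))//; apply: le_trans h.
by rewrite ler_piMl// rate_le1.
Qed.

Lemma isqq_ge0 z : 0 <= isq z.1 * isq z.2. Proof. by rewrite mulr_ge0 ?isq_ge0. Qed.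

(** The weak identity is applied to [psi] times two cutoffs dilated by [rate n]. A derivative
    falling on a cutoff brings a factor [rate n], which tends to 0, and dominated convergence
    removes the cutoffs elsewhere. *)
Lemma weak_pairing01 p q psi psi2 : bounded_symbol p -> bounded_symbol q ->
  weak_partial2 p q ->
  P psi -> P psi2 -> (forall z, is_derive z.2 (1 : R) (fun x => psi (z.1, x)) (psi2 z)) ->
  cint leb2 (fun z => (psi2 z)%:C * p z) = - cint leb2 (fun z => (psi z)%:C * q z).
Proof.
move=> bp bq pq Ppsi Ppsi2 d2; have hk := cutoff_bump; have [_ _ Pm] := hP.
have [k' hk' dk] := bump_class_deriv _ _ _ _ hk.
pose phi n : R * R -> R := term cutoff cutoff psi n.
have tphi n : test_function (phi n).
  by apply: (cutoff_test P (rate n)) => //; [exact: rate_gt0|exact: cutoff_prod].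
pose g n z : R := rate n * term cutoff k' psi n z + term cutoff cutoff psi2 n z.
have pg n : partial2 (phi n) = g n.
  apply: partial2E => z.
  have h := isdM _ _ _ _ _ (isdM _ _ _ _ _ (isd_cst (cutoff (rate n * z.1)) z.2) (isd_dilate cutoff _ (rate n) z.2 (dk _))) (d2 z).
  by apply: isd_ext h _ _ => //=; rewrite -surjective_pairing /g /term; ring.
have mg n : measurable_fun setT (g n : mR * mR -> R).
  by apply: measurable_funD; [apply: measurable_funM => //; exact: measurable_term|exact: measurable_term].
have mphi n : measurable_fun setT (phi n : mR * mR -> R) by exact: measurable_term.
have [M1 M10 hM1] := term_bound cutoff k' psi hk hk' Ppsi.
have [M2 M20 hM2] := term_bound cutoff cutoff psi2 hk hk Ppsi2.
have [M3 M30 hM3] := term_bound cutoff cutoff psi hk hk Ppsi.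
have l1 : ccvg (fun n => cint leb2 (fun z => (g n z)%:C * p z)) (cint leb2 (fun z => (psi2 z)%:C * p z)).
  apply: (pairing_cvg p g psi2 (M1 + M2)) => //; last first.
  - move=> z; rewrite -[psi2 z](_ : 0 * (cutoff 0 * k' 0 * psi z) + cutoff 0 * cutoff 0 * psi2 z = _).
      by apply: cvgD; [apply: cvgM; [exact: rate_cvg|exact: term_cvg]|exact: term_cvg].
    by rewrite cutoff0; ring.
  - move=> n z; rewrite mulrDl; apply: (le_trans (ler_normD _ _)); apply: lerD; last exact: hM2.
    by apply: rate_bound => //; exact: isqq_ge0.
  - exact: Pm.
have l2 : ccvg (fun n => cint leb2 (fun z => (phi n z)%:C * q z)) (cint leb2 (fun z => (psi z)%:C * q z)).
  apply: (pairing_cvg q phi psi M3) => //; last first.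
  - move=> z; rewrite -[psi z](_ : cutoff 0 * cutoff 0 * psi z = _); first exact: term_cvg.
    by rewrite cutoff0; ring.
  - exact: Pm.
have e n : cint leb2 (fun z => (g n z)%:C * p z) = -1 * cint leb2 (fun z => (phi n z)%:C * q z).
  by rewrite -pg (pq _ (tphi n)) ?pg// mulN1r.
rewrite -mulN1r; apply: (ccvg_unique _ _ _ l1).
rewrite (_ : (fun n => cint leb2 (fun z => (g n z)%:C * p z)) = fun n => -1 * cint leb2 (fun z => (phi n z)%:C * q z)).
  by apply: ccvg_mul => //; exact: ccvg_cst.
by apply/funext.
Qed.

Lemma weak_pairing11 p q psi psi2 psi12 : bounded_symbol p -> bounded_symbol q ->
  weak_partial12 p q ->
  P psi -> P psi2 -> P psi12 -> (forall z, is_derive z.2 (1 : R) (fun x => psi (z.1, x)) (psi2 z)) ->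
  (forall z, is_derive z.1 (1 : R) (fun x => psi2 (x, z.2)) (psi12 z)) ->
  cint leb2 (fun z => (psi12 z)%:C * p z) = cint leb2 (fun z => (psi z)%:C * q z).
Proof.
move=> bp bq pq Ppsi Ppsi2 Ppsi12 d2 d12; have hk := cutoff_bump; have [Pd _ Pm] := hP.
have [[psi1 Ppsi1 d1] _] := Pd psi Ppsi.
have [k' hk' dk] := bump_class_deriv _ _ _ _ hk.
pose phi n : R * R -> R := term cutoff cutoff psi n.
have tphi n : test_function (phi n).
  by apply: (cutoff_test P (rate n)) => //; [exact: rate_gt0|exact: cutoff_prod].
pose g1 n z : R := rate n * term cutoff k' psi n z + term cutoff cutoff psi2 n z.
have pg1 n : partial2 (phi n) = g1 n.
  apply: partial2E => z.
  have h := isdM _ _ _ _ _ (isdM _ _ _ _ _ (isd_cst (cutoff (rate n * z.1)) z.2) (isd_dilate cutoff _ (rate n) z.2 (dk _))) (d2 z).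
  by apply: isd_ext h _ _ => //=; rewrite -surjective_pairing /g1 /term; ring.
(* Of the four terms of Leibniz's rule only the last carries no factor [rate n]. *)
pose g n z : R := rate n * (rate n * term k' k' psi n z) + rate n * term cutoff k' psi1 n z +
  rate n * term k' cutoff psi2 n z + term cutoff cutoff psi12 n z.
have pg n : partial1 (partial2 (phi n)) = g n.
  rewrite pg1; apply: partial1E => z.
  have hc := isd_dilate cutoff _ (rate n) z.1 (dk _).
  have h1 := isdM _ _ _ _ _ (isdM _ _ _ _ _ hc (isd_cst (k' (rate n * z.2)) z.1)) (d1 z).
  have h2 := isdM _ _ _ _ _ (isdM _ _ _ _ _ hc (isd_cst (cutoff (rate n * z.2)) z.1)) (d12 z).
  have h := isdD _ _ _ _ _ (isdM _ _ _ _ _ (isd_cst (rate n) z.1) h1) h2.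
  by apply: isd_ext h _ _ => //=; rewrite -surjective_pairing /g /term; ring.
have mg n : measurable_fun setT (g n : mR * mR -> R).
  apply: measurable_funD; last exact: measurable_term.
  apply: measurable_funD; last by apply: measurable_funM => //; exact: measurable_term.
  apply: measurable_funD; last by apply: measurable_funM => //; exact: measurable_term.
  by apply: measurable_funM => //; apply: measurable_funM => //; exact: measurable_term.
have mphi n : measurable_fun setT (phi n : mR * mR -> R) by exact: measurable_term.
have [M1 M10 hM1] := term_bound k' k' psi hk' hk' Ppsi.
have [M2 M20 hM2] := term_bound cutoff k' psi1 hk hk' Ppsi1.
have [M3 M30 hM3] := term_bound k' cutoff psi2 hk' hk Ppsi2.
have [M4 M40 hM4] := term_bound cutoff cutoff psi12 hk hk Ppsi12.
have [M5 M50 hM5] := term_bound cutoff cutoff psi hk hk Ppsi.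
have l1 : ccvg (fun n => cint leb2 (fun z => (g n z)%:C * p z)) (cint leb2 (fun z => (psi12 z)%:C * p z)).
  apply: (pairing_cvg p g psi12 (M1 + M2 + M3 + M4)) => //; last first.
  - move=> z; rewrite -[psi12 z](_ : 0 * (0 * (k' 0 * k' 0 * psi z)) + 0 * (cutoff 0 * k' 0 * psi1 z) +
      0 * (k' 0 * cutoff 0 * psi2 z) + cutoff 0 * cutoff 0 * psi12 z = _).
      apply: cvgD; last exact: term_cvg.
      apply: cvgD; last by apply: cvgM; [exact: rate_cvg|exact: term_cvg].
      apply: cvgD; last by apply: cvgM; [exact: rate_cvg|exact: term_cvg].
      by apply: cvgM; [exact: rate_cvg|apply: cvgM; [exact: rate_cvg|exact: term_cvg]].
    by rewrite cutoff0; ring.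
  - move=> n z; have i0 := isqq_ge0 z; rewrite !mulrDl.
    apply: (le_trans (ler_normD _ _)); apply: lerD; last exact: hM4.
    apply: (le_trans (ler_normD _ _)); apply: lerD; last by apply: rate_bound.
    apply: (le_trans (ler_normD _ _)); apply: lerD; last by apply: rate_bound.
    by apply: rate_bound => //; exact: rate_bound.
  - exact: Pm.
have l2 : ccvg (fun n => cint leb2 (fun z => (phi n z)%:C * q z)) (cint leb2 (fun z => (psi z)%:C * q z)).
  apply: (pairing_cvg q phi psi M5) => //; last first.
  - move=> z; rewrite -[psi z](_ : cutoff 0 * cutoff 0 * psi z = _); first exact: term_cvg.
    by rewrite cutoff0; ring.
  - exact: Pm.
apply: (ccvg_unique _ _ _ l1).
rewrite (_ : (fun n => cint leb2 (fun z => (g n z)%:C * p z)) = fun n => cint leb2 (fun z => (phi n z)%:C * q z))//.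
by apply/funext => n; rewrite -pg; apply: pq => //; rewrite pg.
Qed.

End Cutoffs.
End WeakPairing.

(** * The Sobolev weight *)

Section Weight.
Context {R : realType}.
Local Notation mR := (measurableTypeR R).
Implicit Types (s x a b eps : R).

(** The reciprocal of the multiplier in the Sobolev norm of order [1 + eps]; it is integrable on the
    line since its decay exponent exceeds 1. *)
Definition weight eps s := (1 + s ^+ 2) `^ (- ((1 + eps) / 2)).

Lemma onePsqr_gt0 s : 0 < 1 + s ^+ 2.
Proof. by rewrite ltr_pwDl ?sqr_ge0. Qed.

Lemma onePsqr_ge0 s : 0 <= 1 + s ^+ 2.
Proof. exact/ltW/onePsqr_gt0. Qed.

Lemma isd_powR1D r s : 0 <= s -> is_derive s 1 (fun x => (1 + x) `^ r) (r * (1 + s) `^ (r - 1)).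
Proof.
move=> s0; have p : 0 < 1 * s + 1 by rewrite mul1r ltr_wpDl.
have h := isd_comp (fun x : R => x `^ r) (fun x => 1 * x + 1) s _ _ (is_derive1_powR r p) (isd_affine 1 1 s).
by apply: isd_ext h _ _; [move=> x; rewrite mul1r addrC|rewrite !mul1r [s + 1]addrC].
Qed.

Lemma weight_gt0 eps s : 0 < weight eps s.
Proof. exact/powR_gt0/onePsqr_gt0. Qed.

Lemma weight_ge0 eps s : 0 <= weight eps s.
Proof. exact/ltW/weight_gt0. Qed.

Lemma weight_even eps s : weight eps (- s) = weight eps s.
Proof. by rewrite /weight sqrrN. Qed.

Lemma weight_sobolev eps s : (1 + s ^+ 2) `^ ((1 + eps) / 2) * weight eps s = 1.
Proof. by rewrite /weight powRN mulfV// gt_eqF// powR_gt0// onePsqr_gt0. Qed.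

Lemma measurable_weight eps : measurable_fun setT (weight eps : mR -> R).
Proof.
apply: (measurableT_comp (measurable_powR _)).
by apply: measurable_funD => //; exact: measurable_funX.
Qed.

Variables (eps : R) (eps_gt0 : 0 < eps) (eps_lt1 : eps < 1).

Let half_ge0 : 0 <= (1 + eps) / 2.
Proof. by rewrite divr_ge0// addr_ge0// ltW. Qed.

Lemma weight_mono a b : a ^+ 2 <= b ^+ 2 -> weight eps b <= weight eps a.
Proof.
move=> ab; rewrite /weight !powRN lef_pV2 ?posrE ?powR_gt0 ?onePsqr_gt0//.
by apply: ge0_ler_powR; rewrite ?nnegrE ?onePsqr_ge0 ?lerD2l.
Qed.

Lemma weight_le1 a : weight eps a <= 1.
Proof.
have := weight_mono 0 a; rewrite expr0n => /(_ (sqr_ge0 a)).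
by rewrite {2}/weight expr0n addr0 powR1.
Qed.

(* Peetre's inequality *)
Lemma weight_mul_le a b : weight eps a * weight eps b <= 2 * weight eps (a + b).
Proof.
rewrite /weight !powRN -invfM -powRM ?onePsqr_ge0//.
have p0 := powR_gt0 ((1 + eps) / 2) (onePsqr_gt0 (a + b)).
have p1 := powR_gt0 ((1 + eps) / 2) (mulr_gt0 (onePsqr_gt0 a) (onePsqr_gt0 b)).
rewrite ler_pdivlMr// mulrC ler_pdivrMr//.
(* The inequality [1 + (a + b) ^ 2 <= 2 (1 + a ^ 2) (1 + b ^ 2)] is raised to the power
   [(1 + eps) / 2], which is at most 1, so the constant stays below 2. *)
have h2 : (2 : R) `^ ((1 + eps) / 2) <= 2.
  rewrite -[leRHS]powRr1//; apply: ler_powR; first by rewrite ler1n.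
  by rewrite ler_pdivrMr// mul1r -natr1 addrC lerD2r ltW.
apply: le_trans (ler_wpM2r (ltW p1) h2); rewrite -powRM ?mulr_ge0 ?onePsqr_ge0//.
apply: ge0_ler_powR => //; rewrite ?nnegrE ?mulr_ge0 ?onePsqr_ge0//.
by have := sqr_ge0 (a - b); have := sqr_ge0 (a * b); rewrite !expr2; nra.
Qed.

(** Peetre's inequality is used twice, for the summands [t e] and [(1 - t) e], whose weights are at
    least that of [e]. With [s = zeta - sigma] the weights on the right are attached to the
    arguments of [F] and of [H], recentred at [sigma] and [- sigma]. *)
Lemma weight4_le t s e : 0 <= t <= 1 ->
  weight eps s ^+ 2 * weight eps e ^+ 2 <= 4 * (weight eps (s + t * e) * weight eps ((1 - t) * e - s)).
Proof.
move=> /andP[t0 t1]; have ws := weight_ge0 eps s; have we := weight_ge0 eps e.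
have sq c : 0 <= c -> c <= 1 -> (c * e) ^+ 2 <= e ^+ 2.
  by move=> c0 c1; rewrite exprMn ler_piMl ?sqr_ge0// expr_le1.
have h1 : weight eps s * weight eps e <= 2 * weight eps (s + t * e).
  apply: le_trans (weight_mul_le s (t * e)); rewrite ler_wpM2l//; exact/weight_mono/sq.
have h2 : weight eps s * weight eps e <= 2 * weight eps ((1 - t) * e - s).
  rewrite [_ - s]addrC -(weight_even _ s).
  apply: le_trans (weight_mul_le (- s) ((1 - t) * e)); rewrite weight_even ler_wpM2l//.
  by apply/weight_mono/sq; lra.
rewrite (_ : 4 * _ = (2 * weight eps (s + t * e)) * (2 * weight eps ((1 - t) * e - s))); last by ring.
rewrite (_ : _ * _ = (weight eps s * weight eps e) * (weight eps s * weight eps e)); last by ring.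
by apply: ler_pM => //; exact: mulr_ge0.
Qed.

(** By [(1 + s) ^ 2 <= 2 (1 + s ^ 2)] the weight is at most [2 (1 + s) ^ (- 1 - eps)] on the
    half-line, a function with an explicit primitive that vanishes at infinity. *)
Lemma integrable_weight : leb.-integrable setT (EFin \o weight eps).
Proof.
apply: integrable_even; [exact: measurable_weight|exact: weight_ge0|exact: weight_even|].
pose f s : R := 2 * (1 + s) `^ (- eps - 1); pose F s : R := - (2 / eps) * (1 + s) `^ (- eps).
have e0 : eps != 0 by rewrite gt_eqF.
have dF s : 0 <= s -> is_derive s 1 F (f s).
  move=> s0; have h' := isdM _ _ _ _ _ (isd_cst (- (2 / eps)) s) (isd_powR1D (- eps) s s0).
  by apply: isd_ext h' _ _ => //; rewrite /f; field.
have cF s : 0 <= s -> {for s, continuous F}.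
  by move=> s0; apply/differentiable_continuous/derivable1_diffP; case: (dF s s0).
have cf s : 0 <= s -> {for s, continuous f}.
  move=> s0; have [d _] := isdM _ _ _ _ _ (isd_cst 2 s) (isd_powR1D (- eps - 1) s s0).
  exact/differentiable_continuous/derivable1_diffP.
have key : (\int[leb]_(x in `[0%R, +oo[) (f x)%:E = 0%:E - (F 0)%:E)%E.
  apply: (@ge0_continuous_FTC2y R f F 0 0).
  - by move=> x x0; rewrite mulr_ge0// powR_ge0.
  - rewrite continuous_within_itvcyP; split; last by apply: cvg_at_right_filter; exact: cf.
    by move=> x; rewrite in_itv/= andbT => /ltW; exact: cf.
  - rewrite -(mulr0 (- (2 / eps))); apply: cvgM; first exact: cvg_cst.
    apply/cvgr0Pnorm_lt => e ep.
    near=> s; have sp : e / 2 > 0 by rewrite divr_gt0.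
    have s1 : (e / 2) `^ (- eps^-1) <= 1 + s.
      by rewrite -lerBlDl; near: s; apply: nbhs_pinfty_ge; rewrite num_real.
    rewrite ger0_norm ?powR_ge0// powRN.
    apply: (@le_lt_trans _ _ (e / 2)); last by rewrite ltr_pdivrMr// ltr_pMr// ltr1n.
    have k0 := powR_gt0 (- eps^-1) sp.
    have q1 : ((e / 2) `^ (- eps^-1)) `^ eps <= (1 + s) `^ eps.
      by apply: ge0_ler_powR; rewrite ?nnegrE ?(ltW eps_gt0) ?(ltW k0) ?(ltW (lt_le_trans k0 s1)).
    rewrite -powRrM mulNr mulVf// powR_inv1 ?(ltW sp)// in q1.
    have i0 : 0 < (e / 2)^-1 by rewrite invr_gt0.
    by rewrite -[leRHS]invrK lef_pV2// posrE; apply: lt_le_trans q1.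
  - by move=> x /ltW x0; case: (dF x x0).
  - by apply: cvg_at_right_filter; exact: cF.
  - by move=> x; rewrite in_itv/= andbT => /ltW x0; exact: isd_derive1 (dF x x0).
apply: (@le_lt_trans _ _ (\int[leb]_(x in `[0%R, +oo[) (f x)%:E)%E); last by rewrite key -EFinB ltry.
apply: ge0_le_integral => //.
- by move=> x _; rewrite lee_fin weight_ge0.
- by apply/measurable_EFinP; apply: measurable_funTS; exact: measurable_weight.
- apply/measurable_EFinP; apply: measurable_funTS; apply: measurable_funM => //.
  by apply: (measurableT_comp (measurable_powR _)); exact: measurable_funD.
- move=> x /=; rewrite in_itv/= andbT => x0; rewrite lee_fin /f /weight.
  have x1 : 0 < 1 + x by rewrite ltr_pwDl.
  have E : ((1 + x) ^+ 2) `^ ((1 + eps) / 2) = (1 + x) `^ (1 + eps).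
    by rewrite -powR_mulrn ?ltW// -powRrM; congr (_ `^ _); field.
  rewrite (_ : - eps - 1 = - (1 + eps)); last by ring.
  have p1 := powR_gt0 (1 + eps) x1.
  rewrite !powRN ler_pdivlMr// mulrC ler_pdivrMr ?powR_gt0 ?onePsqr_gt0//.
  have h2 : (2 : R) `^ ((1 + eps) / 2) <= 2.
    rewrite -[leRHS]powRr1//; apply: ler_powR; first by rewrite ler1n.
    by rewrite ler_pdivrMr// mul1r -natr1 addrC lerD2r ltW.
  rewrite -E; apply: le_trans (ler_wpM2r (powR_ge0 _ _) h2); rewrite -powRM ?onePsqr_ge0//.
  apply: ge0_ler_powR => //; rewrite ?nnegrE ?mulr_ge0 ?sqr_ge0 ?onePsqr_ge0 ?(ltW x1)//.
  by have := sqr_ge0 (1 - x); rewrite !expr2; nra.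
Unshelve. all: by end_near.
Qed.

End Weight.

(** * Averaging in the frequency *)

Section Tonelli.
Context {R : realType}.
Local Notation mR := (measurableTypeR R).
Implicit Types (a b u : R -> R) (t x : R).

(** Kept in the extended reals so that Tonelli's theorem can be used before finiteness is known. *)
Definition eint u : \bar R := (\int[leb]_x (u x)%:E)%E.

Definition nonneg_measurable u := measurable_fun setT (u : mR -> R) /\ forall x, 0 <= u x.

Lemma eint_ge0 u : (forall x, 0 <= u x) -> (0 <= eint u)%E.
Proof. by move=> u0; apply: integral_ge0 => x _; rewrite lee_fin. Qed.

Lemma eint_shift u (x : R) : nonneg_measurable u -> eint (fun y => u (y + x)) = eint u.
Proof.
move=> [mu u0]; rewrite /eint [RHS](ge0_integral_affine 1 x) ?oner_neq0//.
- by rewrite normr1 mul1e; apply: eq_integral => y _; rewrite mul1r.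
- exact/measurable_EFinP.
Qed.

Lemma eint_reflect u (x : R) : nonneg_measurable u -> eint (fun y => u (x - y)) = eint u.
Proof.
move=> [mu u0]; rewrite /eint [RHS](ge0_integral_affine (-1) x) ?oppr_eq0 ?oner_neq0//.
- by rewrite normrN1 mul1e; apply: eq_integral => y _; rewrite mulN1r addrC.
- exact/measurable_EFinP.
Qed.

Lemma eint_scale u (c : R) : 0 <= c -> nonneg_measurable u -> eint (fun y => c * u y) = (c%:E * eint u)%E.
Proof.
move=> c0 [mu u0]; rewrite /eint -ge0_integralZl_EFin//.
- by move=> x _; rewrite lee_fin.
- exact/measurable_EFinP.
Qed.

Lemma tonelli (f : R * R -> R) : measurable_fun setT (f : mR * mR -> R) -> (forall z, 0 <= f z) ->
  (\int[leb]_x eint (fun y => f (x, y)) = \int[leb]_y eint (fun x => f (x, y)))%E.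
Proof.
move=> mf f0; apply: (@fubini_tonelli _ _ mR mR R (@lebesgue_measure R) (@lebesgue_measure R) (EFin \o f)).
  exact/measurable_EFinP.
by move=> z; rewrite lee_fin.
Qed.

Lemma measurable_eint (f : R * R -> R) : measurable_fun setT (f : mR * mR -> R) -> (forall z, 0 <= f z) ->
  measurable_fun setT (fun x : mR => eint (fun y => f (x, y))).
Proof.
move=> mf f0; apply: (@measurable_fun_fubini_tonelli_F _ _ mR mR R (@lebesgue_measure R) (EFin \o f)).
  exact/measurable_EFinP.
by move=> z; rewrite lee_fin.
Qed.

Lemma nonneg_measurable_affine u (c x : R) : nonneg_measurable u ->
  nonneg_measurable (fun y => u (c * y + x)).
Proof. by move=> [mu u0]; split=> //; exact: (measurableT_comp mu (measurable_affine c x)). Qed.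

Lemma measurable_comp2 u (c x : R) : measurable_fun setT (u : mR -> R) ->
  measurable_fun setT (fun z : mR * mR => u (c * z.2 + x * z.1)).
Proof.
move=> mu; apply: (measurableT_comp mu).
by apply: measurable_funD; apply: measurable_funM.
Qed.

Lemma eint_convolution a b : nonneg_measurable a -> nonneg_measurable b ->
  (\int[leb]_x eint (fun y => (a x * b (y - x))%R) = eint a * eint b)%E.
Proof.
move=> [ma a0] [mb b0]; rewrite /eint -ge0_integralZr//=.
- apply: eq_integral => x _; rewrite -[X in _ = (_ * X)%E](eint_shift b (- x))//.
  by rewrite -eint_scale//; split=> //; exact: (measurableT_comp mb (measurable_funD _ _)).
- exact/measurable_EFinP.
- by move=> x _; rewrite lee_fin.
- exact: eint_ge0.
Qed.

(* Only translations are needed to change variables from (x, y) to (ty + x, (1 - t)y - x). *)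
Lemma eint_tensor t a b : nonneg_measurable a -> nonneg_measurable b ->
  (\int[leb]_x eint (fun y => (a (t * y + x) * b ((1 - t) * y + - x))%R) = eint a * eint b)%E.
Proof.
move=> ha hb; have [ma a0] := ha; have [mb b0] := hb.
have m1 : measurable_fun setT (fun z : mR * mR => a (t * z.2 + z.1) * b ((1 - t) * z.2 + - z.1)).
  apply: measurable_funM; last first.
    by have := measurable_comp2 b (1 - t) (-1) mb; apply: eq_measurable_fun => z _; rewrite mulN1r.
  by have := measurable_comp2 a t 1 ma; apply: eq_measurable_fun => z _; rewrite mul1r.
have m2 : measurable_fun setT (fun z : mR * mR => a z.1 * b (z.2 - z.1)).
  apply: measurable_funM; first exact: (measurableT_comp ma measurable_fst).
  by have := measurable_comp2 b 1 (-1) mb; apply: eq_measurable_fun => z _; rewrite mulN1r mul1r.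
have p1 (z : R * R) : 0 <= a (t * z.2 + z.1) * b ((1 - t) * z.2 + - z.1) by exact: mulr_ge0.
have p2 (z : R * R) : 0 <= a z.1 * b (z.2 - z.1) by exact: mulr_ge0.
rewrite -(eint_convolution a b ha hb) (tonelli _ m1 p1) (tonelli _ m2 p2).
apply: eq_integral => y _ /=; rewrite -[RHS](eint_shift _ (t * y)).
  by apply: eq_integral => x _; congr ((a _ * b _)%:E); ring.
split; last by move=> x; exact: mulr_ge0.
apply: measurable_funM => //; apply: (measurableT_comp mb).
by apply: measurable_funB => //.
Qed.

End Tonelli.

(** * The averaging inequality *)

Section Averaging.
Context {R : realType}.
Local Notation mR := (measurableTypeR R).
Variables (eps : R) (eps_gt0 : 0 < eps) (eps_lt1 : eps < 1).
Implicit Types (F H : R -> R[i]) (J : R -> R) (t M : R).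
Local Notation k := (weight eps).

Definition weight_mass : R := \int[leb]_x weight eps x.
Definition weight_mass2 : R := \int[leb]_x (weight eps x ^+ 2).

Lemma eint_integrable (u : R -> R) : leb.-integrable setT (EFin \o u) -> eint u = (\int[leb]_x u x)%:E.
Proof. by move=> iu; rewrite /Rintegral fineK//; exact: integrable_fin_num. Qed.

Lemma nonneg_weight : nonneg_measurable k.
Proof. by split; [exact: measurable_weight|exact: weight_ge0]. Qed.

Lemma nonneg_weight2 : nonneg_measurable (fun x => k x ^+ 2).
Proof. by split; [apply: measurable_funX; exact: measurable_weight|move=> x; rewrite sqr_ge0]. Qed.

Lemma integrable_weight2 : leb.-integrable setT (EFin \o (fun x => k x ^+ 2)).
Proof.
apply: le_integrable (integrable_weight eps eps_gt0 eps_lt1) => //.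
  by apply/measurable_EFinP; case: nonneg_weight2.
move=> x _ /=; rewrite lee_fin !ger0_norm ?sqr_ge0 ?weight_ge0//.
by rewrite expr2 ler_piMr ?weight_ge0// weight_le1.
Qed.

Lemma weight_mass2_gt0 : 0 < weight_mass2.
Proof.
have w1 : 0 < k 1 ^+ 2 by rewrite exprn_gt0// weight_gt0.
apply: (Rintegral_gt0_near0 _ _ _ w1 ltr01 integrable_weight2) => x; first by rewrite sqr_ge0.
move=> /andP[x0 x1]; rewrite lerXn2r ?nnegrE ?weight_ge0//.
by apply: weight_mono => //; rewrite expr1n expr_le1.
Qed.

Lemma weighted_integrable F (u : R -> R) : schwartz F -> nonneg_measurable u -> (forall x, u x <= 1) ->
  leb.-integrable setT (EFin \o (fun x => u x * normc (F x) ^+ 2)).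
Proof.
move=> sF [mu u0] u1; apply: le_integrable (integrable_normc2_schwartz F sF) => //.
  apply/measurable_EFinP; apply: measurable_funM => //; apply: measurable_normc2.
  exact: schwartz_cmeasurable.
move=> x _ /=; rewrite lee_fin !ger0_norm ?mulr_ge0 ?exprn_ge0 ?normc_ge0//.
by rewrite ler_piMl ?exprn_ge0 ?normc_ge0.
Qed.

Lemma nonneg_normc2 F : schwartz F -> nonneg_measurable (fun x => normc (F x) ^+ 2).
Proof.
move=> sF; split; last by move=> x; rewrite sqr_ge0.
by apply: measurable_normc2; exact: schwartz_cmeasurable.
Qed.

Lemma nonneg_mul (u v : R -> R) : nonneg_measurable u -> nonneg_measurable v ->
  nonneg_measurable (fun x => u x * v x).
Proof. by move=> [mu u0] [mv v0]; split=> [|x]; [exact: measurable_funM|exact: mulr_ge0]. Qed.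

Lemma nonneg_shift (u : R -> R) (x : R) : nonneg_measurable u -> nonneg_measurable (fun y => u (y + x)).
Proof.
move=> /(nonneg_measurable_affine _ 1 x); congr nonneg_measurable.
by apply/funext => y; rewrite mul1r.
Qed.

(** The square of the second factor in the Cauchy-Schwarz inequality on the slice of frequency
    [zeta], once the Sobolev multiplier has been moved onto the kernel. *)
Definition energy F H t zeta : \bar R := eint (fun e => k e ^+ 2 * normc (kern t F H zeta e) ^+ 2).

Lemma measurable_kern2 F H t : schwartz F -> schwartz H ->
  measurable_fun setT (fun z : mR * mR => k z.2 ^+ 2 * normc (kern t F H z.1 z.2) ^+ 2).
Proof.
move=> sF sH; apply: measurable_funM.
  by case: nonneg_weight2 => mw _; exact: (measurableT_comp mw measurable_snd).
apply: measurable_funX; apply: measurable_normc; apply: cmeasurable_mul.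
  apply: cmeasurable_comp; first exact: schwartz_cmeasurable.
  by apply: measurable_funD => //; exact: measurable_funM.
apply: cmeasurable_comp; first exact: schwartz_cmeasurable.
by apply: measurable_funB => //; exact: measurable_funM.
Qed.

Lemma energy_ge0 F H t zeta : (0 <= energy F H t zeta)%E.
Proof. by apply: eint_ge0 => x; rewrite mulr_ge0// sqr_ge0. Qed.

Lemma measurable_energy F H t : schwartz F -> schwartz H ->
  measurable_fun setT (energy F H t : mR -> \bar R).
Proof.
move=> sF sH; apply: (measurable_eint (fun z => k z.2 ^+ 2 * normc (kern t F H z.1 z.2) ^+ 2)).
  exact: measurable_kern2.
by move=> z; rewrite mulr_ge0// sqr_ge0.
Qed.

(** After [weight4_le] the integrand is a product of a function of the argument of [F] and one of
    the argument of [H], and the double integral factors by [eint_tensor]. *)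
Lemma weighted_energy_le F H t sigma : schwartz F -> schwartz H -> 0 <= t <= 1 ->
  (\int[leb]_zeta ((k (zeta - sigma) ^+ 2)%:E * energy F H t zeta) <=
   (4 * ((\int[leb]_u (k (u - sigma) * normc (F u) ^+ 2)) *
         (\int[leb]_v (k (v + sigma) * normc (H v) ^+ 2))))%:E)%E.
Proof.
move=> sF sH t01.
pose a u : R := k (u - sigma) * normc (F u) ^+ 2; pose b v : R := k (v + sigma) * normc (H v) ^+ 2.
have ha : nonneg_measurable a by apply: nonneg_mul; [apply: nonneg_shift; exact: nonneg_weight|exact: nonneg_normc2].
have hb : nonneg_measurable b by apply: nonneg_mul; [apply: nonneg_shift; exact: nonneg_weight|exact: nonneg_normc2].
have ea : eint a = (\int[leb]_u a u)%:E.
  apply: eint_integrable; apply: weighted_integrable => //; last by move=> x; exact: weight_le1.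
  by apply: nonneg_shift; exact: nonneg_weight.
have eb : eint b = (\int[leb]_u b u)%:E.
  apply: eint_integrable; apply: weighted_integrable => //; last by move=> x; exact: weight_le1.
  by apply: nonneg_shift; exact: nonneg_weight.
rewrite -/(a _) -/(b _) EFinM (EFinM (\int[leb]_u a u)) -ea -eb -(eint_tensor t a b ha hb).
have [ma a0] := ha; have [mb b0] := hb.
have m1 : measurable_fun setT (fun z : mR * mR => a (t * z.2 + z.1) * b ((1 - t) * z.2 + - z.1)).
  apply: measurable_funM; last first.
    by have := measurable_comp2 b (1 - t) (-1) mb; apply: eq_measurable_fun => z _; rewrite mulN1r.
  by have := measurable_comp2 a t 1 ma; apply: eq_measurable_fun => z _; rewrite mul1r.
have p1 (z : R * R) : 0 <= a (t * z.2 + z.1) * b ((1 - t) * z.2 + - z.1) by exact: mulr_ge0.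
have m2 := measurable_eint _ m1 p1.
have mE := measurable_energy F H t sF sH.
have mk : measurable_fun setT (fun x : mR => k (x - sigma) ^+ 2).
  by have [+ _] := nonneg_shift _ (- sigma) nonneg_weight2.
have p3 (x : R) : (0 <= eint (fun y => (a (t * y + x) * b ((1 - t) * y + - x))%R))%E.
  by apply: eint_ge0 => y; exact: (p1 (x, y)).
rewrite -ge0_integralZl_EFin => [|//|x _|//|//]; last exact: p3.
apply: ge0_le_integral => //.
- by move=> x _; rewrite mule_ge0 ?lee_fin ?sqr_ge0 ?energy_ge0.
- by apply: emeasurable_funM => //; exact/measurable_EFinP.
- exact: measurable_funeM.
move=> x _; have px : nonneg_measurable (fun y => a (t * y + x) * b ((1 - t) * y + - x)).
  by split; [exact: (measurableT_comp m1 (measurable_pair1 x))|move=> y; exact: (p1 (x, y))].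
have pk : nonneg_measurable (fun e => k e ^+ 2 * normc (kern t F H x e) ^+ 2).
  split; last by move=> y; rewrite mulr_ge0// sqr_ge0.
  exact: (measurableT_comp (measurable_kern2 F H t sF sH) (measurable_pair1 x)).
rewrite /energy -eint_scale ?sqr_ge0// -eint_scale//.
apply: ge0_le_integral => //.
- by move=> y _; rewrite lee_fin mulr_ge0 ?sqr_ge0//; case: pk.
- by apply/measurable_EFinP; apply: measurable_funM => //; case: pk.
- by apply/measurable_EFinP; apply: measurable_funM => //; case: px.
move=> y _; rewrite lee_fin /kern normc_mul exprMn /a /b.
have := weight4_le _ eps_gt0 eps_lt1 t (x - sigma) y t01.
rewrite (_ : x - sigma + t * y = t * y + x - sigma); last by ring.
rewrite (_ : (1 - t) * y - (x - sigma) = (1 - t) * y + - x + sigma); last by ring.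
have q0 : 0 <= normc (F (t * y + x)) ^+ 2 * normc (H ((1 - t) * y + - x)) ^+ 2 by rewrite mulr_ge0// sqr_ge0.
by move=> /(ler_wpM2r q0); congr (_ <= _); ring.
Qed.

(** The inverse of [weight_mass2] undoes the average, [weight_mass] comes from integrating the
    localized norms over the centre, and [(weight_mass2 + 1) / 2] from the choice of the multiplier
    in [averaging_arith]. *)
Definition averaging_constant : R := weight_mass2^-1 * ((weight_mass2 + 1) / 2 * weight_mass).

(* The multiplier (A + B) / M balances the two terms; e avoids dividing by 0. *)
Lemma averaging_arith (A B M m e : R) : 0 <= A -> 0 <= B -> 0 < M -> 0 <= m -> 0 < e ->
  (A + B + e) / M / 2 * M ^+ 2 * m + (2 * ((A + B + e) / M))^-1 * (4 * (A * B)) <=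
  (A + B + e) * (M * ((m + 1) / 2)).
Proof.
move=> A0 B0 M0 m0 e0; have D0 : 0 < A + B + e by rewrite ltr_wpDl ?addr_ge0.
rewrite (_ : (2 * ((A + B + e) / M))^-1 * (4 * (A * B)) = (4 * (A * B)) / (A + B + e) * (M / 2)); last first.
  by field; rewrite !gt_eqF.
have h : (4 * (A * B)) / (A + B + e) <= A + B + e.
  by rewrite ler_pdivrMr//; have := sqr_ge0 (A - B); rewrite expr2; nra.
have M2 : 0 <= M / 2 by rewrite divr_ge0// ltW.
apply: le_trans (_ : (A + B + e) / M / 2 * M ^+ 2 * m + (A + B + e) * (M / 2) <= _).
  by rewrite lerD2l; exact: ler_wpM2r.
by rewrite le_eqVlt; apply/orP; left; apply/eqP; field; rewrite gt_eqF.
Qed.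

Lemma measurable_average F (c : R) : schwartz F ->
  measurable_fun setT (fun z : mR * mR => k (1 * z.2 + c * z.1) * normc (F z.2) ^+ 2).
Proof.
move=> sF; have [mF _] := nonneg_normc2 F sF; have [mk _] := nonneg_weight.
by apply: measurable_funM; [exact: measurable_comp2|exact: (measurableT_comp mF measurable_snd)].
Qed.

(** Integrating in the centre [s] first leaves the mass of the weight. The signs [c = -1] and
    [c = 1] serve for [F] and [H] respectively. *)
Lemma average_mass F (c : R) : schwartz F -> `|c| = 1 ->
  (\int[leb]_s eint (fun u => (k (1 * u + c * s) * normc (F u) ^+ 2)%R) = (weight_mass * nsq F)%:E)%E.
Proof.
move=> sF c1; have [mF F0] := nonneg_normc2 F sF; have [mk k0] := nonneg_weight.
have c0 : c != 0 by rewrite -normr_eq0 c1 oner_neq0.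
rewrite (tonelli _ (measurable_average F c sF)); last by move=> z; rewrite mulr_ge0.
rewrite EFinM -(eint_integrable _ (integrable_normc2_schwartz F sF)).
rewrite -ge0_integralZl//; last 3 first.
- exact/measurable_EFinP.
- by move=> x _; rewrite lee_fin.
- by rewrite lee_fin; apply: Rintegral_ge0 => x _; exact: k0.
apply: eq_integral => u _ /=; rewrite -(eint_integrable _ (integrable_weight eps eps_gt0 eps_lt1)).
rewrite [eint k in RHS](ge0_integral_affine c u)//; last exact/measurable_EFinP.
transitivity ((normc (F u) ^+ 2)%:E * eint (fun s => k (c * s + u)))%E; last by rewrite c1 mul1e muleC.
rewrite -eint_scale//.
  by apply: eq_integral => s _; rewrite mul1r mulrC addrC.
by apply: nonneg_measurable_affine; exact: nonneg_weight.
Qed.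

(** The hypothesis is a Cauchy-Schwarz bound in Young's form, linear in the energy, so that it can
    be integrated before [l] is chosen. Around each centre [s] the function [J] is integrated
    against [k (z - s) ^ 2], with an [l] that depends on [s] but not on [z]; integrating over [s]
    then recovers [J]. *)
Lemma averaging F H J t M : schwartz F -> schwartz H -> 0 <= t <= 1 -> 0 < M -> nonneg_measurable J ->
  {ae leb, forall zeta, forall l : R, 0 < l ->
     ((J zeta)%:E <= (l / 2 * M ^+ 2)%:E + ((2 * l)^-1)%:E * energy F H t zeta)%E} ->
  (eint J <= (averaging_constant * M * (nsq F + nsq H))%:E)%E.
Proof.
move=> sF sH t01 M0 hJ aeJ; have [mJ J0] := hJ.
have m20 := weight_mass2_gt0.
pose A s : R := \int[leb]_u (k (u - s) * normc (F u) ^+ 2).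
pose B s : R := \int[leb]_v (k (v + s) * normc (H v) ^+ 2).
have A0 s : 0 <= A s by apply: Rintegral_ge0 => x _; rewrite mulr_ge0 ?weight_ge0 ?sqr_ge0.
have B0 s : 0 <= B s by apply: Rintegral_ge0 => x _; rewrite mulr_ge0 ?weight_ge0 ?sqr_ge0.
have mE := measurable_energy F H t sF sH.
have step s : (eint (fun z => k (z - s) ^+ 2 * J z)%R <= ((A s + B s) * (M * ((weight_mass2 + 1) / 2)))%:E)%E.
  apply/lee_addgt0Pr => e e0.
  have c0 : 0 < M * ((weight_mass2 + 1) / 2) by rewrite mulr_gt0// divr_gt0// addr_gt0.
  (* The padding keeps [l] positive when [A s + B s = 0]; it is scaled to cost exactly [e] in the
     final bound. *)
  pose e' := e / (M * ((weight_mass2 + 1) / 2)); have e'0 : 0 < e' by rewrite divr_gt0.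
  rewrite -EFinD (_ : _ + e = (A s + B s + e') * (M * ((weight_mass2 + 1) / 2))); last first.
    by rewrite [RHS]mulrDl /e' divfK// gt_eqF.
  pose l := (A s + B s + e') / M; have l0 : 0 < l by rewrite divr_gt0// ltr_wpDl ?addr_ge0.
  have [mk k0] := nonneg_shift _ (- s) nonneg_weight2.
  have i0 : 0 <= (2 * l)^-1 by rewrite invr_ge0 mulr_ge0 ?(ltW l0).
  have il : 0 <= l / 2 * M ^+ 2 by rewrite mulr_ge0 ?sqr_ge0// divr_ge0 ?(ltW l0).
  have mkE : measurable_fun setT (fun z : mR => (k (z - s) ^+ 2)%:E * energy F H t z)%E.
    by apply: emeasurable_funM => //; exact/measurable_EFinP.
  have kE0 z : (0 <= (k (z - s) ^+ 2)%:E * energy F H t z)%E.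
    by rewrite mule_ge0 ?lee_fin ?energy_ge0.
  apply: (@le_trans _ _ (\int[leb]_z ((l / 2 * M ^+ 2 * k (z - s) ^+ 2)%:E +
      ((2 * l)^-1)%:E * ((k (z - s) ^+ 2)%:E * energy F H t z)))%E).
    apply: ae_ge0_le_integral => //.
    - by move=> z _; rewrite lee_fin mulr_ge0.
    - by apply/measurable_EFinP; exact: measurable_funM.
    - by move=> z _; apply: adde_ge0; [rewrite lee_fin mulr_ge0|rewrite mule_ge0// lee_fin].
    - apply: emeasurable_funD; last exact: measurable_funeM.
      by apply/measurable_EFinP; exact: measurable_funM.
    - apply: (ae_imp leb _ _ aeJ) => z /(_ l l0) h _.
      rewrite (EFinM _ (J z)) (mulrC (l / 2 * M ^+ 2)) (EFinM _ (l / 2 * M ^+ 2)) (muleCA ((2 * l)^-1)%:E) -ge0_muleDr ?lee_fin//.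
        by rewrite lee_wpmul2l// lee_fin.
      by rewrite mule_ge0 ?energy_ge0// lee_fin.
  rewrite ge0_integralD//; last 4 first.
  - by move=> z _; rewrite lee_fin mulr_ge0.
  - by apply/measurable_EFinP; exact: measurable_funM.
  - by move=> z _; rewrite mule_ge0// lee_fin.
  - exact: measurable_funeM.
  rewrite ge0_integralZl_EFin//.
  rewrite -[X in (X + _)%E]/(eint (fun z => l / 2 * M ^+ 2 * k (z - s) ^+ 2)) eint_scale//.
  rewrite (eint_shift (fun z => k z ^+ 2) (- s) nonneg_weight2) (eint_integrable _ integrable_weight2).
  apply: le_trans (_ : _ <= (l / 2 * M ^+ 2)%:E * weight_mass2%:E + ((2 * l)^-1)%:E * (4 * (A s * B s))%:E)%E _.
    by rewrite leeD2l// lee_wpmul2l ?lee_fin//; exact: weighted_energy_le.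
  rewrite -!EFinM -EFinD lee_fin; apply: averaging_arith => //; exact: ltW.
have eA s : eint (fun u => k (u - s) * normc (F u) ^+ 2) = (A s)%:E.
  apply: eint_integrable; apply: weighted_integrable => //; last by move=> x; exact: weight_le1.
  by apply: nonneg_shift; exact: nonneg_weight.
have eB s : eint (fun u => k (u + s) * normc (H u) ^+ 2) = (B s)%:E.
  apply: eint_integrable; apply: weighted_integrable => //; last by move=> x; exact: weight_le1.
  by apply: nonneg_shift; exact: nonneg_weight.
have mA : measurable_fun setT (fun s : mR => (A s)%:E).
  rewrite (_ : (fun s : mR => (A s)%:E) = fun s => eint (fun u => k (1 * u + (-1) * s) * normc (F u) ^+ 2)).
    apply: (measurable_eint (fun z => k (1 * z.2 + (-1) * z.1) * normc (F z.2) ^+ 2)).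
      exact: measurable_average.
    by move=> z; rewrite mulr_ge0 ?weight_ge0 ?sqr_ge0.
  by apply/funext => s; rewrite -eA; apply: eq_integral => u _; rewrite mul1r mulN1r.
have mB : measurable_fun setT (fun s : mR => (B s)%:E).
  rewrite (_ : (fun s : mR => (B s)%:E) = fun s => eint (fun u => k (1 * u + 1 * s) * normc (H u) ^+ 2)).
    apply: (measurable_eint (fun z => k (1 * z.2 + 1 * z.1) * normc (H z.2) ^+ 2)).
      exact: measurable_average.
    by move=> z; rewrite mulr_ge0 ?weight_ge0 ?sqr_ge0.
  by apply/funext => s; rewrite -eB; apply: eq_integral => u _; rewrite !mul1r.
have convA : (\int[leb]_s (A s)%:E = (weight_mass * nsq F)%:E)%E.
  rewrite -(average_mass F (-1) sF) ?normrN1//; apply: eq_integral => s _.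
  by rewrite -eA; apply: eq_integral => u _; rewrite mul1r mulN1r.
have convB : (\int[leb]_s (B s)%:E = (weight_mass * nsq H)%:E)%E.
  rewrite -(average_mass H 1 sH) ?normr1//; apply: eq_integral => s _.
  by rewrite -eB; apply: eq_integral => u _; rewrite !mul1r.
have c0 : 0 <= M * ((weight_mass2 + 1) / 2) by rewrite mulr_ge0 ?(ltW M0)// divr_ge0// addr_ge0// ltW.
have [mk2 k20] := nonneg_weight2.
pose f (z : R * R) : R := k (z.2 - z.1) ^+ 2 * J z.2.
have f0 z : 0 <= f z by rewrite mulr_ge0 ?sqr_ge0.
have mf : measurable_fun setT (f : mR * mR -> R).
  apply: measurable_funM; last exact: (measurableT_comp mJ measurable_snd).
  by have := measurable_comp2 (fun x => k x ^+ 2) 1 (-1) mk2; apply: eq_measurable_fun => z _; rewrite mulN1r mul1r.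
(* Exchanging the integrals in [s] and [z], the squared weights integrate over [s] to [weight_mass2]
   for every [z]. *)
have total : (weight_mass2%:E * eint J <= (weight_mass * (nsq F + nsq H) * (M * ((weight_mass2 + 1) / 2)))%:E)%E.
  have -> : (weight_mass2%:E * eint J = \int[leb]_s eint (fun z => f (s, z)))%E.
    rewrite (tonelli f mf f0) /eint -ge0_integralZl_EFin ?(ltW m20)//; last 2 first.
    - by move=> x _; rewrite lee_fin.
    - exact/measurable_EFinP.
    apply: eq_integral => z _; rewrite muleC -[weight_mass2%:E](eint_integrable _ integrable_weight2).
    rewrite -(eint_reflect _ z nonneg_weight2) -eint_scale//.
      by apply: eq_integral => x _; rewrite mulrC.
    split; last by move=> x; rewrite sqr_ge0.
    by apply: (measurableT_comp mk2); exact: measurable_funB.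
  apply: (@le_trans _ _ (\int[leb]_s ((M * ((weight_mass2 + 1) / 2))%:E * ((A s)%:E + (B s)%:E)))%E).
    apply: ge0_le_integral => //.
    - by move=> s _; apply: eint_ge0.
    - exact: measurable_eint.
    - by apply: measurable_funeM; exact: emeasurable_funD.
    - by move=> s _; rewrite -EFinD -EFinM mulrC; exact: step.
  rewrite ge0_integralZl_EFin//; last 2 first.
  - by move=> s _; rewrite -EFinD lee_fin addr_ge0.
  - exact: emeasurable_funD.
  rewrite ge0_integralD//; try by move=> s _; rewrite lee_fin.
  by rewrite convA convB -EFinD -EFinM lee_fin -mulrDr mulrC.
rewrite -lee_pdivlMl// in total; apply: (le_trans total).
by rewrite -EFinM lee_fin /averaging_constant le_eqVlt; apply/orP; left; apply/eqP; ring.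
Qed.
End Averaging.

(** * The Sobolev norm of the sections *)

Section Slices.
Context {R : realType}.
Local Notation mR := (measurableTypeR R).
Local Notation mu := (@lebesgue_measure R).
Local Notation mu2 := (mu \x mu)%E.

(** Tonelli's theorem for the indicator of a measurable null set containing the exceptions: its
    integral over almost every section, in either direction, vanishes. *)
Lemma ae_slices (P : R * R -> Prop) : {ae mu2, forall z, P z} ->
  {ae mu, forall x, {ae mu, forall y, P (x, y)}} /\ {ae mu, forall y, {ae mu, forall x, P (x, y)}}.
Proof.
move=> [A [mA A0 PA]].
have mI : measurable_fun setT (fun z : mR * mR => (\1_A z : R)%:E).
  by apply/measurable_EFinP; exact: measurable_indic.
have I0 z : (0 <= (\1_A z : R)%:E)%E by rewrite lee_fin.
have e0 : (\int[mu2]_z (\1_A z : R)%:E = 0)%E by rewrite integral_indic// setIT.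
have key (f : mR -> \bar R) : measurable_fun setT f -> (forall x, (0 <= f x)%E) -> (\int[mu]_x f x = 0)%E ->
    {ae mu, forall x, f x = 0%E}.
  move=> mf f0 h; have h' : (\int[mu]_x `|f x| = 0)%E.
    by rewrite -[RHS]h; apply: eq_integral => x _; rewrite gee0_abs.
  by have /(ae_eq_integral_abs mu measurableT mf) h'' := h'; apply: (ae_imp mu _ _ h'') => x /(_ I).
split.
  have mF := @measurable_fun_fubini_tonelli_F _ _ mR mR R mu _ mI I0.
  have h := e0; rewrite (@fubini_tonelli1 _ _ mR mR R mu mu _ mI I0) in h.
  have hx := key _ mF (fun x => integral_ge0 _ (fun y _ => I0 (x, y))) h.
  apply: (ae_imp mu _ _ hx) => x h1.
  have m1 := measurableT_comp mI (measurable_pair1 x).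
  apply: (ae_imp mu _ _ (key _ m1 (fun y => I0 (x, y)) h1)) => y /= h2.
  apply: contrapT => nP; have /PA Az : (~` P) (x, y) by [].
  by move: h2; rewrite indicE mem_set// => -[] /eqP; rewrite oner_eq0.
have mG := @measurable_fun_fubini_tonelli_G _ _ mR mR R mu _ mI I0.
have h := e0; rewrite (@fubini_tonelli2 _ _ mR mR R mu mu _ mI I0) in h.
have hy := key _ mG (fun y => integral_ge0 _ (fun x _ => I0 (x, y))) h.
apply: (ae_imp mu _ _ hy) => y h1.
have m1 := measurableT_comp mI (measurable_pair2 y).
apply: (ae_imp mu _ _ (key _ m1 (fun x => I0 (x, y)) h1)) => x /= h2.
apply: contrapT => nP; have /PA Az : (~` P) (x, y) by [].
by move: h2; rewrite indicE mem_set// => -[] /eqP; rewrite oner_eq0.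
Qed.

End Slices.

Lemma cmeasurable_slice2 {R : realType} (f : R * R -> R[i]) (y : R) :
  cmeasurable (f : measurableTypeR R * measurableTypeR R -> R[i]) ->
  cmeasurable ((fun x => f (x, y)) : measurableTypeR R -> R[i]).
Proof.
by move=> [f1 f2]; split;
  [exact: (measurableT_comp f1 (measurable_pair2 y))|exact: (measurableT_comp f2 (measurable_pair2 y))].
Qed.

Section SobolevPairing.
Context {R : realType}.
Local Notation mR := (measurableTypeR R).
Implicit Types (g G phi : R -> R[i]) (F H : R -> R[i]) (M t : R).
Variables (eps : R) (eps_gt0 : 0 < eps) (eps_lt1 : eps < 1).
Local Notation k := (weight eps).

Lemma measurable_of_plateaus (u : R -> R) :
  (forall n l r, measurable_fun setT (fun x : mR => u x * plateau n.+1%:R l r x)) ->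
  measurable_fun setT (u : mR -> R).
Proof.
move=> h; have hi l r : measurable_fun setT (fun x : mR => u x * ind l r x).
  apply: (measurable_fun_cvg (fun n => h n l r)) => x _.
  by apply: cvgM; [exact: cvg_cst|exact: plateau_cvg].
apply: (measurable_fun_cvg (fun n => hi (- n%:R) n%:R)) => x _.
apply: cvg_near_cst; have [N _ hN] := ind_eventually x.
by exists N => // n /hN /= ->; rewrite mulr1.
Qed.

(** The definition provides integrability of the products of [G] with Schwartz functions; [G] is a
    pointwise limit of its products with plateaus. *)
Lemma tempered_cmeasurable g G : tempered_fourier g G -> cmeasurable (G : mR -> R[i]).
Proof.
move=> h; split; apply: measurable_of_plateaus => n l r.
all: have n0 : 0 < n.+1%:R :> R by rewrite ltr0n.
all: have [_ ig _] := h _ (bump_schwartz _ _ _ _ n0 (plateau_bump _ l r n0)).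
all: have [m1 m2] := cintegrable_cmeasurable _ _ ig.
- by apply: eq_measurable_fun m1 => x _; rewrite cE /= mulr0 subr0.
- by apply: eq_measurable_fun m2 => x _; rewrite cE /= mulr0 add0r.
Qed.

(** The tempered transform moves the pairing to the frequency side, where the Sobolev multiplier and
    its reciprocal are shared between the two factors. The bound on the norm is strict because the
    norm is an infimum: strictness supplies an actual transform [G]. *)
Lemma sobolev_pairing g phi M l : schwartz phi -> (sobolev_norm (1 + eps) g < M%:E)%E -> 0 < l ->
  ((normc (cint leb (fun x => g x * fourier phi x)))%:E <=
   (l / 2 * M ^+ 2)%:E + ((2 * l)^-1)%:E * eint (fun e => (k e ^+ 2 * normc (phi e) ^+ 2)%R))%E.
Proof.
move=> sphi /ereal_inf_lt[_ [G tG <-] GM] l0.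
have mG := tempered_cmeasurable g G tG; have [_ _ <-] := tG phi sphi.
pose w x : R := (1 + x ^+ 2) `^ ((1 + eps) / 2); pose wG x : R[i] := (w x)%:C * G x.
have mw : measurable_fun setT (w : mR -> R).
  apply: (measurableT_comp (measurable_powR _)).
  by apply: measurable_funD => //; exact: measurable_funX.
have iw : inL2 wG.
  split; first by apply: cmeasurable_mul => //; exact: cmeasurable_real.
  by apply: (lt_trans GM); rewrite ltry.
have nw : nrm wG < M by move: GM; rewrite -/wG L2normE.
have ip : inL2 (fun x => (k x)%:C * phi x).
  apply: (inL2_dom _ _ _ (integrable_normc2_schwartz phi sphi)).
    apply: cmeasurable_mul; [apply: cmeasurable_real; exact: measurable_weight|exact: schwartz_cmeasurable].
  move=> x; rewrite normc_mul normc_real exprMn ler_piMl ?sqr_ge0// expr_le1 ?normr_ge0//.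
  by rewrite ger0_norm ?weight_ge0// weight_le1.
have -> : cint leb (fun e => G e * phi e) = cint leb (fun e => wG e * ((k e)%:C * phi e)).
  apply: eq_cint => e; rewrite /wG; have := weight_sobolev eps e; rewrite -/(w e) => h.
  by rewrite mulrACA -rmorphM mulrC mulrA h mul1r.
have e1 : eint (fun e => k e ^+ 2 * normc (phi e) ^+ 2) = (nsq (fun x => (k x)%:C * phi x))%:E.
  have e2 : (fun e => k e ^+ 2 * normc (phi e) ^+ 2) = (fun e => normc ((k e)%:C * phi e) ^+ 2).
    by apply/funext => e; rewrite normc_mul normc_real exprMn real_normK ?num_real.
  by rewrite e2 eint_integrable//; case/inL2P: ip.
rewrite e1 -EFinM -EFinD lee_fin; apply: (le_trans (normc_cint_mulL2 _ _ iw ip)).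
rewrite -nrm2; have n0 := nrm_ge0 wG; have := nrm_ge0 (fun x => (k x)%:C * phi x).
set a := nrm _ in nw n0 *; set b := nrm _ => b0.
have a2 : a ^+ 2 <= M ^+ 2 by rewrite lerXn2r ?nnegrE ?(ltW nw)// (le_trans n0 (ltW nw)).
have l2 : 0 < 2 * l by rewrite mulr_gt0.
apply: (@le_trans _ _ (l / 2 * a ^+ 2 + (2 * l)^-1 * b ^+ 2)); last first.
  by rewrite lerD2r ler_wpM2l// divr_ge0 ?(ltW l0).
rewrite -subr_ge0 (_ : _ - _ = (2 * l)^-1 * (l * a - b) ^+ 2); first by rewrite mulr_ge0 ?sqr_ge0 ?invr_ge0 ?(ltW l2).
by field; rewrite gt_eqF.
Qed.

Lemma wig_fourier t F H x zeta : schwartz F -> schwartz H ->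
  wig t F H (x, zeta) = fourier (fun e => kern t F H zeta (-1 * e + 0)) x.
Proof.
move=> sF sH; rewrite /wig /ifourier /= /fourier.
rewrite -(cint_reflect 0 _ (cintegrable_wig t F H (x, zeta) sF sH)).
apply: eq_cint => e /=; rewrite sub0r addr0 mulN1r.
by congr (expi _ * _); ring.
Qed.

Lemma wig_sobolev_energy (g : R -> R[i]) t F H M l zeta : schwartz F -> schwartz H ->
  (sobolev_norm (1 + eps) g < M%:E)%E -> 0 < l ->
  ((normc (cint leb (fun x => g x * wig t F H (x, zeta))))%:E <=
   (l / 2 * M ^+ 2)%:E + ((2 * l)^-1)%:E * energy eps F H t zeta)%E.
Proof.
move=> sF sH gM l0; have N1 : (-1 : R) != 0 by rewrite oppr_eq0 oner_eq0.
have sk := schwartz_affine (-1) 0 _ N1 (schwartz_kern t F H zeta sF sH).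
have := sobolev_pairing g _ M l sk gM l0.
rewrite (_ : (fun x => g x * fourier _ x) = fun x => g x * wig t F H (x, zeta)); last first.
  by apply/funext => x; rewrite (wig_fourier t F H x zeta sF sH).
rewrite (_ : eint _ = energy eps F H t zeta)//.
have pk : nonneg_measurable (fun e => k e ^+ 2 * normc (kern t F H zeta e) ^+ 2).
  split; last by move=> y; rewrite mulr_ge0// sqr_ge0.
  exact: (measurableT_comp (measurable_kern2 eps F H t sF sH) (measurable_pair1 zeta)).
rewrite /energy -(eint_reflect _ 0 pk); apply: eq_integral => e _.
by rewrite sub0r mulN1r addr0 weight_even.
Qed.

(** Two representatives of the same symbol: the boundedness of [q] makes the integrals converge
    absolutely, while the slices of [q'] carry the Sobolev bound. They are compared on almost every
    slice, and [averaging] sums the slices. *)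
Lemma wig_pairing_le (q q' : R * R -> R[i]) t F H M : schwartz F -> schwartz H -> 0 <= t <= 1 -> 0 < M ->
  bounded_symbol q -> {ae leb2, forall z, q z = q' z} ->
  cmeasurable (q' : mR * mR -> R[i]) ->
  {ae leb, forall zeta, (sobolev_norm (1 + eps) (fun x => q' (x, zeta)) < M%:E)%E} ->
  normc (cint leb2 (fun z => wig t F H z * q z)) <= averaging_constant eps * M * (nsq F + nsq H).
Proof.
move=> sF sH t01 M0 [mq [K K0 hK]] qq' mq' hM.
have t2 : `|t| <= 2 by move: t01 => /andP[t0 t1]; rewrite ger0_norm// (le_trans t1)// ler1n.
have mW := cmeasurable_wig t F H sF sH; have [B B0 hB] := wig_bound F H sF sH.
have mf : cmeasurable ((fun z => wig t F H z * q z) : mR * mR -> R[i]) by exact: cmeasurable_mul.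
have bf x y : normc (wig t F H (x, y) * q (x, y)) <= (B * K * isq x) * isq y.
  rewrite normc_mul (_ : _ * isq y = B * (isq x * isq y) * K); last by ring.
  by apply: ler_pM; rewrite ?normc_ge0//; exact: hB t (x, y) t2.
have iB : leb.-integrable setT (EFin \o (fun x : R => B * K * isq x)).
  by apply: integrable_scaler; exact: integrable_isq.
have fi : cintegrable leb2 (fun z => wig t F H z * q z).
  by apply: cintegrable2_dom mf iB integrable_isq bf.
have [_ e1] := cint2_fubini _ fi; rewrite e1 (cint2_swap _ fi).
pose J zeta : R := normc (cint leb (fun x => wig t F H (x, zeta) * q (x, zeta))).
have fi' : cintegrable leb2 (fun z => wig t F H (z.2, z.1) * q (z.2, z.1)) := cintegrable_swap _ _ _ fi.
have [iJ _] := cint2_fubini _ fi'.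
have mJ : measurable_fun setT (J : mR -> R).
  by apply: (@measurable_normc _ mR R); exact: (cintegrable_cmeasurable _ _ iJ).
apply: (le_trans (normc_cint_le _ _ iJ)).
have iJ' : leb.-integrable setT (EFin \o J) := integrable_normc _ _ iJ.
rewrite -lee_fin -[X in (X <= _)%E](eint_integrable J iJ').
apply: (averaging eps eps_gt0 eps_lt1 F H J t M sF sH t01 M0).
  by split=> // z; exact: normc_ge0.
have [_ sl] := ae_slices _ qq'.
apply: (ae_imp2 leb _ _ _ sl hM) => zeta qz sz l l0.
have m1 := cmeasurable_slice2 _ zeta mf.
have m2 : cmeasurable ((fun x => q' (x, zeta) * wig t F H (x, zeta)) : mR -> R[i]).
  by apply: cmeasurable_mul; exact: cmeasurable_slice2.
suff -> : J zeta = normc (cint leb (fun x => q' (x, zeta) * wig t F H (x, zeta))).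
  exact: wig_sobolev_energy.
congr normc; apply: (cint_ae_eq _ _ _ m1 m2).
by apply: (ae_imp leb _ _ qz) => x ->; rewrite mulrC.
Qed.
End SobolevPairing.

(** * Interpolation between the operator and its transpose *)

Section WignerPairing.
Context {R : realType}.
Local Notation mR := (measurableTypeR R).
Implicit Types (F H f g : R -> R[i]) (t x M K : R) (p q r w : R * R -> R[i]) (phi psi : R * R -> R) (c : R[i]).

(** Test functions are real-valued, so the kernel enters through the real parts of its complex
    multiples, its imaginary part among them. *)
Inductive wig_class t : (R * R -> R) -> Prop :=
| wig_class_re c F H : schwartz F -> schwartz H -> wig_class t (fun z => cRe (c * wig t F H z))
| wig_class_add phi psi : wig_class t phi -> wig_class t psi -> wig_class t (fun z => phi z + psi z).

Lemma wig_class_smooth t : `|t| <= 2 -> integrable_smooth (wig_class t).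
Proof.
move=> t2; split.
- move=> psi; elim=> {psi} [c F H sF sH|phi psi _ [[p1 P1 d1] [p2 P2 d2]] _ [[q1 Q1 e1] [q2 Q2 e2]]]; last first.
    split.
      by exists (fun z => p1 z + q1 z); [exact: wig_class_add|move=> z; exact: isdD].
    by exists (fun z => p2 z + q2 z); [exact: wig_class_add|move=> z; exact: isdD].
  have [F' sF' dF] := schwartz_deriv F sF; have [H' sH' dH] := schwartz_deriv H sH.
  split.
    exists (fun z => cRe (c * (0 +i* (2 * pi)) * wig t (mx F) H z) + cRe (c * (0 +i* (2 * pi)) * wig t F (mx H) z)).
      by apply: wig_class_add; apply: wig_class_re => //; exact: schwartz_mulx.
    move=> z; have [h _] := cderiv_scale c _ _ _ (cderiv_wig_x t F H z t2 sF sH).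
    by apply: isd_ext h _ _ => //; rewrite -cRe_add mulrDr !mulrA.
  exists (fun z => cRe (c * wig t F' H z) + cRe (- c * wig t F H' z)).
    by apply: wig_class_add; exact: wig_class_re.
  move=> z; have [h _] := cderiv_scale c _ _ _ (cderiv_wig_xi t F H F' H' z t2 sF sH sF' sH' dF dH).
  by apply: isd_ext h _ _ => //; rewrite -cRe_add mulrBr mulNr.
- move=> psi; elim=> {psi} [c F H sF sH|phi psi _ [M M0 hM] _ [N N0 hN]]; last first.
    exists (M + N) => [|z]; first exact: addr_ge0.
    by rewrite mulrDl; apply: (le_trans (ler_normD _ _)); exact: lerD.
  have [M M0 hM] := wig_bound F H sF sH; exists (normc c * M); first by rewrite mulr_ge0 ?normc_ge0.
  move=> z; apply: (le_trans (normc_ge_cRe _)); rewrite normc_mul -mulrA.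
  by apply: ler_wpM2l; [exact: normc_ge0|exact: hM].
- move=> psi; elim=> {psi} [c F H sF sH|phi psi _ h1 _ h2]; last exact: measurable_funD.
  have : cmeasurable ((fun z => c * wig t F H z) : mR * mR -> R[i]).
    by apply: cmeasurable_mul; [exact: cmeasurable_cst|exact: cmeasurable_wig].
  by case.
Qed.

Definition schwartz_like w := cmeasurable (w : mR * mR -> R[i]) /\
  exists2 M : R, 0 <= M & forall z, normc (w z) <= M * (isq z.1 * isq z.2).

Lemma wig_schwartz_like t F H : `|t| <= 2 -> schwartz F -> schwartz H -> schwartz_like (wig t F H).
Proof.
move=> t2 sF sH; split; first exact: cmeasurable_wig.
by have [M M0 hM] := wig_bound F H sF sH; exists M => // z; exact: hM.
Qed.

Lemma schwartz_like_add w w' : schwartz_like w -> schwartz_like w' -> schwartz_like (fun z => w z + w' z).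
Proof.
move=> [mw [M M0 hM]] [mw' [N N0 hN]]; split; first exact: cmeasurable_add.
exists (M + N) => [|z]; first exact: addr_ge0.
by rewrite mulrDl; apply: (le_trans (normc_add _ _)); exact: lerD.
Qed.

Lemma schwartz_like_scale c w : schwartz_like w -> schwartz_like (fun z => c * w z).
Proof.
move=> [mw [M M0 hM]]; split; first by apply: cmeasurable_mul => //; exact: cmeasurable_cst.
exists (normc c * M) => [|z]; first by rewrite mulr_ge0 ?normc_ge0.
by rewrite normc_mul -mulrA; apply: ler_wpM2l; [exact: normc_ge0|exact: hM].
Qed.

Lemma schwartz_like_opp w : schwartz_like w -> schwartz_like (fun z => - w z).
Proof. by move=> /(schwartz_like_scale (-1)); congr schwartz_like; apply/funext => z; rewrite mulN1r. Qed.

Lemma schwartz_like_cintegrable w p : schwartz_like w -> bounded_symbol p ->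
  cintegrable leb2 (fun z => w z * p z).
Proof.
move=> [mw [M M0 hM]] [mp [K K0 hK]].
apply: (cintegrable2_dom _ (fun x : R => M * K * isq x) isq).
- exact: cmeasurable_mul.
- by apply: integrable_scaler; exact: integrable_isq.
- exact: integrable_isq.
move=> x y; rewrite normc_mul (_ : _ * isq y = M * (isq x * isq y) * K); last by ring.
by apply: ler_pM; rewrite ?normc_ge0//; exact: (hM (x, y)).
Qed.

(** The identity [w = Re w + i Re (- i w)] reduces a complex pairing to real functions of the form
    occurring in [wig_class]. *)
Lemma pairing_split w p : schwartz_like w -> bounded_symbol p ->
  cint leb2 (fun z => w z * p z) = cint leb2 (fun z => (cRe (1 * w z))%:C * p z) +
    (0 +i* 1) * cint leb2 (fun z => (cRe ((0 +i* (-1)) * w z))%:C * p z).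
Proof.
move=> hw bp; have re c : cintegrable leb2 (fun z => (cRe (c * w z))%:C * p z).
  apply: (schwartz_like_cintegrable (fun z => (cRe (c * w z))%:C)) => //.
  have [[mw1 mw2] [M M0 hM]] := schwartz_like_scale c w hw; split; first exact: cmeasurable_real.
  exists M => // z; rewrite normc_real; exact: le_trans (normc_ge_cRe _) (hM z).
rewrite -cint_scale; last exact: re.
rewrite -cint_add; [|exact: re|by apply: cintegrable_scale; exact: re].
by apply: eq_cint => z; apply: complex_ext; rewrite !cE /=; ring.
Qed.

Lemma wig_pairing01 t F H F' H' p r : `|t| <= 2 -> schwartz F -> schwartz H -> schwartz F' -> schwartz H' ->
  (forall x, cderiv F x (F' x)) -> (forall x, cderiv H x (H' x)) ->
  bounded_symbol p -> bounded_symbol r ->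
  weak_partial2 p r ->
  cint leb2 (fun z => (wig t F' H z - wig t F H' z) * p z) = - cint leb2 (fun z => wig t F H z * r z).
Proof.
move=> t2 sF sH sF' sH' dF dH bp br pr.
have key c : cint leb2 (fun z => (cRe (c * (wig t F' H z - wig t F H' z)))%:C * p z) =
    - cint leb2 (fun z => (cRe (c * wig t F H z))%:C * r z).
  have := weak_pairing01 _ (wig_class_smooth t t2) p r (fun z => cRe (c * wig t F H z))
    (fun z => cRe (c * wig t F' H z) + cRe (- c * wig t F H' z)) bp br pr.
  rewrite (_ : (fun z => (cRe (c * (_ - _)))%:C * p z) =
    fun z => (cRe (c * wig t F' H z) + cRe (- c * wig t F H' z))%:C * p z); last first.
    by apply/funext => z; rewrite -cRe_add mulrBr mulNr.
  apply; first exact: wig_class_re.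
    by apply: wig_class_add; exact: wig_class_re.
  move=> z; have [h _] := cderiv_scale c _ _ _ (cderiv_wig_xi t F H F' H' z t2 sF sH sF' sH' dF dH).
  by apply: isd_ext h _ _ => //; rewrite -cRe_add mulrBr mulNr.
have l1 := wig_schwartz_like t F' H t2 sF' sH; have l2 := wig_schwartz_like t F H' t2 sF sH'.
have l3 := schwartz_like_add _ _ l1 (schwartz_like_opp _ l2).
rewrite (pairing_split _ p l3 bp) (pairing_split _ r (wig_schwartz_like t F H t2 sF sH) br).
by rewrite !key mulrN opprD.
Qed.

Definition wig_dt t F H F' H' z : R[i] :=
  wig t (mx F') H z + wig t F' (mx H) z - (wig t (mx F) H' z + wig t F (mx H') z).

Lemma wig_dt_schwartz_like t F H F' H' : `|t| <= 2 -> schwartz F -> schwartz H -> schwartz F' -> schwartz H' ->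
  schwartz_like (wig_dt t F H F' H').
Proof.
move=> t2 sF sH sF' sH'; apply: schwartz_like_add; last apply: schwartz_like_opp;
  by apply: schwartz_like_add; apply: wig_schwartz_like => //; exact: schwartz_mulx.
Qed.

Lemma wig_pairing11 t F H F' H' p q : `|t| <= 2 -> schwartz F -> schwartz H -> schwartz F' -> schwartz H' ->
  (forall x, cderiv F x (F' x)) -> (forall x, cderiv H x (H' x)) ->
  bounded_symbol p -> bounded_symbol q ->
  weak_partial12 p q ->
  (0 +i* (2 * pi)) * cint leb2 (fun z => wig_dt t F H F' H' z * p z) =
  cint leb2 (fun z => wig t F H z * q z).
Proof.
move=> t2 sF sH sF' sH' dF dH bp bq pq; set I2 : R[i] := 0 +i* (2 * pi).
have sxF := schwartz_mulx F sF; have sxH := schwartz_mulx H sH.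
have sxF' := schwartz_mulx F' sF'; have sxH' := schwartz_mulx H' sH'.
have key c : cint leb2 (fun z => (cRe (c * (I2 * wig_dt t F H F' H' z)))%:C * p z) =
    cint leb2 (fun z => (cRe (c * wig t F H z))%:C * q z).
  pose psi12 z : R := (cRe (c * I2 * wig t (mx F') H z) + cRe (c * I2 * wig t F' (mx H) z)) +
    (cRe (- c * I2 * wig t (mx F) H' z) + cRe (- c * I2 * wig t F (mx H') z)).
  have e12 z : psi12 z = cRe (c * (I2 * wig_dt t F H F' H' z)).
    by rewrite /psi12 -!cRe_add /wig_dt; congr cRe; ring.
  have := weak_pairing11 _ (wig_class_smooth t t2) p q (fun z => cRe (c * wig t F H z))
    (fun z => cRe (c * wig t F' H z) + cRe (- c * wig t F H' z)) psi12 bp bq pq.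
  rewrite (_ : (fun z => (cRe (c * (I2 * _)))%:C * p z) = fun z => (psi12 z)%:C * p z); last first.
    by apply/funext => z; rewrite e12.
  apply.
  - exact: wig_class_re.
  - by apply: wig_class_add; exact: wig_class_re.
  - by apply: wig_class_add; apply: wig_class_add; exact: wig_class_re.
  - move=> z; have [h _] := cderiv_scale c _ _ _ (cderiv_wig_xi t F H F' H' z t2 sF sH sF' sH' dF dH).
    by apply: isd_ext h _ _ => //; rewrite -cRe_add mulrBr mulNr.
  - move=> z; have [h1 _] := cderiv_scale c _ _ _ (cderiv_wig_x t F' H z t2 sF' sH).
    have [h2 _] := cderiv_scale (- c) _ _ _ (cderiv_wig_x t F H' z t2 sF sH').
    apply: isd_ext (isdD _ _ _ _ _ h1 h2) _ _ => //.
    by rewrite /psi12 -!cRe_add /I2; congr cRe; ring.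
have l1 := wig_dt_schwartz_like t F H F' H' t2 sF sH sF' sH'.
rewrite -cint_scale; last exact: schwartz_like_cintegrable.
rewrite (_ : (fun z => I2 * _) = fun z => (I2 * wig_dt t F H F' H' z) * p z); last first.
  by apply/funext => z; rewrite mulrA.
rewrite (pairing_split _ p (schwartz_like_scale I2 _ l1) bp).
by rewrite (pairing_split _ q (wig_schwartz_like t F H t2 sF sH) bq) !key.
Qed.

Lemma cderiv_wig_pairing t F H F' H' p : `|t| < 2 -> schwartz F -> schwartz H -> schwartz F' -> schwartz H' ->
  (forall x, cderiv F x (F' x)) -> (forall x, cderiv H x (H' x)) -> bounded_symbol p ->
  cderiv (fun t => cint leb2 (fun z => wig t F H z * p z)) t
    (cint leb2 (fun z => wig_dt t F H F' H' z * p z)).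
Proof.
move=> t2 sF sH sF' sH' dF dH bp; have [mp [K K0 hK]] := bp.
have sxF := schwartz_mulx F sF; have sxH := schwartz_mulx H sH.
have sxF' := schwartz_mulx F' sF'; have sxH' := schwartz_mulx H' sH'.
have [M1 M10 hM1] := wig_bound _ _ sxF' sH; have [M2 M20 hM2] := wig_bound _ _ sF' sxH.
have [M3 M30 hM3] := wig_bound _ _ sxF sH'; have [M4 M40 hM4] := wig_bound _ _ sF sxH'.
have tI (s : R) : s \in `]-2, 2[ -> `|s| < 2 by rewrite in_itv/= -ltr_norml.
apply: (cderiv_cint leb2 (fun t z => wig t F H z * p z) (fun t z => wig_dt t F H F' H' z * p z)
  (fun z : R * R => (M1 + M2 + (M3 + M4)) * K * (isq z.1 * isq z.2)) t (-2) 2).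
- by rewrite in_itv/= -ltr_norml.
- by move=> s /tI /ltW s2; apply: schwartz_like_cintegrable => //; exact: wig_schwartz_like.
- move=> s z /tI s2; have h := cderiv_wig_t s F H F' H' z s2 sF sH sF' sH' dF dH.
  apply: cderiv_ext (cderiv_mul _ _ _ _ _ h (cderiv_cst (p z) s)) _ _ => //.
  by rewrite mulr0 addr0.
- apply: integrable_scaler.
  by apply: (integrable_tensor (@lebesgue_measure R) (@lebesgue_measure R) isq isq); exact: integrable_isq.
- move=> s z /tI /ltW s2; rewrite normc_mul mulrAC.
  apply: ler_pM; rewrite ?normc_ge0// !mulrDl.
  apply: (le_trans (normc_add _ _)); rewrite normc_opp.
  by apply: lerD; apply: (le_trans (normc_add _ _)); apply: lerD; [exact: hM1|exact: hM2|exact: hM3|exact: hM4].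
Qed.

Lemma cderiv_mean_value (f f' : R -> R[i]) M : (forall t, 0 <= t <= 1 -> cderiv f t (f' t)) ->
  (forall t, 0 <= t <= 1 -> normc (f' t) <= M) -> normc (f 1 - f 0) <= 2 * M.
Proof.
move=> df fM; have mvt (u u' : R -> R) : (forall t, 0 <= t <= 1 -> is_derive t (1 : R) u (u' t)) ->
    (forall t, 0 <= t <= 1 -> `|u' t| <= M) -> `|u 1 - u 0| <= M.
  move=> du uM; have [||t + ->] := @MVT_segment _ u u' 0 1 ler01.
  - by move=> t; rewrite in_itv/= => /andP[t0 t1]; apply: du; rewrite !ltW.
  - apply: derivable_within_continuous => t; rewrite in_itv/= => t01.
    by case: (du t t01).
  by rewrite in_itv/= subr0 mulr1 => t01; exact: uM.
apply: (le_trans (normc_le_sum _)); rewrite !cE mulr_natl mulr2n lerD//.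
  apply: (mvt (fun t => cRe (f t)) (fun t => cRe (f' t))) => t t01; first by case: (df t t01).
  exact: le_trans (normc_ge_cRe _) (fM t t01).
apply: (mvt (fun t => cIm (f t)) (fun t => cIm (f' t))) => t t01; first by case: (df t t01).
exact: le_trans (normc_ge_cIm _) (fM t t01).
Qed.

Lemma wig_pairing_difference F H p q q' (eps M : R) : 0 < eps -> eps < 1 -> schwartz F -> schwartz H -> 0 < M ->
  bounded_symbol p -> bounded_symbol q ->
  weak_partial12 p q ->
  {ae leb2, forall z, q z = q' z} -> cmeasurable (q' : mR * mR -> R[i]) ->
  {ae leb, forall zeta, (sobolev_norm (1 + eps) (fun x => q' (x, zeta)) < M%:E)%E} ->
  normc (cint leb2 (fun z => wig 1 F H z * p z) - cint leb2 (fun z => wig 0 F H z * p z)) <=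
  averaging_constant eps * M * (nsq F + nsq H).
Proof.
move=> e0 e1 sF sH M0 bp bq pq qq' mq' hM.
have [F' sF' dF] := schwartz_deriv F sF; have [H' sH' dH] := schwartz_deriv H sH.
set K := _ * _; have p2 : (2 : R) <= 2 * pi by have := @pi_ge2 R; lra.
(* The derivative in [t] carries a factor [1 / (2 pi)], at most one half, which absorbs the factor 2
   of the mean value inequality for complex-valued functions. *)
rewrite (_ : K = 2 * (K / 2)); last by field.
apply: (cderiv_mean_value (fun t => cint leb2 (fun z => wig t F H z * p z))
  (fun t => cint leb2 (fun z => wig_dt t F H F' H' z * p z))) => t /andP[t0 t1].
  by apply: cderiv_wig_pairing => //; rewrite ger0_norm// (le_lt_trans t1)// ltr1n.
have t2 : `|t| <= 2 by rewrite ger0_norm// (le_trans t1)// ler1n.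
have t01 : 0 <= t <= 1 by rewrite t0.
have := wig_pairing_le eps e0 e1 q q' t F H M sF sH t01 M0 bq qq' mq' hM.
rewrite -(wig_pairing11 t F H F' H' p q t2 sF sH sF' sH' dF dH bp bq pq) normc_mul normc_imc.
rewrite ger0_norm; last by apply: le_trans p2.
have n0 := normc_ge0 (cint leb2 (fun z => wig_dt t F H F' H' z * p z)).
by rewrite -/K => h; rewrite ler_pdivlMr// mulrC; apply: le_trans h; exact: ler_wpM2r.
Qed.

End WignerPairing.

(** * Operators with bounded symbols *)

Section BoundedSymbols.
Context {R : realType}.
Local Notation mR := (measurableTypeR R).
Implicit Types (F H f g : R -> R[i]) (t x M K : R) (p q r : R * R -> R[i]) (z : R * R).

(** The operator as a function of the transform [F] of its argument, so that [F] can be replaced by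
    its derivative. *)
Definition opw p F x : R[i] := cint leb (fun xi => expi (2 * pi * x * xi) * p (x, xi) * F xi).

Lemma cintegrable_opw p F x : bounded_symbol p -> schwartz F ->
  cintegrable leb (fun xi => expi (2 * pi * x * xi) * p (x, xi) * F xi).
Proof.
move=> [mp [K K0 hK]] sF.
have sF1 := cintegrable_expi (2 * pi * x) F (schwartz_cintegrable F sF).
have := cintegrable_boundedM leb (fun xi : R => p (x, xi)) _ K (cmeasurable_slice _ x mp) sF1 (fun xi => hK (x, xi)).
by congr cintegrable; apply/funext => xi; rewrite mulrCA mulrA.
Qed.

Lemma opw_bound p F : bounded_symbol p -> schwartz F ->
  exists2 B : R, 0 <= B & forall x, normc (opw p F x) <= B.
Proof.
move=> bp sF; have [mp [K K0 hK]] := bp.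
exists (K * \int[leb]_xi normc (F xi)).
  by rewrite mulr_ge0//; apply: Rintegral_ge0 => xi _; exact: normc_ge0.
move=> x; rewrite -RintegralZl//; last exact: integrable_normc_schwartz.
apply: normc_cint_le_dom.
- exact: cintegrable_cmeasurable (cintegrable_opw p F x bp sF).
- by apply: integrable_scaler; exact: integrable_normc_schwartz.
- by move=> xi; rewrite !normc_mul normc_expi mul1r; apply: ler_wpM2r; rewrite ?normc_ge0.
Qed.

Lemma cmeasurable_opw p F : cmeasurable (p : mR * mR -> R[i]) -> schwartz F -> cmeasurable (opw p F : mR -> R[i]).
Proof.
move=> mp sF; apply: (cmeasurable_cint_param (@lebesgue_measure R)
  (fun z : mR * mR => expi (2 * pi * z.1 * z.2) * p z * F z.2)).
apply: cmeasurable_mul; last first.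
  by apply: cmeasurable_comp; [exact: schwartz_cmeasurable|exact: measurable_snd].
have := cmeasurable_mul _ _ (cmeasurable_expiT (fun z : mR * mR => 2 * pi * z.1 * z.2) _) mp.
apply; apply: measurable_funM; last exact: measurable_snd.
by apply: measurable_funM => //; exact: measurable_fst.
Qed.

Lemma cintegrable_opw_mul p F g : bounded_symbol p -> schwartz F -> schwartz g ->
  cintegrable leb (fun x => opw p F x * g x).
Proof.
move=> bp sF sg; have [B B0 hB] := opw_bound p F bp sF.
exact: (cintegrable_boundedM _ _ _ B (cmeasurable_opw p F bp.1 sF) (schwartz_cintegrable g sg) hB).
Qed.

Section Inversion.
Variables (c : R) (c_gt0 : 0 < c).
Hypothesis inversion : forall f x, schwartz f -> ifourier (fourier f) x = c%:C * f x.

Lemma cintegrable_ifourier F x : schwartz F -> cintegrable leb (fun e => expi (2 * pi * x * e) * F e).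
Proof. by move=> sF; apply: cintegrable_expi; exact: schwartz_cintegrable. Qed.

Lemma ifourier_shift F x s : schwartz F ->
  cint leb (fun e => expi (2 * pi * x * e) * F (e + s)) = expi (- (2 * pi * x * s)) * ifourier F x.
Proof.
move=> sF; have i1 := cintegrable_ifourier F x sF.
rewrite /ifourier -(cint_shift s _ i1) -cint_scale; last first.
  have := cintegrable_affine 1 s _ (oner_neq0 _) i1.
  by congr cintegrable; apply/funext => e; rewrite mul1r.
apply: eq_cint => e; rewrite mulrA; congr (_ * _); rewrite -expiD; congr expi; ring.
Qed.

(** At [t = 0] the factor [F] no longer depends on [eta], and inversion evaluates the integral of
    the other one. *)
Lemma wig0 F g z : schwartz F -> schwartz g ->
  wig 0 F (fourier g) z = c%:C * (expi (2 * pi * z.1 * z.2) * F z.2 * g z.1).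
Proof.
move=> sF sg; have sH := schwartz_fourier g sg.
have := ifourier_shift (fourier g) z.1 (- z.2) sH; rewrite mulrN opprK inversion// => h.
transitivity (F z.2 * cint leb (fun e => expi (2 * pi * z.1 * e) * fourier g (e - z.2))).
  rewrite -cint_scale.
    apply: eq_cint => e; rewrite /kern mul0r add0r subr0 mul1r; ring.
  have := cintegrable_ifourier _ z.1 (schwartz_affine 1 (- z.2) _ (oner_neq0 _) sH).
  by congr cintegrable; apply/funext => e; rewrite mul1r.
by rewrite h; ring.
Qed.

Lemma wig1 f H z : schwartz f -> schwartz H ->
  wig 1 (fourier f) H z = c%:C * (expi (- (2 * pi * z.1 * z.2)) * H (- z.2) * f z.1).
Proof.
move=> sf sH; have sF := schwartz_fourier f sf.
have := ifourier_shift (fourier f) z.1 z.2 sF; rewrite inversion// => h.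
transitivity (H (- z.2) * cint leb (fun e => expi (2 * pi * z.1 * e) * fourier f (e + z.2))).
  rewrite -cint_scale.
    apply: eq_cint => e; rewrite /kern subrr mul0r add0r mul1r; ring.
  have := cintegrable_ifourier _ z.1 (schwartz_affine 1 z.2 _ (oner_neq0 _) sF).
  by congr cintegrable; apply/funext => e; rewrite mul1r.
by rewrite h; ring.
Qed.

Let norm0 : `|0 : R| <= 2.
Proof. by rewrite normr0. Qed.

Let norm1 : `|1 : R| <= 2.
Proof. by rewrite normr1 ler1n. Qed.

Lemma pairing0 p F g : bounded_symbol p -> schwartz F -> schwartz g ->
  cint leb2 (fun z => wig 0 F (fourier g) z * p z) = c%:C * cint leb (fun x => opw p F x * g x).
Proof.
move=> bp sF sg; have sH := schwartz_fourier g sg.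
have [_ ->] := cint2_fubini _ (schwartz_like_cintegrable _ _ (wig_schwartz_like 0 F _ norm0 sF sH) bp).
rewrite -cint_scale; last exact: cintegrable_opw_mul.
apply: eq_cint => x; transitivity ((c%:C * g x) * opw p F x); last by ring.
rewrite /opw -cint_scale; last exact: cintegrable_opw.
by apply: eq_cint => xi; rewrite wig0//=; ring.
Qed.

(** At [t = 1] the frequency enters [H] with a minus sign; the reflection [xi -> - xi] and the
    evenness of [p] restore the operator. *)
Lemma pairing1 p f H : bounded_symbol p -> (forall x xi, p (x, - xi) = p (x, xi)) ->
  schwartz f -> schwartz H ->
  cint leb2 (fun z => wig 1 (fourier f) H z * p z) = c%:C * cint leb (fun x => f x * opw p H x).
Proof.
move=> bp pe sf sH; have sF := schwartz_fourier f sf.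
have [_ ->] := cint2_fubini _ (schwartz_like_cintegrable _ _ (wig_schwartz_like 1 _ H norm1 sF sH) bp).
rewrite -cint_scale; last first.
  by have := cintegrable_opw_mul p H f bp sH sf; congr cintegrable; apply/funext => x; rewrite mulrC.
apply: eq_cint => x; transitivity ((c%:C * f x) * opw p H x); last by ring.
have io := cintegrable_opw p H x bp sH.
rewrite /opw -(cint_reflect 0 _ io) -cint_scale.
  by apply: eq_cint => xi; rewrite wig1//= sub0r pe mulrN; ring.
have N1 : (-1 : R) != 0 by rewrite oppr_eq0 oner_eq0.
have := cintegrable_affine (-1) 0 _ N1 io.
by congr cintegrable; apply/funext => xi; rewrite mulN1r addr0 sub0r.
Qed.

(** The weak derivative in [xi] is tested against the kernel for [t = 0], whose own derivative in
    [xi] involves those of [F] and of [fourier g]. In the application [gd] is [- 2 pi i x g]. *)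
Lemma opw_weak_derivative p r F F' g gd : bounded_symbol p -> bounded_symbol r ->
  weak_partial2 p r ->
  schwartz F -> schwartz F' -> schwartz g -> schwartz gd -> (forall xi, cderiv F xi (F' xi)) ->
  (forall xi, cderiv (fourier g) xi (fourier gd xi)) ->
  cint leb (fun x => opw p F' x * g x - opw p F x * gd x + opw r F x * g x) = 0.
Proof.
move=> bp br pr sF sF' sg sgd dF dg; have sH := schwartz_fourier g sg; have sH' := schwartz_fourier gd sgd.
have := wig_pairing01 0 F (fourier g) F' (fourier gd) p r norm0 sF sH sF' sH' dF dg bp br pr.
have i1 := schwartz_like_cintegrable _ _ (wig_schwartz_like 0 F' _ norm0 sF' sH) bp.
have i2 := schwartz_like_cintegrable _ _ (wig_schwartz_like 0 F _ norm0 sF sH') bp.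
have e1 := pairing0 p F' g bp sF' sg; have e2 := pairing0 p F gd bp sF sgd; have e3 := pairing0 r F g br sF sg.
have ck : (c^-1)%:C * c%:C = 1 :> R[i] by rewrite -rmorphM mulVf ?gt_eqF.
have cancel (a b d u v w : R[i]) : a - b = - d -> a = c%:C * u -> b = c%:C * v -> d = c%:C * w -> u - v = - w.
  move=> h ha hb hd; move: h; rewrite ha hb hd -mulrBr -mulrN => /(congr1 (fun y => (c^-1)%:C * y)).
  by rewrite !mulrA ck !mul1r.
have j1 := cintegrable_opw_mul p F' g bp sF' sg; have j2 := cintegrable_opw_mul p F gd bp sF sgd.
have j3 := cintegrable_opw_mul r F g br sF sg.
rewrite (cint_add _ _ _ (cintegrable_add _ _ _ j1 (cintegrable_opp _ _ j2)) j3) (cint_sub _ _ _ j1 j2).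
move=> h; apply/eqP; rewrite addr_eq0; apply/eqP; apply: (cancel _ _ _ _ _ _ _ e1 e2 e3); rewrite -h -(cint_sub _ _ _ i1 i2).
by apply: eq_cint => z; rewrite mulrBl.
Qed.

(* Integrating by parts in the frequency variable bounds x Op(p) f(x), so that Op(p) f(x) decays like 1/|x|. *)
Lemma Op_inL2 p r f : bounded_symbol p -> bounded_symbol r ->
  weak_partial2 p r ->
  schwartz f -> inL2 (Op p f).
Proof.
move=> bp br pr sf; pose dual g x := (0 +i* (- (2 * pi))) * (x%:C * g x) : R[i].
have sdual g : schwartz g -> schwartz (dual g).
  by move=> sg; apply: schwartz_scale; exact: schwartz_mulx.
set F := fourier f; set F' := fourier (dual f).
have sF : schwartz F by exact: schwartz_fourier.
have sF' : schwartz F' by apply: schwartz_fourier; exact: sdual.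
have dF xi : cderiv F xi (F' xi) := cderiv_fourier f xi sf.
rewrite -[Op p f]/(opw p F); clearbody F F'.
(* Formally [V x] is the integral in [xi] of the derivative of [expi (2 pi x xi) p F], hence zero;
   weakly, this holds against every Schwartz [g]. *)
pose V x : R[i] := opw p F' x + (0 +i* (2 * pi * x)) * opw p F x + opw r F x.
have arith (a b d u : R[i]) x : (a + (0 +i* (2 * pi * x)) * b + d) * u =
    (a * u - b * ((0 +i* (- (2 * pi))) * (x%:C * u))) + d * u.
  by apply: complex_ext; rewrite !cE /=; ring.
have V0 g : schwartz g -> cint leb (fun x => V x * g x) = 0.
  move=> sg; have sd := sdual g sg.
  rewrite -[RHS](opw_weak_derivative p r F F' g (dual g) bp br pr sF sF' sg sd dF
    (fun xi => cderiv_fourier g xi sg)).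
  by apply: eq_cint => x; exact: arith.
have mo := cmeasurable_opw p F bp.1 sF; have mo' := cmeasurable_opw p F' bp.1 sF'; have mor := cmeasurable_opw r F br.1 sF.
have mV : cmeasurable (V : mR -> R[i]).
  apply: cmeasurable_add => //; apply: cmeasurable_add => //; apply: cmeasurable_mul => //.
  by split => /=; [exact: measurable_cst|exact: measurable_funM].
have [A A0 hA] := opw_bound p F' bp sF'; have [B B0 hB] := opw_bound p F bp sF.
have [D D0 hD] := opw_bound r F br sF.
have p0 : 0 <= pi :> R by exact: pi_ge0.
have bV x : normc (V x) <= A + 2 * pi * `|x| * B + D.
  apply: (le_trans (normc_add _ _)); apply: lerD => //; apply: (le_trans (normc_add _ _)); apply: lerD => //.
  rewrite normc_mul normc_imc normrM [`|2 * pi|]ger0_norm ?mulr_ge0//.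
  by apply: ler_wpM2l => //; rewrite !mulr_ge0.
have zero (u : R -> R) : measurable_fun setT (u : mR -> R) -> (forall x, `|u x| <= normc (V x)) ->
    (forall k l s, \int[leb]_x (u x * plateau k.+1%:R l s x) = 0) -> {ae leb, forall x, u x = 0}.
  move=> mu uV u0; apply: zero_of_plateaus => // M.
  (* On the window of radius [M] the linear bound on [V] is at most [E * isq x]. *)
  pose E := (A + 2 * pi * `|M| * B + D) * (1 + M ^+ 2).
  have S0 : 0 <= A + 2 * pi * `|M| * B + D by rewrite !addr_ge0 ?mulr_ge0.
  have E0 : 0 <= E by apply: mulr_ge0 => //; exact: onePsqr_ge0.
  apply: le_integrable (integrable_cisq E) => //.
    by apply/measurable_EFinP; apply: measurable_funM => //; exact: measurable_ind.
  move=> x _ /=; rewrite lee_fin normrM [`|E * _|](ger0_norm (mulr_ge0 E0 (isq_ge0 x))).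
  rewrite /ind; case: ifP => [h|_]; last first.
    by rewrite normr0 mulr0 !mulr_ge0 ?isq_ge0 ?onePsqr_ge0.
  have xM : `|x| <= `|M| by rewrite (le_trans _ (ler_norm M))// ltW// ltr_norml.
  rewrite normr1 mulr1 (le_trans (uV x))// (le_trans (bV x))//.
  apply: (@le_trans _ _ (A + 2 * pi * `|M| * B + D)).
    by rewrite lerD2r lerD2l ler_wpM2r// ler_wpM2l// mulr_ge0.
  rewrite /E -(mulrA _ (1 + M ^+ 2)) ler_peMr// /isq ler_pdivlMr ?onePsqr_gt0// mul1r lerD2l.
  by rewrite -(real_normK (num_real x)) -(real_normK (num_real M)) lerXn2r ?nnegrE.
have V0ae : {ae leb, forall x, V x = 0}.
  have pl k l s : cintegrable leb (fun x => V x * (plateau k.+1%:R l s x)%:C) /\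
      cint leb (fun x => V x * (plateau k.+1%:R l s x)%:C) = 0.
    have k0 : 0 < k.+1%:R :> R by rewrite ltr0n.
    have sp := bump_schwartz _ _ _ _ k0 (plateau_bump _ l s k0); split; last exact: V0.
    apply: (cintegrable_dom leb _ (fun x : R => normc ((A + D)%:C * (plateau k.+1%:R l s x)%:C) +
       normc ((2 * pi * B)%:C * (x%:C * (plateau k.+1%:R l s x)%:C)))).
    - by apply: cmeasurable_mul => //; exact: schwartz_cmeasurable.
    - apply: (@integrableD _ _ _ leb _ measurableT (EFin \o _) (EFin \o _)); apply: integrable_normc_schwartz.
        exact: schwartz_scale.
      by apply: schwartz_scale; exact: schwartz_mulx.
    - move=> x; rewrite !normc_mul !normc_real mulrA -mulrDl ler_wpM2r//.
      have w0 : 0 <= 2 * pi * B by rewrite !mulr_ge0.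
      apply: (le_trans (bV x)); rewrite (ger0_norm (addr_ge0 A0 D0)) (ger0_norm w0).
      by rewrite le_eqVlt; apply/orP; left; apply/eqP; ring.
  have [m1 m2] := mV.
  have z1 : {ae leb, forall x, cRe (V x) = 0}.
    apply: zero => // [x|k l s]; first exact: normc_ge_cRe.
    have [_ /(congr1 (fun y => cRe y))] := pl k l s; rewrite /= => h.
    by rewrite -[RHS]h; apply: eq_Rintegral => x _; rewrite mulr0 subr0.
  have z2 : {ae leb, forall x, cIm (V x) = 0}.
    apply: zero => // [x|k l s]; first exact: normc_ge_cIm.
    have [_ /(congr1 (fun y => cIm y))] := pl k l s; rewrite /= => h.
    by rewrite -[RHS]h; apply: eq_Rintegral => x _; rewrite mulr0 add0r.
  by apply: (ae_imp2 leb _ _ _ z1 z2) => x e1 e2; apply: complex_ext.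
have solve (a b d : R[i]) : a + b + d = 0 -> b = - (a + d).
  move=> h; rewrite -[LHS](addrK (a + d)) (_ : b + (a + d) = a + b + d); last by ring.
  by rewrite h sub0r.
(* The bounds [A + D] on [|x|] times the operator and [B] on the operator itself are squared and
   added, which gives [1 + x ^ 2] on the left. *)
pose N := (A + D) ^+ 2 + B ^+ 2.
have oN : {ae leb, forall x, normc (opw p F x) ^+ 2 <= N * isq x}.
  apply: (ae_imp leb _ _ V0ae) => x Vx.
  have e : (0 +i* (2 * pi * x)) * opw p F x = - (opw p F' x + opw r F x).
    exact: solve Vx.
  have h1 : `|x| * normc (opw p F x) <= A + D.
    apply: (@le_trans _ _ (normc ((0 +i* (2 * pi * x)) * opw p F x))).
      rewrite normc_mul normc_imc normrM ler_wpM2r ?normc_ge0// ler_peMl//.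
      by have := @pi_ge2 R; rewrite ger0_norm ?mulr_ge0//; lra.
    by rewrite e normc_opp; apply: (le_trans (normc_add _ _)); exact: lerD.
  rewrite /isq ler_pdivlMr ?onePsqr_gt0// mulrDr mulr1 [leRHS]addrC; apply: lerD.
    by rewrite lerXn2r ?nnegrE ?normc_ge0.
  rewrite -(real_normK (num_real x)) mulrC -exprMn lerXn2r ?nnegrE ?addr_ge0//.
  by rewrite mulr_ge0 ?normc_ge0.
apply/inL2P; split=> //; apply/integrableP; split.
  by apply/measurable_EFinP; exact: measurable_normc2.
have /integrableP[_] := integrable_cisq N.
apply: le_lt_trans; apply: ae_ge0_le_integral => //.
- by apply: measurableT_comp => //; apply/measurable_EFinP; exact: measurable_normc2.
- by apply: measurableT_comp => //; apply/measurable_EFinP; apply: measurable_funM => //; exact: measurable_isq.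
- apply: (ae_imp leb _ _ oN) => x h _ /=; rewrite lee_fin ger0_norm ?sqr_ge0//.
  by apply: (le_trans h); exact: ler_norm.
Qed.

Definition skew_form p f g : R[i] :=
  cint leb (fun x => Op p f x * g x) - cint leb (fun x => f x * Op p g x).

Hypothesis plancherel : forall f, schwartz f -> nsq (fourier f) = c * nsq f.

Lemma skew_form_le p q q' (eps M : R) f g : 0 < eps -> eps < 1 -> 0 < M ->
  bounded_symbol p -> (forall x xi, p (x, - xi) = p (x, xi)) -> bounded_symbol q ->
  weak_partial12 p q ->
  {ae leb2, forall z, q z = q' z} -> cmeasurable (q' : mR * mR -> R[i]) ->
  {ae leb, forall zeta, (sobolev_norm (1 + eps) (fun x => q' (x, zeta)) < M%:E)%E} ->
  schwartz f -> schwartz g ->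
  normc (skew_form p f g) <= averaging_constant eps * M * (nsq f + nsq g).
(* The pairings at both ends and, by Plancherel, the squared norms all carry the same inversion
   constant [c], which cancels. *)
Proof.
move=> e0 e1 M0 bp pe bq pq qq' mq' hM sf sg.
have sF := schwartz_fourier f sf; have sH := schwartz_fourier g sg.
have h := wig_pairing_difference _ _ p q q' eps M e0 e1 sF sH M0 bp bq pq qq' mq' hM.
have a0 := pairing0 p _ g bp sF sg; have a1 := pairing1 p f _ bp pe sf sH.
have cancel (a b x y : R[i]) (K n m u v : R) : normc (b - a) <= K * (n + m) ->
    a = c%:C * x -> b = c%:C * y -> n = c * u -> m = c * v -> normc (x - y) <= K * (u + v).
  move=> k ha hb hn hm; move: k; rewrite ha hb hn hm -mulrBr normc_mul normc_real gtr0_norm//.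
  by rewrite -mulrDr mulrCA ler_pM2l// -normc_opp opprB.
exact: cancel h a0 a1 (plancherel f sf) (plancherel g sg).
Qed.

End Inversion.

Lemma Op_linear p f g a x : bounded_symbol p -> schwartz f -> schwartz g ->
  Op p (fun x => a * f x + g x) x = a * Op p f x + Op p g x.
Proof.
move=> bp sf sg; have i1 := cintegrable_opw p _ x bp (schwartz_fourier f sf).
have i2 := cintegrable_opw p _ x bp (schwartz_fourier g sg).
rewrite /Op -(cint_scale leb _ _ i1) -cint_add//; last exact: cintegrable_scale.
apply: eq_cint => xi; rewrite (fourier_add _ _ (schwartz_scale a f sf) sg) (fourier_scale a f sf).
ring.
Qed.

Lemma skew_form_linearl p a f f' g : bounded_symbol p -> schwartz f -> schwartz f' -> schwartz g ->
  skew_form p (fun x => a * f x + f' x) g = a * skew_form p f g + skew_form p f' g.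
Proof.
move=> bp sf sf' sg; have sF := schwartz_fourier f sf; have sF' := schwartz_fourier f' sf'.
have sG := schwartz_fourier g sg.
have i1 := cintegrable_opw_mul p _ g bp sF sg; have i2 := cintegrable_opw_mul p _ g bp sF' sg.
have sw (h : R -> R[i]) : schwartz h -> cintegrable leb (fun x => h x * Op p g x).
  by move=> sh; have := cintegrable_opw_mul p _ h bp sG sh; congr cintegrable; apply/funext => x; rewrite mulrC.
have j1 := sw f sf; have j2 := sw f' sf'.
have e1 : cint leb (fun x => Op p (fun x => a * f x + f' x) x * g x) =
    a * cint leb (fun x => Op p f x * g x) + cint leb (fun x => Op p f' x * g x).
  rewrite -(cint_scale leb _ a i1) -(cint_add _ _ _ (cintegrable_scale _ _ a i1) i2).
  by apply: eq_cint => x; rewrite (Op_linear p f f' a x bp sf sf') mulrDl mulrA.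
have e2 : cint leb (fun x => (a * f x + f' x) * Op p g x) =
    a * cint leb (fun x => f x * Op p g x) + cint leb (fun x => f' x * Op p g x).
  rewrite -(cint_scale leb _ a j1) -(cint_add _ _ _ (cintegrable_scale _ _ a j1) j2).
  by apply: eq_cint => x; rewrite mulrDl mulrA.
have alg (u v a1 b1 a2 b2 : R[i]) : u = a * a1 + b1 -> v = a * a2 + b2 -> u - v = a * (a1 - a2) + (b1 - b2).
  by move=> -> ->; ring.
exact: (alg _ _ _ _ _ _ e1 e2).
Qed.

Lemma skew_form_linearr p a f g g' : bounded_symbol p -> schwartz f -> schwartz g -> schwartz g' ->
  skew_form p f (fun x => a * g x + g' x) = a * skew_form p f g + skew_form p f g'.
Proof.
have sym h k : skew_form p h k = - skew_form p k h.
  by rewrite /skew_form opprB; congr (_ - _); apply: eq_cint => x; rewrite mulrC.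
by move=> bp sf sg sg'; rewrite sym (skew_form_linearl p a g g' f bp sg sg' sf) opprD -mulrN -!sym.
Qed.

(** The symmetry under which a bound by a sum of squared norms can be optimised into a product. *)
Lemma skew_form_scale p f g (s : R) : bounded_symbol p -> schwartz f -> schwartz g -> 0 < s ->
  skew_form p (fun x => s%:C * f x) (fun x => (s^-1)%:C * g x) = skew_form p f g.
Proof.
move=> bp sf sg s0; have z0 := @schwartz0 R; have z (h : R -> R[i]) a : schwartz h ->
    (fun x => a * h x) = (fun x => a * h x + 0 : R[i]) by move=> _; apply/funext => x; rewrite addr0.
have sz := schwartz_scale s%:C f sf.
have e0 : (fun _ : R => -1 * 0 + 0 : R[i]) = fun=> 0 by apply/funext => x; rewrite mulr0 add0r.
have l0 (h : R -> R[i]) : schwartz h -> skew_form p (fun=> 0) h = 0.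
  by move=> sh; have := skew_form_linearl p (-1) _ _ h bp z0 z0 sh; rewrite e0 mulN1r addNr.
have r0 (h : R -> R[i]) : schwartz h -> skew_form p h (fun=> 0) = 0.
  by move=> sh; have := skew_form_linearr p (-1) h _ _ bp sh z0 z0; rewrite e0 mulN1r addNr.
rewrite (z g _ sg) (skew_form_linearr p _ _ g _ bp sz sg z0) (r0 _ sz) addr0.
rewrite (z f _ sf) (skew_form_linearl p _ f _ g bp sf z0 sg) (l0 g sg) addr0.
by rewrite mulrA -rmorphM mulVf ?mul1r// gt_eqF.
Qed.

End BoundedSymbols.

(** * Weak derivatives of symbols *)

Section WeakDerivatives.
Context {R : realType}.
Local Notation mR := (measurableTypeR R).
Implicit Types (p q : R * R -> R[i]) (u v : R -> R).

(** Partial derivatives of a product of one-dimensional bumps are products of the same kind, with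
    the same supporting box. *)
Inductive tensor_class (n l r l' r' : R) : (R * R -> R) -> Prop :=
| tensor_bump u v : bump_class n l r u -> bump_class n l' r' v ->
    tensor_class n l r l' r' (fun z => u z.1 * v z.2).

Lemma tensor_test n l r l' r' phi : 0 < n -> tensor_class n l r l' r' phi -> test_function phi.
Proof.
move=> n0 hphi; split.
  move=> k; apply: (Ck_of_class (tensor_class n l r l' r')) hphi => psi [u v hu hv].
    have [u' hu' du] := bump_class_deriv _ _ _ _ hu; have [v' hv' dv] := bump_class_deriv _ _ _ _ hv.
    split.
      exists (fun z => u' z.1 * v z.2); first exact: tensor_bump.
      by move=> z; apply: isd_ext (isdM _ _ _ _ _ (du z.1) (isd_cst (v z.2) z.1)) _ _ => //=; ring.
    exists (fun z => u z.1 * v' z.2); first exact: tensor_bump.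
    by move=> z; apply: isd_ext (isdM _ _ _ _ _ (isd_cst (u z.1) z.2) (dv z.2)) _ _ => //=; ring.
  have [K K0 hK] := bump_class_bounded _ _ _ _ hu; have [L L0 hL] := bump_class_bounded _ _ _ _ hv.
  by exists (K * L) => z; rewrite normrM ler_pM.
case: hphi => u v hu hv; pose M := `|l| + `|r| + `|l'| + `|r'|; exists M => z.
have out a b x : M < `|x| -> `|a| <= M -> `|b| <= M -> x <= a \/ b <= x.
  move=> Mx aM bM; have [x0|x0] := leP 0 x.
    by right; move: Mx; rewrite ger0_norm// => Mx; rewrite (le_trans (ler_norm b))// (le_trans bM)// ltW.
  left; move: Mx; rewrite ltr0_norm// => Mx; rewrite -[a]opprK lerNr.
  by rewrite (le_trans (ler_norm (- a)))// normrN (le_trans aM)// ltW.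
have a1 := normr_ge0 l; have a2 := normr_ge0 r; have a3 := normr_ge0 l'; have a4 := normr_ge0 r'.
case=> h.
  by rewrite (bump_class_supp _ _ _ _ z.1 n0 hu) ?mul0r//; apply: out h _ _; rewrite /M; lra.
by rewrite (bump_class_supp _ _ _ _ z.2 n0 hv) ?mulr0//; apply: out h _ _; rewrite /M; lra.
Qed.

Lemma locally_integrable_box p M : clocally_integrable p ->
  cintegrable leb2 (fun z => (ind (- M) M z.1 * ind (- M) M z.2)%:C * p z).
Proof.
move=> [mp /(_ M) hM].
have mI : measurable_fun setT (fun z : mR * mR => ind (- M) M z.1 * ind (- M) M z.2).
  by apply: measurable_funM; [exact: measurableT_comp (measurable_ind _ _) measurable_fst|
    exact: measurableT_comp (measurable_ind _ _) measurable_snd].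
have mB : measurable (`[- M, M] `*` `[- M, M] : set (mR * mR)) by exact: measurableX.
apply/cintegrableP; split.
  by apply: cmeasurable_mul => //; exact: cmeasurable_real.
apply: le_lt_trans hM; rewrite [leRHS]integral_mkcond; apply: ge0_le_integral => //.
- by move=> z _; rewrite lee_fin normc_ge0.
- by apply: measurable_enormc; apply: cmeasurable_mul => //; exact: cmeasurable_real.
- by apply/(measurable_restrictT _ _).1 => //; apply: measurable_funTS; exact: measurable_enormc.
move=> z _; rewrite patchE normc_mul normc_real /ind.
case: ifP => [h1|_]; last by rewrite mul0r normr0 mul0r; case: ifP => // _; rewrite lee_fin normc_ge0.
case: ifP => [h2|_]; last by rewrite mulr0 normr0 mul0r; case: ifP => // _; rewrite lee_fin normc_ge0.
rewrite ifT ?mulr1 ?normr1 ?mul1r//; rewrite inE; split => /=; rewrite in_itv/=.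
  by case/andP: h1 => /ltW -> /ltW ->.
by case/andP: h2 => /ltW -> /ltW ->.
Qed.

(** Products of two plateaus are test functions, and their pairings determine a locally integrable
    function almost everywhere. *)
Lemma weak_derivative_unique a b p q q' : weak_derivative a b p q -> weak_derivative a b p q' ->
  {ae leb2, forall z, q z = q' z}.
Proof.
move=> [_ lq eq] [_ lq' eq'].
have [mq _] := lq; have [mq' _] := lq'.
have pairing phi : test_function phi ->
    cint leb2 (fun z => (phi z)%:C * q z) = cint leb2 (fun z => (phi z)%:C * q' z).
  move=> tp; have := etrans (esym (eq phi tp)) (eq' phi tp).
  have s0 : (-1) ^+ (a + b) != 0 :> R[i] by rewrite expf_neq0// oppr_eq0 oner_eq0.
  exact: (mulfI s0).
have mpl k l r l' r' : measurable_fun setT (fun z : mR * mR => plateau k.+1%:R l r z.1 * plateau k.+1%:R l' r' z.2).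
  by apply: measurable_funM; [exact: measurableT_comp (measurable_plateau k l r) measurable_fst|
    exact: measurableT_comp (measurable_plateau k l' r') measurable_snd].
have ibox q0 k l r l' r' : clocally_integrable q0 ->
    cintegrable leb2 (fun z => (plateau k.+1%:R l r z.1 * plateau k.+1%:R l' r' z.2)%:C * q0 z).
  move=> l0; pose M := `|l| + `|r| + `|l'| + `|r'|.
  apply: (cintegrable_domc leb2 _ _ _ (locally_integrable_box q0 M l0)).
    by case: l0 => m0 _; apply: cmeasurable_mul => //; exact: cmeasurable_real.
  move=> z; rewrite !normc_mul !normc_real ler_wpM2r ?normc_ge0//.
  have a1 := ler_norm l; have a2 := ler_norm r; have a3 := ler_norm l'; have a4 := ler_norm r'.
  have b1 := ler_norm (- l); have b2 := ler_norm (- r); have b3 := ler_norm (- l'); have b4 := ler_norm (- r').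
  rewrite !normrN in b1 b2 b3 b4.
  have n1 := normr_ge0 l; have n2 := normr_ge0 r; have n3 := normr_ge0 l'; have n4 := normr_ge0 r'.
  have le_ind s e x : `|s| <= M -> `|e| <= M -> plateau k.+1%:R s e x <= ind (- M) M x.
    move=> sM eM; have /andP[_ h] := plateau_ind k s e x; apply: (le_trans h); rewrite /ind.
    case: ifP => [/andP[sx xe]|_]; last by case: ifP.
    rewrite ifT//; apply/andP; split.
      by apply: le_lt_trans sx; rewrite lerNl (le_trans _ sM)// -normrN ler_norm.
    by apply: (lt_le_trans xe); rewrite (le_trans _ eM)// ler_norm.
  rewrite !ger0_norm ?mulr_ge0 ?plateau_ge0 ?ind_ge0// ler_pM ?plateau_ge0//; apply: le_ind; rewrite /M; lra.
have re : {ae leb2, forall z, cRe (q z) - cRe (q' z) = 0}.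
  apply: zero_of_plateaus2.
  - by case: mq mq' => m1 _ [m2 _]; exact: measurable_funB.
  - move=> M; have [i1 _] := locally_integrable_box q M lq; have [i2 _] := locally_integrable_box q' M lq'.
    have := integrableB measurableT i1 i2; congr (_.-integrable _ _); apply/funext => z /=.
    by rewrite -EFinD; congr EFin; rewrite !cE /=; ring.
  - move=> k l r l' r'; have k0 : 0 < k.+1%:R :> R by rewrite ltr0n.
    have tp := tensor_test _ l r l' r' _ k0 (tensor_bump _ _ _ _ _ _ _ (plateau_bump _ l r k0) (plateau_bump _ l' r' k0)).
    have [i1 _] := ibox q k l r l' r' lq; have [i2 _] := ibox q' k l r l' r' lq'.
    have := congr1 (fun y => cRe y) (pairing _ tp); rewrite /= => h.
    have := RintegralB measurableT i1 i2; rewrite [X in _ = X - _]h subrr => <-.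
    by apply: eq_Rintegral => z _; rewrite !cE /=; ring.
have im : {ae leb2, forall z, cIm (q z) - cIm (q' z) = 0}.
  apply: zero_of_plateaus2.
  - by case: mq mq' => _ m1 [_ m2]; exact: measurable_funB.
  - move=> M; have [_ i1] := locally_integrable_box q M lq; have [_ i2] := locally_integrable_box q' M lq'.
    have := integrableB measurableT i1 i2; congr (_.-integrable _ _); apply/funext => z /=.
    by rewrite -EFinD; congr EFin; rewrite !cE /=; ring.
  - move=> k l r l' r'; have k0 : 0 < k.+1%:R :> R by rewrite ltr0n.
    have tp := tensor_test _ l r l' r' _ k0 (tensor_bump _ _ _ _ _ _ _ (plateau_bump _ l r k0) (plateau_bump _ l' r' k0)).
    have [_ i1] := ibox q k l r l' r' lq; have [_ i2] := ibox q' k l r l' r' lq'.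
    have := congr1 (fun y => cIm y) (pairing _ tp); rewrite /= => h.
    have := RintegralB measurableT i1 i2; rewrite [X in _ = X - _]h subrr => <-.
    by apply: eq_Rintegral => z _; rewrite !cE /=; ring.
by apply: (ae_imp2 leb2 _ _ _ re im) => z /eqP; rewrite subr_eq0 => /eqP e1 /eqP; rewrite subr_eq0 => /eqP e2; exact: complex_ext.
Qed.

Lemma ess_bounded q : (cLnorm leb2 +oo%E q < +oo)%E -> exists2 K : R, 0 <= K & {ae leb2, forall z, normc (q z) <= K}.
Proof.
rewrite /cLnorm unlock; case: ifPn => [_ h|].
  have aeq := ess_sup_ge leb2 (abse \o (fun z => (normc (q z))%:E)).
  move: h aeq; case: (ess_sup _ _) => [s _ h|//|_ h].
    exists `|s| => //; apply: (ae_imp leb2 _ _ h) => z /=; rewrite lee_fin => /le_trans.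
    by rewrite ger0_norm ?normc_ge0//; apply; exact: ler_norm.
  by exists 0 => //; apply: (ae_imp leb2 _ _ h) => z /=.
(* In the remaining branch of the norm the whole space has measure zero, and any bound holds almost
   everywhere. *)
rewrite -leNgt => h _; exists 0 => //; exists setT; split => //.
by apply/eqP; rewrite eq_le h measure_ge0.
Qed.

(** For an essentially bounded [q] and suitable [K], a bounded representative. As it depends on the
    value of [q] alone, it remains even in the frequency when [q] is. *)
Definition truncate K q z : R[i] := if normc (q z) <= K then q z else 0.

Lemma truncate_bounded K q : 0 <= K -> cmeasurable (q : mR * mR -> R[i]) -> bounded_symbol (truncate K q).
Proof.
move=> K0 mq; split; last first.
  by exists K => // z; rewrite /truncate; case: ifP; rewrite ?normc_zero.
have mb : measurable_fun setT (fun z : mR * mR => normc (q z) <= K).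
  by apply: measurable_fun_ler => //; exact: measurable_normc.
have [m1 m2] := mq; split.
  rewrite (_ : (fun x => _) = fun z => if normc (q z) <= K then cRe (q z) else 0).
    exact: measurable_fun_ifT.
  by apply/funext => z; rewrite /truncate; case: ifP.
rewrite (_ : (fun x => _) = fun z => if normc (q z) <= K then cIm (q z) else 0).
  exact: measurable_fun_ifT.
by apply/funext => z; rewrite /truncate; case: ifP.
Qed.

Lemma truncate_ae K q q' : {ae leb2, forall z, q z = q' z} -> {ae leb2, forall z, normc (q' z) <= K} ->
  {ae leb2, forall z, truncate K q z = q z}.
Proof. by move=> h1 h2; apply: (ae_imp2 leb2 _ _ _ h1 h2) => z e1 e2; rewrite /truncate e1 e2. Qed.

Lemma symbol_class_derivative p a b : symbol_class 1 1 p -> (a <= 1)%N -> (b <= 1)%N ->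
  exists q, weak_derivative a b p q /\ exists2 K : R, 0 <= K & {ae leb2, forall z, normc (q z) <= K}.
Proof.
move=> hp a1 b1; have : (ereal_inf [set cLnorm leb2 +oo q | q in weak_derivative a b p] < +oo)%E.
  by apply: le_lt_trans hp; apply: ereal_sup_ubound; exists a, b.
by move=> /ereal_inf_lt[_ [q wq <-] /ess_bounded hq]; exists q.
Qed.

(** [symbol_class] bounds some representative of the weak derivative; uniqueness transfers the bound
    to the given one. *)
Lemma bounded_version p q a b : symbol_class 1 1 p -> (a <= 1)%N -> (b <= 1)%N -> weak_derivative a b p q ->
  exists2 K : R, 0 <= K & {ae leb2, forall z, truncate K q z = q z}.
Proof.
move=> hp a1 b1 wq; have [q' [wq' [K K0 hK]]] := symbol_class_derivative p a b hp a1 b1.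
by exists K => //; apply: truncate_ae hK; exact: weak_derivative_unique wq wq'.
Qed.

(** Makes the bound of order [(0, 0)] in [symbol_class] apply to [p] itself. *)
Lemma weak_derivative_refl p a b q : weak_derivative a b p q -> weak_derivative 0 0 p p.
Proof. by move=> [lp _ _]; split=> // phi _; rewrite expr0 mul1r. Qed.

Lemma cint_ae_symbol (phi : R * R -> R) q q' : measurable_fun setT (phi : mR * mR -> R) ->
  cmeasurable (q : mR * mR -> R[i]) -> cmeasurable (q' : mR * mR -> R[i]) ->
  {ae leb2, forall z, q z = q' z} ->
  cint leb2 (fun z => (phi z)%:C * q z) = cint leb2 (fun z => (phi z)%:C * q' z).
Proof.
move=> mphi mq mq' h; apply: cint_ae_eq.
- by apply: cmeasurable_mul => //; exact: cmeasurable_real.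
- by apply: cmeasurable_mul => //; exact: cmeasurable_real.
- by apply: (ae_imp leb2 _ _ h) => z ->.
Qed.

Lemma Op_ae p p' (f : R -> R[i]) : cmeasurable (p : mR * mR -> R[i]) -> cmeasurable (p' : mR * mR -> R[i]) ->
  {ae leb2, forall z, p z = p' z} -> schwartz f -> ceq_ae leb (Op p f) (Op p' f).
Proof.
move=> mp mp' h sf; have [sl _] := ae_slices _ h; have mF := schwartz_cmeasurable _ (schwartz_fourier f sf).
apply: (ae_imp leb _ _ sl) => x hx; rewrite /Op; apply: cint_ae_eq.
- apply: cmeasurable_mul => //; apply: cmeasurable_mul; [exact: cmeasurable_expi|exact: cmeasurable_slice].
- apply: cmeasurable_mul => //; apply: cmeasurable_mul; [exact: cmeasurable_expi|exact: cmeasurable_slice].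
- by apply: (ae_imp leb _ _ hx) => xi ->.
Qed.

End WeakDerivatives.

(** * Boundedness of the skew part *)

Section OperatorNorm.
Context {R : realType}.
Local Notation mR := (measurableTypeR R).
Implicit Types (f g : R -> R[i]) (T : (R -> R[i]) -> R -> R[i]) (K : R).

Lemma opnorm_le T K : 0 <= K -> (forall f, inL2 f -> inL2 (T f)) ->
  (forall f, inL2 f -> nrm (T f) <= K * nrm f) -> (opnorm T <= K%:E)%E.
Proof.
move=> K0 iT nT; apply: ge_ereal_sup => _ [f [fi f1] <-].
rewrite L2normE ?lee_fin; last exact: iT.
move: f1; rewrite L2normE// lee_fin => f1.
by apply: (le_trans (nT f fi)); rewrite -[leRHS]mulr1 ler_wpM2l.
Qed.

Lemma L2norm_ge0 f : (0 <= L2norm f)%E.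
Proof. exact: Lnorm_ge0. Qed.

(** The supremum in [opnorm] is applied to [f / nrm f], [T] being homogeneous almost everywhere;
    when [nrm f = 0] the bound by [K] shows that [T f] vanishes in norm. *)
Lemma L2norm_le_opnorm T K : 0 <= K -> (forall f, inL2 f -> inL2 (T f)) ->
  (forall z f g, inL2 f -> inL2 g ->
     ceq_ae leb (T (fun x => z * f x + g x)) (fun x => z * T f x + T g x)) ->
  (forall f, inL2 f -> nrm (T f) <= K * nrm f) ->
  forall f, inL2 f -> (L2norm (T f) <= opnorm T * L2norm f)%E.
Proof.
move=> K0 iT lT nT f fi; pose zero (x : R) : R[i] := 0.
have zi : inL2 zero := schwartz_inL2 _ (@schwartz0 R).
have z2 : nsq zero = 0.
  rewrite /nsq (_ : (fun x => normc (zero x) ^+ 2) = fun=> 0); last first.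
    by apply/funext => x; rewrite /zero normc_zero expr0n.
  by rewrite /Rintegral integral0.
(* Homogeneity is linearity with a zero second summand, up to the term [T zero], which therefore has
   to vanish almost everywhere. *)
have Tz : nsq (T zero) = 0.
  have := nT zero zi; rewrite /nrm z2 sqrtr0 mulr0 => h.
  have : Num.sqrt (nsq (T zero)) == 0 by rewrite eq_le h sqrtr_ge0.
  by rewrite sqrtr_eq0 => h'; apply/eqP; rewrite eq_le h' nsq_ge0.
have Tz0 := nsq_eq0 _ (iT _ zi) Tz.
have o0 : (0 <= opnorm T)%E.
  apply: (le_trans (L2norm_ge0 (T zero))); apply: ereal_sup_ubound; exists zero => //; split=> //.
  by rewrite L2normE// /nrm z2 sqrtr0 lee_fin.
have [n0|n0] := eqVneq (nrm f) 0.
  rewrite L2normE; last exact: iT.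
  by apply: (@le_trans _ _ 0%E); [have := nT f fi; rewrite n0 mulr0|rewrite mule_ge0// L2norm_ge0].
have np : 0 < nrm f by rewrite lt_neqAle eq_sym n0 nrm_ge0.
pose a : R[i] := ((nrm f)^-1)%:C.
have na : normc a = (nrm f)^-1 by rewrite normc_real ger0_norm// invr_ge0 ltW.
have gi := inL2_scale a f fi.
have Tg : nrm (T (fun x => a * f x)) = (nrm f)^-1 * nrm (T f).
  rewrite -na -nrm_scale; last exact: iT.
  rewrite /nrm; congr Num.sqrt; apply: nsq_ae_eq; [exact: iT|by apply: inL2_scale; exact: iT|].
  have := lT a f zero fi zi; rewrite (_ : (fun x => a * f x + zero x) = fun x => a * f x); last first.
    by apply/funext => x; rewrite addr0.
  by move=> h; apply: (ae_imp2 leb _ _ _ h Tz0) => x -> ->; rewrite addr0.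
have : ((nrm (T (fun x => a * f x)%R))%:E <= opnorm T)%E.
  rewrite -L2normE; last exact: iT.
  apply: ereal_sup_ubound; exists (fun x => a * f x) => //; split=> //.
  by rewrite L2normE// nrm_scale// na mulVf.
rewrite Tg !L2normE//; last exact: iT.
move=> h; rewrite -(mulVKf n0 (nrm (T f))) EFinM muleC.
by apply: lee_wpmul2r => //; rewrite lee_fin ltW.
Qed.
End OperatorNorm.

(** * From the bound by a sum of squares to the bound by a product *)

Section SkewOperator.
Context {R : realType}.
Local Notation mR := (measurableTypeR R).

Lemma le_all_gt (A B X : R) : 0 <= A -> (forall M, B < M -> X <= A * M) -> X <= A * B.
Proof.
move=> A0 h; apply/ler_addgt0Pr => e e0.
have d0 : 0 < e / (A + 1) by rewrite divr_gt0// ltr_wpDl.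
have := h (B + e / (A + 1)); rewrite ltrDl => /(_ d0) /le_trans; apply.
by rewrite mulrDr lerD2l mulrCA ler_piMr ?(ltW e0)// ler_pdivrMr ?ltr_wpDl// mul1r lerDl ler01.
Qed.

Lemma averaging_constant_ge0 (eps : R) : 0 < eps -> eps < 1 -> 0 <= averaging_constant eps.
Proof.
move=> e0 e1; have m2 := ltW (weight_mass2_gt0 eps e0 e1).
rewrite /averaging_constant !mulr_ge0 ?invr_ge0 ?addr_ge0//.
by apply: Rintegral_ge0 => x _; exact: weight_ge0.
Qed.

(** The bound by a sum of squares, applied to [sqrt t f] and [g / sqrt t], is optimised over [t] by
    [le_sqrt_mul]. At the optimum the two squares are equal, whence the factor 2. *)
Lemma skew_form_bounded (p q q' : R * R -> R[i]) (eps M : R) : 0 < eps -> eps < 1 -> 0 <= M ->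
  bounded_symbol p -> (forall x xi, p (x, - xi) = p (x, xi)) -> bounded_symbol q ->
  weak_partial12 p q -> {ae leb2, forall z, q z = q' z} -> cmeasurable (q' : mR * mR -> R[i]) ->
  {ae leb, forall zeta, (sobolev_norm (1 + eps) (fun x => q' (x, zeta)) <= M%:E)%E} ->
  forall f g, schwartz f -> schwartz g ->
  normc (skew_form p f g) <= 2 * (averaging_constant eps * M) * nrm f * nrm g.
Proof.
move=> e0 e1 M0 bp pe bq pq qq' mq' hM f g sf sg.
have [c c0 [inv pl]] := @inversion_plancherel R.
have A0 := averaging_constant_ge0 eps e0 e1.
have step f' g' : schwartz f' -> schwartz g' ->
    normc (skew_form p f' g') <= averaging_constant eps * M * (nsq f' + nsq g').
  (* The preceding estimate asks for a strict bound on the Sobolev norms, so it is used for every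
     [M' > M]. *)
  move=> sf' sg'; rewrite mulrAC; apply: le_all_gt; first by rewrite mulr_ge0 ?addr_ge0 ?nsq_ge0.
  move=> M' MM'; rewrite mulrAC; have M'0 : 0 < M' by exact: le_lt_trans MM'.
  apply: (skew_form_le c c0 inv pl p q q' eps M' f' g') => //.
  by apply: (ae_imp leb _ _ hM) => zeta h; apply: (le_lt_trans h); rewrite lte_fin.
set D := averaging_constant eps * M in step *; have D0 : 0 <= D by exact: mulr_ge0.
clearbody D.
have h : normc (skew_form p f g) / 2 <= Num.sqrt (D * nsq f) * Num.sqrt (D * nsq g).
  apply: le_sqrt_mul => [||t t0]; try by rewrite mulr_ge0 ?nsq_ge0.
  have s0 : 0 < Num.sqrt t by rewrite sqrtr_gt0.
  have st : Num.sqrt t ^+ 2 = t by rewrite sqr_sqrtr// ltW.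
  have := step _ _ (schwartz_scale (Num.sqrt t)%:C f sf) (schwartz_scale ((Num.sqrt t)^-1)%:C g sg).
  rewrite (skew_form_scale p f g _ bp sf sg s0) !nsq_scale; try exact: schwartz_inL2.
  rewrite !normc_real !real_normK ?num_real// exprVn st.
  by move=> h; rewrite mulrCA divff// mulr1; apply: (le_trans h); rewrite mulrDr !(mulrCA D).
move: h; rewrite !sqrtrM// mulrACA -expr2 sqr_sqrtr// ler_pdivrMr// -/(nrm f) -/(nrm g).
by congr (_ <= _); ring.
Qed.

End SkewOperator.

Section SobolevNorms.
Context {R : realType}.

Lemma fourier_weighted_norm_ge0 (w : R -> R) (g : R -> R[i]) : (0 <= fourier_weighted_norm w g)%E.
Proof. by apply: le_ereal_inf_tmp => _ [G _ <-]; exact: L2norm_ge0. Qed.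

Lemma leb_setT_gt0 : (0 < @leb R [set: R])%E.
Proof.
rewrite -set_itvNyy; rewrite [ltRHS](@lebesgue_measure_itv R `]-oo, +oo[) /=.
by rewrite ltry.
Qed.

End SobolevNorms.

Theorem theorem5p3 (R : realType) (eps : R) (eps_gt0 : 0 < eps)
    (eps_lt1 : eps < 1) :
  exists C : R, 0 < C /\
    forall p q : R * R -> R[i],
      symbol_class 1 1 p ->
      (forall x xi : R, p (x, - xi) = p (x, xi)) ->
      weak_derivative 1 1 p q ->
      (ess_sup leb (fun xi : R =>
         sobolev_norm (- eps) (fun x => q (x, xi)) +
         sobolev_norm (1 + eps) (fun x => q (x, xi))) < +oo)%E ->
      exists T : (R -> R[i]) -> R -> R[i],
        [/\ is_Op_skew p T,
            forall f : R -> R[i], inL2 f ->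
              (L2norm (T f) <= opnorm T * L2norm f)%E &
            (opnorm T <= C%:E * ess_sup leb (fun xi : R =>
               hom_sobolev_norm (- eps) (fun x => q (x, xi)) +
               sobolev_norm (1 + eps) (fun x => q (x, xi))))%E].
Proof.
have A0 : 0 <= averaging_constant eps :> R by exact: averaging_constant_ge0.
(* The averaging constant is only recorded as nonnegative; adding 1 makes the final constant
   positive. *)
have C0 : 0 < 2 * averaging_constant eps + 1 by apply: ltr_wpDl => //; exact: mulr_ge0.
exists (2 * averaging_constant eps + 1); split=> //.
move=> p q hp pe wq hq.
pose sob (xi : R) := sobolev_norm (1 + eps) (fun x => q (x, xi)).
have [M M0 eM] : exists2 M : R, 0 <= M & ess_sup leb sob = M%:E.
  have h : (ess_sup leb sob < +oo)%E.
    apply: le_lt_trans hq; apply: le_ess_sup; apply: aeW => xi.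
    by rewrite leeDr// fourier_weighted_norm_ge0.
  have h0 : (0 <= ess_sup leb sob)%E.
    by apply: ess_sup_gee; [exact: leb_setT_gt0|apply: aeW => xi; exact: fourier_weighted_norm_ge0].
  by move: h h0; case: (ess_sup _ _) => // M _; rewrite lee_fin => M0; exists M.
have sobM : {ae leb, forall xi, (sob xi <= M%:E)%E} by rewrite -eM; exact: ess_sup_ge.
(* The homogeneous norm is nonnegative, so the essential supremum in the conclusion dominates
   [M]. *)
have homM : (M%:E <= ess_sup leb (fun xi => hom_sobolev_norm (- eps) (fun x => q (x, xi)) + sob xi))%E.
  rewrite -eM; apply: le_ess_sup; apply: aeW => xi.
  by rewrite leeDr// fourier_weighted_norm_ge0.
have [[mp _] [mq _] dq] := wq.
have [K K0 pK] := bounded_version p p 0 0 hp isT isT (weak_derivative_refl p 1 1 q wq).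
have [L L0 qL] := bounded_version p q 1 1 hp isT isT wq.
(* A bounded frequency derivative of [p], from which [Op_inL2] derives the decay of [Op p' f]. *)
have [r [wr [N N0 rN]]] := symbol_class_derivative p 0 1 hp isT isT.
have [_ [mr _] dr] := wr.
have rN' : {ae leb2, forall z, truncate N r z = r z} by apply: truncate_ae rN; exact: aeW.
(* Representatives bounded everywhere, for which all pairings converge absolutely; the operators
   change only on null sets. *)
pose p' := truncate K p; pose q' := truncate L q; pose r' := truncate N r.
have bp : bounded_symbol p' := truncate_bounded K p K0 mp.
have bq : bounded_symbol q' := truncate_bounded L q L0 mq.
have br : bounded_symbol r' := truncate_bounded N r N0 mr.
have pe' x xi : p' (x, - xi) = p' (x, xi) by rewrite /p' /truncate pe.
have w2 : weak_partial2 p' r'.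
  move=> phi tphi mphi m2; have := dr phi tphi.
  rewrite (cint_ae_symbol _ _ _ m2 bp.1 mp pK) (cint_ae_symbol _ _ _ mphi br.1 mr rN') /= expr1 mulN1r.
  by [].
have w12 : weak_partial12 p' q'.
  move=> phi tphi mphi m12; have := dq phi tphi.
  rewrite (cint_ae_symbol _ _ _ m12 bp.1 mp pK) (cint_ae_symbol _ _ _ mphi bq.1 mq qL) /= sqrrN expr1n mul1r.
  by [].
pose B := 2 * (averaging_constant eps * M); have B0 : 0 <= B by apply: mulr_ge0 => //; exact: mulr_ge0.
have bB : forall f g : R -> R[i], schwartz f -> schwartz g -> normc (skew_form p' f g) <= B * nrm f * nrm g.
  exact: (skew_form_bounded p' q' q eps M).
have [T [iT lT nT TE]] := bilinear_operator (skew_form p') B B0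
  (fun z f f' g => skew_form_linearl p' z f f' g bp) (fun z f g g' => skew_form_linearr p' z f g g' bp) bB.
have oT := opnorm_le T B B0 iT nT.
exists T; split.
- split; first by split=> //; apply: (le_lt_trans oT); rewrite ltry.
  move=> f sf; have [c c0 [inv _]] := @inversion_plancherel R.
  have iO := Op_inL2 c c0 inv p' r' f bp br w2 sf.
  have iTf := iT f (schwartz_inL2 f sf).
  (* The transpose applied to [f] is obtained as the difference of two functions in L^2, and the
     pairing identity satisfied by [T] says that it is the transpose. *)
  exists (fun x => Op p' f x - T f x); split; last first.
    apply: (ae_imp leb _ _ (Op_ae p' p f bp.1 mp pK sf)) => x e.
    by rewrite -e opprB addrCA subrr addr0.
  split; first exact: inL2_sub.
  move=> psi spsi; have ipsi := schwartz_inL2 psi spsi.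
  have i1 := cintegrable_mulL2 _ _ iO ipsi; have i2 := cintegrable_mulL2 _ _ iTf ipsi.
  transitivity (cint leb (fun x => f x * Op p' psi x)).
    transitivity (cint leb (fun x => Op p' f x * psi x) - cint leb (fun x => T f x * psi x)).
      by rewrite -(cint_sub _ _ _ i1 i2); apply: eq_cint => x; rewrite mulrBl.
    by rewrite TE// /skew_form opprB addrCA subrr addr0.
  have mF := schwartz_cmeasurable _ (schwartz_fourier psi spsi).
  apply: cint_ae_eq.
  - by apply: cmeasurable_mul; [exact: schwartz_cmeasurable|apply: cmeasurable_opw => //; [exact: bp.1|exact: schwartz_fourier]].
  - by apply: cmeasurable_mul; [exact: schwartz_cmeasurable|apply: cmeasurable_opw => //; exact: schwartz_fourier].
  - by apply: (ae_imp leb _ _ (Op_ae p' p psi bp.1 mp pK spsi)) => x ->.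
- exact: L2norm_le_opnorm B0 iT lT nT.
- apply: (le_trans oT); apply: (@le_trans _ _ ((2 * averaging_constant eps + 1)%:E * M%:E)%E).
    by rewrite -EFinM lee_fin /B mulrA ler_wpM2r// lerDl.
  by apply: lee_wpmul2l => //; rewrite lee_fin ltW.
Qed.
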